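(* Let $X:g=0$ be a reduced curve of degree $d$ in $\mathbb{C}^2$ and let $C:f=0$ be its closure in $\mathbb{P}^2$, where $f$ is the degree $d$ homogenization of $g$. Then $$\tau(X)\le\tau(C),$$ and the equality holds exactly when the curve $C$ has no singularities on the line at infinity $L_0:x_0=0$. Moreover, $$\tau(X)\le\tau(d,r)_{max},$$ where $r=mdr(g)=mdr(f)$. In addition, this last inequality is an equality if and only if the curve $C$ has no singularities on the line at infinity $L_0$ and $C$ is either free when $r<d/2$, or maximal Tjurina when $r\ge d/2$.
   Context: $R=\mathbb{C}[x_1,x_2]$, $S=\mathbb{C}[x_0,x_1,x_2]$; $g\in R$ is nonconstant and reduced of degree $d$, and $f=x_0^dg(x_1/x_0,x_2/x_0)\in S$. Subscripts on $f,g$ denote partial derivatives. For a reduced curve $Y$ (affine or projective), $\tau(Y)$ is the total Tjurina number, i.e. the sum over the singular points $p$ of $Y$ of the local Tjurina numbers $\tau(Y,p)=\dim_{\mathbb{C}}\mathcal{O}_2/(h,\partial_1h,\partial_2h)$, where $h=0$ is a local equation of $Y$ at $p$ and $\mathcal{O}_2$ is the ring of analytic germs at the origin of $\mathbb{C}^2$. $AR(f)=\{(a_0,a_1,a_2)\in S^3 : a_0f_0+a_1f_1+a_2f_2=0\}$, graded so that $AR(f)_s$ consists of the syzygies with entries homogeneous of degree $s$; $mdr(f)=\min\{r : AR(f)_r\ne0\}$. $AR(g)=\{(\alpha_0,\alpha_1,\alpha_2)\in R^3 : \alpha_0g+\alpha_1g_1+\alpha_2g_2=0\}$; for nonzero $\rho'=(\alpha_0,\alpha_1,\alpha_2)\in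 AR(g)$, $sdeg(\rho')=\max\{\deg\alpha_0,\deg(d\alpha_1+x_1\alpha_0),\deg(d\alpha_2+x_2\alpha_0)\}$ with $\deg 0=-\infty$; $mdr(g)$ is the minimal value of $sdeg$ on nonzero elements of $AR(g)$. It is known that $mdr(g)=mdr(f)\le d-1$. Define $\tau(d,r)_{max}=(d-1)(d-r-1)+r^2$ if $r<d/2$, and $\tau(d,r)_{max}=(d-1)(d-r-1)+r^2-\binom{2r-d+2}{2}$ if $d/2\le r\le d-1$. The curve $C:f=0$ is free if the graded $S$-module $AR(f)$ is free. A reduced curve $C:f=0$ of degree $d$ with $r=mdr(f)\ge d/2$ is called maximal Tjurina if $\tau(C)=\tau(d,r)_{max}$. *)

(* Defs.v *)
(* The complex numbers are R[i] for an arbitrary R : realType. *)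
From HB Require Import structures.
From mathcomp Require Import all_boot all_order all_algebra.
From mathcomp Require Import complex mpoly.
From mathcomp Require Import classical_sets reals constructive_ereal.
From mathcomp Require Import ereal esum.

Set Implicit Arguments.
Unset Strict Implicit.
Unset Printing Implicit Defensive.

Import Order.TTheory GRing.Theory Num.Theory.
Local Open Scope classical_set_scope.
Local Open Scope ring_scope.
Local Open Scope complex_scope.

(* Minimum of a set of naturals; the value 0 on the empty set is a
   convention that is never reached below, the sets considered for a
   nonconstant polynomial being nonempty. *)
Definition least (P : set nat) : nat :=
  xget 0%N [set n | P n /\ forall m, P m -> (n <= m)%N].

Section Polynomials.
Context {R : realType}.
Local Notation C := R[i].

(* Total degree; equal to 0 for constants, including 0. *)
Definition deg n (p : {mpoly C[n]}) : nat := (msize p).-1.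

(* No repeated factor. *)
Definition reduced n (p : {mpoly C[n]}) : Prop :=
  p != 0 /\ forall h q : {mpoly C[n]}, p = h ^+ 2 * q -> deg h = 0%N.

(* x_0^d g(x_1/x_0, x_2/x_0) with d = deg g: the monomial x_1^a x_2^b of g
   becomes x_0^(d-a-b) x_1^a x_2^b, and the truncated subtraction is exact. *)
Definition homogenize (g : {mpoly C[2]}) : {mpoly C[3]} :=
  \sum_(m <- msupp g)
    g@_m *: 'X_[[multinom (if unlift ord0 i is Some k then m k
                           else deg g - mdeg m)%N | i < 3]].

(* Syzygies of a homogeneous f among its first order partial derivatives. *)
Definition AR_proj (f : {mpoly C[3]}) : set 'rV[{mpoly C[3]}]_3 :=
  [set a | \sum_(i < 3) a ord0 i * mderiv i f = 0].

Definition AR_proj_deg (f : {mpoly C[3]}) (s : nat) : set 'rV[{mpoly C[3]}]_3 :=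
  [set a | AR_proj f a /\ forall i, a ord0 i \is s.-homog].

Definition mdr_proj (f : {mpoly C[3]}) : nat :=
  least [set r | exists a, AR_proj_deg f r a /\ a != 0].

(* Syzygies (alpha_0, alpha_1, alpha_2) of g, g_1, g_2; the partial derivative
   with respect to the k-th variable of C^2 (k = 0, 1) goes with the
   coefficient of index k + 1. *)
Definition AR_aff (g : {mpoly C[2]}) : set 'rV[{mpoly C[2]}]_3 :=
  [set a | a ord0 ord0 * g
           + \sum_(k < 2) a ord0 (lift ord0 k) * mderiv k g = 0].

(* As msize is the degree plus one, and 0 at 0, taking the predecessor after
   the maximum implements deg 0 = -oo; for a <> 0 and d > 0 the maximum is
   positive. *)
Definition sdeg (d : nat) (a : 'rV[{mpoly C[2]}]_3) : nat :=
  (maxn (msize (a ord0 ord0))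
        (\max_(k < 2) msize (a ord0 (lift ord0 k) *+ d
                             + 'X_k * a ord0 ord0))).-1.

Definition mdr_aff (g : {mpoly C[2]}) : nat :=
  least [set s | exists a, [/\ AR_aff g a, a != 0 & sdeg (deg g) a = s]].

(* Freeness of the S-module AR(f): a basis is given by the rows of b.  Only
   finite bases need to be considered since AR(f) is finitely generated. *)
Definition free_curve (f : {mpoly C[3]}) : Prop :=
  exists (n : nat) (b : 'M[{mpoly C[3]}]_(n, 3)),
    (forall k, AR_proj f (row k b)) /\
    (forall a, AR_proj f a -> exists! c : 'rV[{mpoly C[3]}]_n, a = c *m b).

End Polynomials.

Section Germs.
Context {R : realType}.
Local Notation C := R[i].

(* Power series in two variables; u i j is the coefficient of x^i y^j. *)
Definition series : Type := nat -> nat -> C.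

(* Absolute convergence on some polydisc of radius r > 0 around the origin:
   O_2 is the ring of the convergent power series. *)
Definition convergent (u : series) : Prop :=
  exists r M : R, 0 < r /\
    forall n : nat,
      \sum_(i < n) \sum_(j < n) `|u i j| * (r ^+ (i + j))%:C <= M%:C.

Definition series_mul (u v : series) : series := fun i j =>
  \sum_(k < i.+1) \sum_(l < j.+1) u k l * v (i - k)%N (j - l)%N.

Definition series_d1 (u : series) : series := fun i j => i.+1%:R * u i.+1 j.
Definition series_d2 (u : series) : series := fun i j => j.+1%:R * u i j.+1.

Definition series_of_mpoly (p : {mpoly C[2]}) : series :=
  fun i j => p@_[multinom [tuple i; j]].

(* The ideal (h, d_1 h, d_2 h) of O_2. *)
Definition tjurina_ideal (h : series) : set series :=
  [set u | exists a b c : series,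
    [/\ convergent a, convergent b, convergent c &
      forall i j, u i j = series_mul a h i j + series_mul b (series_d1 h) i j
                          + series_mul c (series_d2 h) i j]].

(* Linear independence over C of the classes modulo I. *)
Definition independent_mod (I : set series) n (u : 'I_n -> series) : Prop :=
  forall c : 'I_n -> C,
    I (fun i j => \sum_(k < n) c k * u k i j) -> forall k, c k = 0.

(* dim_C O_2 / (h, d_1 h, d_2 h), as an element of {0, 1, ..., +oo}. *)
Definition local_tjurina (h : series) : \bar R :=
  ereal_sup [set n%:R%:E | n in
    [set n : nat | exists u : 'I_n -> series,
       (forall k, convergent (u k)) /\
       independent_mod (tjurina_ideal h) u]].

End Germs.

Section Curves.
Context {R : realType}.
Local Notation C := R[i].

Definition sing_aff (g : {mpoly C[2]}) : set 'rV[C]_2 :=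
  [set p | g.@[p ord0] = 0 /\ forall i, (mderiv i g).@[p ord0] = 0].

Definition local_eq_aff (g : {mpoly C[2]}) (p : 'rV[C]_2) : {mpoly C[2]} :=
  g \mPo [tuple (p ord0 i)%:MP + 'X_i | i < 2].

Definition tau_aff (g : {mpoly C[2]}) : \bar R :=
  \esum_(p in sing_aff g) local_tjurina (series_of_mpoly (local_eq_aff g p)).

(* Index of the first nonzero homogeneous coordinate (2 for the zero vector). *)
Definition chart (p : 'rV[C]_3) : 'I_3 :=
  if p ord0 0 != 0 then 0 else if p ord0 1 != 0 then 1 else ord_max.

(* Every point of the projective plane has exactly one vector of homogeneous
   coordinates whose first nonzero coordinate is 1. *)
Definition P2 : Type := {p : 'rV[C]_3 | p ord0 (chart p) == 1}.
HB.instance Definition _ := Choice.on P2.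
Definition coord (p : P2) (i : 'I_3) : C := val p ord0 i.

Definition sing_proj (f : {mpoly C[3]}) : set P2 :=
  [set p | f.@[coord p] = 0 /\ forall i, (mderiv i f).@[coord p] = 0].

(* Equation of f = 0 in the affine chart x_j = 1, where j = chart p, with p
   moved to the origin. *)
Definition local_eq_proj (f : {mpoly C[3]}) (p : P2) : {mpoly C[2]} :=
  f \mPo [tuple (if unlift (chart (val p)) i is Some k
                 then (coord p i)%:MP + 'X_k else 1) | i < 3].

Definition tau_proj (f : {mpoly C[3]}) : \bar R :=
  \esum_(p in sing_proj f) local_tjurina (series_of_mpoly (local_eq_proj f p)).

Definition smooth_at_infinity (f : {mpoly C[3]}) : Prop :=
  forall p : P2, coord p 0 = 0 -> ~ sing_proj f p.

End Curves.

(* The second formula is meant for d/2 <= r <= d - 1. *)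
Definition tau_max (d r : nat) : int :=
  let t := (d%:Z - 1) * (d%:Z - r%:Z - 1) + r%:Z ^+ 2 in
  if (r.*2 < d)%N then t else t - 'C(r.*2 - d + 2, 2)%:Z.

Definition maximal_tjurina {R : realType} (f : {mpoly R[i][3]}) : Prop :=
  (deg f <= (mdr_proj f).*2)%N /\
  tau_proj f = ((tau_max (deg f) (mdr_proj f))%:~R)%:E.

(* Main.v *)
(* Write f_i for the partial derivatives of f, J for the ideal they generate in
   S = C[x_0, x_1, x_2], and r = mdr(f).  Since g is reduced, the f_i have no
   common factor, and neither do the entries of a minimal syzygy a.  For b in
   AR(f)_s the cross product a x b is h (f_0, f_1, f_2) with h of degree
   s + r - d + 1, and b |-> h has kernel S_(s-r) a, whence dim AR(f)_s <=
   dim S_(s-r) + dim S_(s+r-d+1) and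
   dim (S/J)_(s+d-1) <= (d-1)(d-r-1) + r^2 for large s.  When 2 r >= d, the
   multiples l^j h with deg h = 2 r - d are never reached for a general linear
   form l, because l can be divided out of a x b = l h (f_0, f_1, f_2) by
   restricting to the line l = 0, and a x b = h (f_0, f_1, f_2) with
   deg b < r is impossible; this gives the correction term.  Equality in the
   first bound means that l^j is reached, hence that a x b = (f_0, f_1, f_2)
   for some b in AR(f)_(d-1-r), which is freeness (Saito's criterion).

   Interpolation at the singular points, whose local ideals contain powers of
   the coordinates, gives tau(C) <= dim (S/J)_k for large k.  If C is smooth
   on x_0 = 0 and a x b = c (f_0, f_1, f_2), then x_0 is a nonzerodivisor
   modulo J, so a form of degree k whose germs at all the affine singular
   points lie in the local Tjurina ideals lies in J, and
   dim (S/J)_k <= tau(X). *)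
Require Import Defs.
From HB Require Import structures.
From mathcomp Require Import all_boot all_order all_algebra.
From mathcomp Require Import complex mpoly.
From mathcomp Require Import classical_sets reals constructive_ereal.
From mathcomp Require Import ereal esum.
From mathcomp Require Import boolp cardinality fsbigop separable.
From mathcomp Require Import ring lra zify.

Set Implicit Arguments.
Unset Strict Implicit.
Unset Printing Implicit Defensive.

Local Open Scope ring_scope.
Local Open Scope complex_scope.
Import Order.TTheory GRing.Theory Num.Theory.

(** Coprimality is expressed by [thin]: an ideal of C[x_0, x_1] that contains a nonzero polynomial
    in each variable alone. Such eliminants come from Bezout identities over C(x_k). They make
    quotients of parallel vectors polynomial, they confine zeros to a finite grid, and, since a
    linear factor with nonzero root is a unit of O_2, they put powers of the variables in the local
    ideals. Convergent series are thereby reduced to polynomials of bounded bidegree, where linear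
    algebra suffices. The upper bound for tau(C) is proved with an arbitrary integer B that bounds
    dim (S/J)_k for large k. This gives finiteness of the local Tjurina numbers and, with B one less
    than the maximum, turns a strict inequality of dimensions into a strict inequality for tau(C),
    which yields freeness by contradiction. In the other direction, a basis of AR(f) is not given as
    homogeneous, nor as having two elements; both have to be recovered before degrees can be
    counted. *)

(** * Bivariate polynomials as polynomials in one variable over the other *)

Section Bipoly.
Variable C : comNzRingType.
Implicit Types (P Q H : {poly {poly C}}) (p q : {mpoly C[2]}).

(* The isomorphism C[x_0, x_1] = C[x_k][x_k'] with k' the other index. *)
Definition bipoly (k : 'I_2) : {mpoly C[2]} -> {poly {poly C}} :=
  mmap (polyC \o polyC) (fun l : 'I_2 => if l == k then 'X%:P else 'X).
Lemma bipoly_is_additive k : additive (bipoly k).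
Proof. exact: mmap_is_additive. Qed.
Lemma bipoly_is_multiplicative k : multiplicative (bipoly k).
Proof. exact: mmap_is_multiplicative. Qed.
HB.instance Definition _ k :=
  GRing.isAdditive.Build _ _ (bipoly k) (bipoly_is_additive k).
HB.instance Definition _ k :=
  GRing.isMultiplicative.Build _ _ (bipoly k) (bipoly_is_multiplicative k).

Definition bimonom (k : 'I_2) (i j : nat) : 'X_{1..2} :=
  [multinom if l == k then i else j | l < 2].

Definition other (k : 'I_2) : 'I_2 := if k == 0 then 1 else 0.

Lemma otherP (k l : 'I_2) : (l == other k) = (l != k).
Proof. by move: k l; do 2 case=> [[|[|[]]]] //= ?. Qed.

Lemma other_neq k : (other k == k) = false.
Proof. by apply/negbTE; rewrite -otherP. Qed.

Lemma bimonomE k (m : 'X_{1..2}) : m = bimonom k (m k) (m (other k)).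
Proof.
apply/mnmP=> l; rewrite mnmE; case: eqVneq => [-> //|].
by rewrite -otherP => /eqP ->.
Qed.

Lemma bimonom_k k i j : bimonom k i j k = i.
Proof. by rewrite mnmE eqxx. Qed.

Lemma bimonom_other k i j : bimonom k i j (other k) = j.
Proof. by rewrite mnmE other_neq. Qed.

Lemma bipolyC k c : bipoly k c%:MP = c%:P%:P.
Proof. exact: mmapC. Qed.

Lemma bipolyX k l : bipoly k 'X_l = if l == k then 'X%:P else 'X.
Proof. by rewrite /bipoly mmapX mmap1U. Qed.

Lemma bipolyXm k m : bipoly k 'X_[m] = ('X ^+ m k)%:P * 'X ^+ m (other k).
Proof.
rewrite /bipoly mmapX /mmap1 (bigD1 k) //= eqxx (bigD1 (other k)) ?other_neq //=.
rewrite big1 ?mulr1 ?rmorphXn // => i /andP[].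
by rewrite -otherP => ->.
Qed.

Lemma coef_bipoly k p i j : (bipoly k p)`_j`_i = p@_(bimonom k i j).
Proof.
rewrite [p in LHS]mpolyE raddf_sum /= !coef_sum [p in RHS]mpolyE raddf_sum /=.
apply: eq_bigr => m _; rewrite mcoeffZ mcoeffX -mul_mpolyC rmorphM /=.
rewrite bipolyC bipolyXm !coefCM coefXn; congr (_ * _).
have -> : (m == bimonom k i j) = (i == m k) && (j == m (other k)).
  apply/eqP/andP=> [->|[/eqP-> /eqP->]]; last exact: bimonomE.
  by rewrite bimonom_k bimonom_other !eqxx.
by case: (j == _); rewrite ?mulr1 ?mulr0 ?coef0 ?andbF ?andbT // coefXn.
Qed.

Lemma bipoly_inj k : injective (bipoly k).
Proof.
move=> p q e; apply/mpolyP=> m.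
by rewrite (bimonomE k m) -!coef_bipoly e.
Qed.

Lemma bipoly_surj k P : exists p, bipoly k p = P.
Proof.
exists (\sum_(j < size P) \sum_(i < size P`_j) P`_j`_i *: 'X_[bimonom k i j]).
rewrite raddf_sum /= -[RHS]coefK poly_def; apply: eq_bigr => j _.
rewrite raddf_sum /= -[in RHS](coefK P`_j) poly_def -mul_polyC rmorph_sum mulr_suml.
apply: eq_bigr => i _; rewrite -mul_mpolyC rmorphM /= bipolyC bipolyXm.
by rewrite bimonom_k bimonom_other mulrA -polyCM (mul_polyC P`_j`_i).
Qed.

Lemma deriv_bipoly k p : (bipoly k p)^`() = bipoly k (mderiv (other k) p).
Proof.
apply/polyP=> j; apply/polyP=> i; rewrite coef_deriv coefMn !coef_bipoly.
rewrite mcoeff_deriv bimonom_other; congr (_@_ _ *+ _).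
apply/mnmP=> l; rewrite mnmDE mnm1E !mnmE; have := otherP k l.
by rewrite eq_sym; case: (l == k) => ->; rewrite ?addn0 ?addn1.
Qed.

Definition univ (k : 'I_2) (D : {poly C}) : {mpoly C[2]} :=
  (map_poly (mpolyC 2 (R := C)) D).['X_k].

Lemma univE k D : univ k D = \sum_(i < size D) D`_i *: 'X_k ^+ i.
Proof.
rewrite /univ horner_coef size_map_inj_poly //; last exact: can_inj (@mpolyCK _ _).
by apply: eq_bigr => i _; rewrite coef_map /= mul_mpolyC.
Qed.

Lemma bipoly_univ k D : bipoly k (univ k D) = D%:P.
Proof.
rewrite univE raddf_sum /= -[in RHS](coefK D) poly_def rmorph_sum.
apply: eq_bigr => i _; rewrite -mul_mpolyC rmorphM rmorphXn /= bipolyC bipolyX eqxx.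
by rewrite -rmorphXn -mul_polyC polyCM.
Qed.

Lemma bipoly_univ_other k D : bipoly k (univ (other k) D) = map_poly polyC D.
Proof.
rewrite univE raddf_sum /= -[in RHS](coefK D) poly_def rmorph_sum.
apply: eq_bigr => i _; rewrite -mul_mpolyC rmorphM rmorphXn /= bipolyC bipolyX.
by rewrite other_neq /= -[D`_i *: _]mul_polyC rmorphM rmorphXn /= map_polyC map_polyX.
Qed.

End Bipoly.

(** * Elimination and coprimality in two variables *)

Section BivariateElimination.
Variable C : numClosedFieldType.
Implicit Types (P Q H : {poly {poly C}}) (p q : {mpoly C[2]}).

Definition xeval (a : C) : {poly {poly C}} -> {poly C} := map_poly (horner_eval a).
HB.instance Definition _ a := GRing.RMorphism.copy (xeval a) (map_poly (horner_eval a)).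

(** This is primitivity over C[x]: the field being algebraically closed, a nonconstant common factor
    of the coefficients would have a root, and the specialization at this root would vanish. *)
Definition xprimitive P := forall a, xeval a P != 0.

Lemma xevalC a (c : {poly C}) : xeval a c%:P = (c.[a])%:P.
Proof. by rewrite /xeval map_polyC. Qed.

Lemma xeval_map_polyC a (D : {poly C}) : xeval a (map_poly polyC D) = D.
Proof. by apply/polyP=> i; rewrite !coef_map /= /horner_eval hornerC. Qed.

Lemma xevalZ a (c : {poly C}) P : xeval a (c *: P) = c.[a] *: xeval a P.
Proof. by rewrite -[c *: P]mul_polyC rmorphM /= xevalC mul_polyC. Qed.

Lemma xeval0_factor a P : xeval a P = 0 -> exists Q, P = ('X - a%:P) *: Q.
Proof.
move=> P0; exists (map_poly (fun c => c %/ ('X - a%:P)) P).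
apply/polyP=> i; rewrite coefZ coef_map_id0 ?div0p // mulrC divpK //.
have Pi0 : (xeval a P)`_i = 0 by rewrite P0 coef0.
by rewrite dvdp_XsubCl; apply/rootP; rewrite -Pi0 coef_map.
Qed.

Lemma poly_root_factor (c : {poly C}) : (1 < size c)%N ->
  exists a c', c = ('X - a%:P) * c'.
Proof.
move=> c1; have /closed_rootP[a /factor_theorem[q ->]] : size c != 1%N by case: (size c) c1 => [|[]].
by exists a, q; rewrite mulrC.
Qed.

(** Linear factors ['X - a] are removed one at a time; each removal lowers the degree of the leading
    coefficient, which bounds their number. *)
Lemma xprimitive_decomposition P : P != 0 ->
  exists c Q, [/\ c != 0, P = c *: Q & xprimitive Q].
Proof.
have [n] := ubnP (size (lead_coef P)); elim: n P => // n IHn P ltn P0.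
have [prim|] := pselect (xprimitive P).
  by exists 1, P; rewrite scale1r oner_neq0.
move=> /existsNP[a] /negP; rewrite negbK => /eqP /xeval0_factor[Q PQ].
have Q0 : Q != 0 by apply: contraNneq P0 => Q0; rewrite PQ Q0 scaler0.
have X0 : 'X - a%:P != 0 by rewrite polyXsubC_eq0.
have ltQ : (size (lead_coef Q) < n)%N.
  by move: ltn; rewrite PQ lead_coefZ size_mul ?lead_coef_eq0 ?X0 // size_XsubC.
have [c [Q' [c0 QQ' prim]]] := IHn Q ltQ Q0; exists (('X - a%:P) * c), Q'.
by rewrite mulf_neq0 // -scalerA -QQ'.
Qed.

(* Gauss' lemma, C[x] having only linear primes. *)
Lemma xprimitive_dvd (c : {poly C}) H P Q : c != 0 -> xprimitive H ->
  c *: P = H * Q -> exists Q', P = H * Q'.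
Proof.
have [n] := ubnP (size c); elim: n c Q => // n IHn c Q ltn c0 primH e.
have [|c1] := leqP (size c) 1.
  move/size1_polyC=> ec; move: c0 e; rewrite ec polyC_eq0 => a0 e.
  exists ((c`_0)^-1%:P *: Q).
  by rewrite -scalerAr -e scalerA -polyCM mulVf // scale1r.
have [a [c' ec]] := poly_root_factor c1.
have X0 : 'X - a%:P != 0 by rewrite polyXsubC_eq0.
have : xeval a H * xeval a Q = 0.
  by rewrite -rmorphM /= -e xevalZ ec hornerM !hornerE subrr mul0r scale0r.
move/eqP; rewrite mulf_eq0 (negPf (primH a)) => /eqP /xeval0_factor[Q1 eQ].
have c'0 : c' != 0 by apply: contraNneq c0; rewrite ec => ->; rewrite mulr0.
apply: (IHn c' Q1) => //.
  by move: ltn; rewrite ec size_mul ?X0 // size_XsubC.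
have X0' : ('X - a%:P)%:P != 0 :> {poly {poly C}} by rewrite polyC_eq0.
by apply: (mulfI X0'); rewrite !mul_polyC scalerA -ec e eQ scalerAr.
Qed.

Definition in_ideal n (w : 'I_n -> {mpoly C[2]}) (p : {mpoly C[2]}) :=
  exists c : 'I_n -> {mpoly C[2]}, p = \sum_i c i * w i.

(** Over this field it amounts to the ideal having finitely many zeros; the two eliminants are the
    form in which finiteness is used. *)
Definition thin n (w : 'I_n -> {mpoly C[2]}) :=
  forall k, exists D, D != 0 /\ in_ideal w (univ k D).

(** Coprimality in [{poly {poly C}}] is coprimality over the fraction field C(x_k); [D] is the
    denominator cleared from the Bezout identity. *)
Lemma bezout_bipoly k p q : coprimep (bipoly k p) (bipoly k q) ->
  exists D u v, D != 0 /\ univ k D = u * p + v * q.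
Proof.
case/Bezout_coprimepP=> -[U V] /= /eqpP[[c1 c2]] /= /andP[c10 c20] e.
have [u uE] := bipoly_surj k U; have [v vE] := bipoly_surj k V.
exists c2, (univ k c1 * u), (univ k c1 * v); split=> //.
apply: (@bipoly_inj _ k); rewrite -!mulrA -mulrDr rmorphM rmorphD !rmorphM /= uE vE.
by rewrite !bipoly_univ mul_polyC e -mul_polyC mulr1.
Qed.

Lemma deriv_neq0 (P : {poly {poly C}}) : (1 < size P)%N -> P^`() != 0.
Proof.
move=> P1; apply/eqP=> /polyP/(_ (size P).-2); rewrite coef_deriv coef0.
have -> : (size P).-2.+1 = (size P).-1 by lia.
rewrite -scaler_nat => /eqP; rewrite scaler_eq0 pnatr_eq0 -[_`_ _]/(lead_coef P) lead_coef_eq0.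
by case/orP=> /eqP e; move: P1; [lia | rewrite e size_poly0].
Qed.

Lemma msize_bipoly_const k p : (msize p <= 1)%N -> (size (bipoly k p) <= 1)%N.
Proof. by move/msize1_polyC=> ->; rewrite bipolyC; apply: size_polyC_leq1. Qed.

(** By Gauss' lemma the factors [c], which lie in C[x_k], can be cancelled, so that [H] becomes a
    genuine common factor of the [w i]. *)
Lemma xprimitive_elim k n (w : 'I_n -> {mpoly C[2]}) H :
  (forall c, (forall i, exists q, w i = c * q) -> (msize c <= 1)%N) ->
  xprimitive H -> (forall i, exists c Q, c != 0 /\ c *: bipoly k (w i) = H * Q) ->
  (size H <= 1)%N.
Proof.
move=> noc prim dvd; have [h hE] := bipoly_surj k H.
rewrite -hE; apply/msize_bipoly_const/noc => i; have [c [Q [c0 e]]] := dvd i.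
have [Q' e'] := xprimitive_dvd c0 prim e; have [q qE] := bipoly_surj k Q'.
by exists q; apply: (@bipoly_inj _ k); rewrite rmorphM /= hE qE.
Qed.

(** The gcd of the three polynomials over C(x_k) is trivial, since its primitive part would be a
    common factor. Two successive Bezout identities, with denominators cleared, then give an
    eliminant in x_k. *)
Lemma thin_coprime (w : 'I_3 -> {mpoly C[2]}) : (exists i, w i != 0) ->
  (forall c, (forall i, exists q, w i = c * q) -> (msize c <= 1)%N) -> thin w.
Proof.
move=> [i0 wi0] noc k.
pose W i := bipoly k (w i); pose G := gcdp (W 0) (W 1).
have G2 : coprimep G (W ord_max).
  pose K := gcdp G (W ord_max).
  have K0 : K != 0.
    rewrite gcdp_eq0 gcdp_eq0 /W !(raddf_eq0 _ (@bipoly_inj _ k)).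
    apply: contraNN wi0 => /andP[/andP[w0 w1] w2].
    by case: i0 => [[|[|[|]]]] // lti; [move: w0 | move: w1 | move: w2];
      congr (w _ == 0); apply: val_inj.
  have [c [H [c0 KE prim]]] := xprimitive_decomposition K0.
  have : (size H <= 1)%N.
    apply: (xprimitive_elim (k := k) noc prim) => i.
    have /Pdiv.Idomain.dvdpP[[d Q] /= d0 e] : K %| W i.
      case: i => [[|[|[|]]]] // lti; set i := Ordinal lti.
      - have -> : i = 0 by apply: val_inj.
        by rewrite (dvdp_trans (dvdp_gcdl _ _)) // dvdp_gcdl.
      - have -> : i = 1 by apply: val_inj.
        by rewrite (dvdp_trans (dvdp_gcdl _ _)) // dvdp_gcdr.
      - have -> : i = ord_max by apply: val_inj.
        by rewrite dvdp_gcdr.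
    by exists d, (c *: Q); split=> //; rewrite [LHS]e KE -!scalerAr [Q * H]mulrC.
  rewrite /coprimep -/K KE -mul_polyC size_mul ?polyC_eq0 //; last first.
    by apply: contraNneq K0 => H0; rewrite KE H0 scaler0.
  rewrite size_polyC c0 /= => H1; rewrite eqn_leq H1 size_poly_gt0.
  by apply: contraNneq K0 => H0; rewrite KE H0 scaler0.
have [g gE] := bipoly_surj k G.
have := Bezoutp (W 0) (W 1) => -[[U V]] /= /eqpP[[c1 c2]] /= /andP[c10 c20] e.
have [u uE] := bipoly_surj k U; have [v vE] := bipoly_surj k V.
have [D [s [t [D0 De]]]] : exists D u v, D != 0 /\ univ k D = u * g + v * w ord_max.
  by apply: bezout_bipoly; rewrite gE.
have ge : univ k c2 * g = univ k c1 * (u * w 0 + v * w 1).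
  apply: (@bipoly_inj _ k); rewrite !rmorphM rmorphD !rmorphM /= !bipoly_univ.
  by rewrite uE vE gE !mul_polyC e.
have c2D : univ k (c2 * D) = univ k c2 * univ k D.
  by apply: (@bipoly_inj _ k); rewrite rmorphM /= !bipoly_univ polyCM.
exists (c2 * D); split; first by rewrite mulf_neq0.
exists (fun i => if i == 0 then s * univ k c1 * u else
   if i == 1 then s * univ k c1 * v else univ k c2 * t).
rewrite !big_ord_recl big_ord0 c2D De mulrDr mulrCA ge addr0 /=.
have -> : lift ord0 ord0 = 1 :> 'I_3 by apply: val_inj.
have -> : lift ord0 (lift ord0 ord0) = ord_max :> 'I_3 by apply: val_inj.
by rewrite /=; ring.
Qed.

Definition gradient (g : {mpoly C[2]}) (i : 'I_3) : {mpoly C[2]} :=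
  if unlift ord0 i is Some k then mderiv k g else g.

(** If g is coprime to its derivative in the other variable, Bezout over C(x_k) gives the eliminant.
    Otherwise, in characteristic 0, g has a multiple factor over C(x_k), and the primitive part of
    this factor is a repeated factor of g in C[x_0, x_1]. *)
Lemma thin_gradient g : (1 < msize g)%N ->
  (forall h q : {mpoly C[2]}, g = h ^+ 2 * q -> (msize h <= 1)%N) ->
  thin (gradient g).
Proof.
move=> g1 red k; pose G := bipoly k g.
have g0 : g != 0 by apply: contraTneq g1 => ->; rewrite msize0.
have G0 : G != 0 by rewrite raddf_eq0 //; apply: bipoly_inj.
have [cop|] := boolP (coprimep G G^`()).
  have [|D [u [v [D0 De]]]] := @bezout_bipoly k g (mderiv (other k) g).
    by rewrite -deriv_bipoly.
  exists D; split=> //.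
  exists (fun i => if i == 0 then u else if unlift ord0 i == Some (other k) then v else 0).
  rewrite big_ord_recl /= /gradient unlift_none De; congr (_ + _).
  rewrite (bigD1 (other k)) //= liftK eqxx big1 ?addr0 // => l lk.
  rewrite liftK; case: eqP => [[/eqP]|_]; last by rewrite mul0r.
  by rewrite (negPf lk).
have -> : coprimep G G^`() = separable_poly G by rewrite unlock.
(* The criterion also asks that nonconstant factors have nonzero derivative, which is characteristic
   0. There remain u and v with u v dividing G: the square of their gcd K divides G, and must be
   shown trivial. *)
move=> /separable_polyP nsep; exfalso; apply: nsep; split; last first.
  by move=> u _; apply: deriv_neq0.
move=> u v uvG; apply/idPn=> ncop.
pose K := gcdp u v.
have KKG : K * K %| G by rewrite (dvdp_trans _ uvG) // dvdp_mul ?dvdp_gcdl ?dvdp_gcdr.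
have K0 : K != 0.
  by apply: contraNneq G0 => K0; move: KKG; rewrite K0 mulr0 dvd0p.
have [c [H [c0 KE prim]]] := xprimitive_decomposition K0.
have H0 : H != 0 by apply: contraNneq K0 => H0; rewrite KE H0 scaler0.
have [[d Q] /= d0 e] := Pdiv.Idomain.dvdpP _ _ KKG.
have prim2 : xprimitive (H * H) by move=> a; rewrite rmorphM /=; apply: mulf_neq0; apply: prim.
have [|Q' e'] := xprimitive_dvd (Q := c ^+ 2 *: Q) d0 prim2 (P := G).
  by rewrite e KE -!scalerAl -!scalerAr scalerA -expr2 mulrC.
have [h hE] := bipoly_surj k H; have [q qE] := bipoly_surj k Q'.
have : (msize h <= 1)%N.
  apply: (red h q); apply: (@bipoly_inj _ k).
  by rewrite expr2 !rmorphM /= hE qE.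
move=> /(msize_bipoly_const k); rewrite hE => H1; case/negP: ncop.
rewrite /coprimep -/K KE -mul_polyC size_mul ?polyC_eq0 // size_polyC c0 add1n /=.
by rewrite eqn_leq H1 size_poly_gt0.
Qed.

(** Over the fraction field v = h w. The eliminants in x_0 and in x_1 both serve as denominators of
    h, and polynomials in different variables share no factor, so h is a polynomial. *)
Lemma thin_parallel (n : nat) (w v : 'I_n -> {mpoly C[2]}) : thin w ->
  (exists i, w i != 0) -> (forall i j, v i * w j = v j * w i) ->
  exists h, forall i, v i = h * w i.
Proof.
move=> tw [i0 wi0] par.
have [D [D0 [c e]]] := tw 0; have [D' [D'0 [c' e']]] := tw 1.
(* The quotient h is E / D and also E' / D'. *)
pose E := \sum_i c i * v i; pose E' := \sum_i c' i * v i.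
have vE i : univ 0 D * v i = w i * E.
  rewrite e mulr_suml /E mulr_sumr; apply: eq_bigr => j _.
  by rewrite -mulrA (mulrC (w j)) par; ring.
have vE' i : univ 1 D' * v i = w i * E'.
  rewrite e' mulr_suml /E' mulr_sumr; apply: eq_bigr => j _.
  by rewrite -mulrA (mulrC (w j)) par; ring.
have DE : univ 0 D * E' = univ 1 D' * E.
  by apply: (mulfI wi0); rewrite mulrCA -vE' mulrCA vE mulrCA.
have o01 : other 0 = 1 :> 'I_2 by [].
have D0' : univ 0 D != 0.
  by apply: contra_neq D0 => e0; apply: polyC_inj; rewrite -(bipoly_univ 0) e0 raddf0.
have bDE := congr1 (bipoly 0) DE; move: bDE.
rewrite !rmorphM /= bipoly_univ -o01 bipoly_univ_other mul_polyC => bDE.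
(* Specializing x_0 leaves a polynomial in x_1 unchanged, so it is primitive over C[x_0], and Gauss'
   lemma makes [D'] a divisor of [E']. *)
have prim : xprimitive (map_poly polyC D').
  by move=> a; rewrite xeval_map_polyC.
have [Q Qe] := xprimitive_dvd D0 prim bDE; have [q qE] := bipoly_surj 0 Q.
have D'u : univ 1 D' != 0.
  by apply: contra_neq D'0 => e0; apply: polyC_inj; rewrite -(bipoly_univ 1) e0 !raddf0.
have EQ : E = univ 0 D * q.
  apply: (mulfI D'u); rewrite -DE mulrCA; congr (_ * _).
  apply: (@bipoly_inj _ 0); rewrite rmorphM /= qE Qe; congr (_ * _).
  by rewrite -(bipoly_univ_other 0) o01.
by exists q => i; apply: (mulfI D0'); rewrite vE EQ; ring.
Qed.

End BivariateElimination.

(** One substitution covers two uses: with [j = 0] and [c = 0] it is dehomogenization, and with j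
    the chart of a point and c its coordinates it gives the local equation at that point. *)
HB.lock Definition localize (C : comNzRingType) (j : 'I_3) (c : 'I_3 -> C) (F : {mpoly C[3]}) :
  {mpoly C[2]} :=
  F \mPo [tuple (if unlift j i is Some k then (c i)%:MP + 'X_k else 1) | i < 3].

(** * Charts of the projective plane *)

Section Dehomogenization.
Variable C : comNzRingType.
Implicit Types (F G : {mpoly C[3]}) (p q w : {mpoly C[2]}) (c : 'I_3 -> C).

Lemma localizeE j c : localize j c =1
  comp_mpoly [tuple (if unlift j i is Some k then (c i)%:MP + 'X_k else 1) | i < 3].
Proof. by move=> F; rewrite localize.unlock. Qed.

Lemma localize_is_additive j c : additive (localize j c).
Proof. by move=> F G; rewrite !localizeE raddfB. Qed.
Lemma localize_is_scalable j c : scalable (localize j c).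
Proof. by move=> a F; rewrite !localizeE linearZ. Qed.
HB.instance Definition _ j c :=
  GRing.isAdditive.Build _ _ (localize j c) (localize_is_additive j c).
HB.instance Definition _ j c :=
  GRing.isScalable.Build _ _ _ _ (localize j c) (localize_is_scalable j c).
Lemma localize_is_multiplicative j c : multiplicative (localize j c).
Proof. by split=> [F G|]; rewrite !localizeE ?rmorphM ?rmorph1. Qed.
HB.instance Definition _ j c :=
  GRing.isMultiplicative.Build _ _ (localize j c) (localize_is_multiplicative j c).

Lemma localizeX j c i :
  localize j c 'X_i = if unlift j i is Some k then (c i)%:MP + 'X_k else 1.
Proof. by rewrite localizeE comp_mpolyXU -tnth_nth tnth_mktuple. Qed.

Lemma localizeC j c a : localize j c a%:MP = a%:MP.
Proof. by rewrite localizeE comp_mpolyC. Qed.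

Lemma dhomog_prod_exp n N (F : 'I_N -> {mpoly C[n]}) (m : 'I_N -> nat) :
  (forall l, F l \is 1.-homog) -> \prod_l F l ^+ m l \is (\sum_l m l)%N.-homog.
Proof.
move=> F1; apply: (big_ind2 (fun x (y : nat) => x \is y.-homog)).
- exact: dhomog1.
- by move=> *; apply: dhomogM.
- by move=> l _; rewrite -[X in X.-homog]mul1n; apply: dhomogMn.
Qed.

Lemma dhomog_linear n (a : C) (i j : 'I_n) : 'X_i - a%:MP * 'X_j \is 1.-homog.
Proof.
rewrite mul_mpolyC; apply: rpredB; first by rewrite dhomogX /= mdeg1.
by apply: rpredZ; rewrite dhomogX /= mdeg1.
Qed.

(** The lift substitutes x_i - c_i x_j for the coordinates of the chart and pads each monomial with
    a power of x_j up to degree k. *)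
Lemma localize_lift j c k w : (msize w <= k.+1)%N ->
  exists F, F \is k.-homog /\ localize j c F = w.
Proof.
move=> wk.
exists (\sum_(m <- msupp w) w@_m *: ((\prod_(l < 2)
   ('X_(lift j l) - (c (lift j l))%:MP * 'X_j) ^+ m l) * 'X_j ^+ (k - mdeg m))).
have m_le m : m \in msupp w -> (mdeg m <= k)%N by move=> /msize_mdeg_lt; lia.
split.
  rewrite big_seq; apply: rpred_sum => m /m_le mk; apply: rpredZ.
  have -> : k = (mdeg m + 1 * (k - mdeg m))%N by lia.
  rewrite [in X in _ * X]addKn mul1n; apply: dhomogM; last first.
    by rewrite -[X in X.-homog]mul1n; apply: dhomogMn; rewrite dhomogX /= mdeg1.
  rewrite mdegE; apply: dhomog_prod_exp => l; exact: dhomog_linear.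
rewrite raddf_sum [RHS]mpolyE; apply: eq_bigr => m _ /=.
rewrite linearZ rmorphM rmorph_prod rmorphXn /= localizeX unlift_none expr1n mulr1.
congr (_ *: _); rewrite [RHS]mpolyXE_id; apply: eq_bigr => l _.
rewrite rmorphXn rmorphB rmorphM /= !localizeX localizeC liftK unlift_none.
by rewrite mulr1 addrAC subrr add0r.
Qed.

Definition dehom : {mpoly C[3]} -> {mpoly C[2]} := localize ord0 (fun=> 0).
HB.instance Definition _ :=
  GRing.isAdditive.Build _ _ dehom (localize_is_additive ord0 (fun=> 0)).
HB.instance Definition _ :=
  GRing.isScalable.Build _ _ _ _ dehom (localize_is_scalable ord0 (fun=> 0)).
HB.instance Definition _ :=
  GRing.isMultiplicative.Build _ _ dehom (localize_is_multiplicative ord0 (fun=> 0)).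

Lemma dehom_X0 : dehom 'X_ord0 = 1.
Proof. by rewrite /dehom localizeX unlift_none. Qed.

Lemma dehom_XS k : dehom 'X_(lift ord0 k) = 'X_k.
Proof. by rewrite /dehom localizeX liftK mpolyC0 add0r. Qed.

Definition hmonom k (m : 'X_{1..2}) : 'X_{1..3} :=
  [multinom (if unlift ord0 i is Some l then m l else k - mdeg m)%N | i < 3].

Lemma mdeg_hmonom k m : (mdeg m <= k)%N -> mdeg (hmonom k m) = k.
Proof.
move=> mk; rewrite mdegE big_ord_recl mnmE unlift_none.
under eq_bigr do rewrite mnmE liftK.
by rewrite -mdegE subnK.
Qed.

Lemma dehomX m : dehom 'X_[m] = 'X_[[multinom m (lift ord0 l) | l < 2]].
Proof.
rewrite /dehom localizeE comp_mpolyX big_ord_recl tnth_mktuple unlift_none.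
rewrite expr1n mul1r [RHS]mpolyXE_id; apply: eq_bigr => l _.
by rewrite tnth_mktuple liftK mpolyC0 add0r mnmE.
Qed.

Lemma dehom_hmonom k m : dehom 'X_[hmonom k m] = 'X_[m].
Proof. by rewrite dehomX; congr 'X_[_]; apply/mnmP=> l; rewrite !mnmE liftK. Qed.

Lemma mcoeff_dehom k F m : F \is k.-homog ->
  (dehom F)@_m = if (mdeg m <= k)%N then F@_(hmonom k m) else 0.
Proof.
move=> /dhomogP hF; rewrite [F in LHS]mpolyE !raddf_sum /=.
have key m' : m' \in msupp F ->
    ([multinom m' (lift ord0 l) | l < 2] == m) = (mdeg m <= k)%N && (m' == hmonom k m).
  move=> /hF m'k; apply/eqP/andP => [<-|[mk /eqP->]]; last first.
    by apply/mnmP=> l; rewrite !mnmE liftK.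
  have e : k = (m' ord0 + mdeg [multinom m' (lift ord0 l) | l < 2])%N.
    rewrite -m'k /= [LHS]mdegE big_ord_recl mdegE; congr (_ + _)%N.
    by apply: eq_bigr => l _; rewrite mnmE.
  split; first by rewrite e leq_addl.
  apply/eqP/mnmP=> i; rewrite mnmE; case: unliftP => [l ->|->]; first by rewrite mnmE.
  by rewrite {1}e addnK.
transitivity (\sum_(m' <- msupp F)
    (if (mdeg m <= k)%N then F@_m' * (m' == hmonom k m)%:R else 0)).
  rewrite !big_seq; apply: eq_bigr => m' m'F.
  rewrite linearZ /= mcoeffZ dehomX mcoeffX key //.
  by case: ifP; rewrite /= ?mulr0.
case: ifP => _; last by rewrite big1.
by rewrite [F in RHS]mpolyE raddf_sum /=; apply: eq_bigr => m' _; rewrite mcoeffZ mcoeffX.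
Qed.

Lemma dehom_inj k F G : F \is k.-homog -> G \is k.-homog -> dehom F = dehom G -> F = G.
Proof.
move=> hF hG e; apply/eqP; rewrite -subr_eq0; apply/eqP.
have hFG : F - G \is k.-homog by apply: rpredB.
apply/mpolyP=> m; rewrite mcoeff0; have [mk|/eqP mk] := eqVneq (mdeg m) k; last first.
  by apply: (dhomog_nemf_coeff hFG); apply/eqP.
pose m' := [multinom m (lift ord0 l) | l < 2].
have mE : k = (m ord0 + mdeg m')%N.
  rewrite -mk [LHS]mdegE big_ord_recl mdegE; congr (_ + _)%N.
  by apply: eq_bigr => l _; rewrite mnmE.
have -> : m = hmonom k m'.
  apply/mnmP=> i; rewrite mnmE; case: unliftP => [l ->|->]; first by rewrite mnmE.
  by rewrite {1}mE addnK.
have := mcoeff_dehom m' hFG; rewrite mE leq_addl -mE => <-.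
by rewrite raddfB /= e subrr mcoeff0.
Qed.

Lemma msize_dehom k F : F \is k.-homog -> (msize (dehom F) <= k.+1)%N.
Proof.
move=> hF; rewrite msizeE; apply/bigmax_leqP_seq => m + _.
by rewrite mcoeff_msupp (mcoeff_dehom _ hF); case: ifP; rewrite ?ltnS ?eqxx.
Qed.

Lemma dehom_lift k w : (msize w <= k.+1)%N -> exists F, F \is k.-homog /\ dehom F = w.
Proof. exact: localize_lift. Qed.

End Dehomogenization.

(** * Cross products and Cramer's rule *)

Section CrossProduct.
Variable A : idomainType.
Implicit Types (a b n u : 'I_3 -> A).

Definition cross a b (i : 'I_3) : A :=
  if i == 0 then a 1 * b ord_max - a ord_max * b 1
  else if i == 1 then a ord_max * b 0 - a 0 * b ord_max
  else a 0 * b 1 - a 1 * b 0.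

Lemma ord3_ind (P : 'I_3 -> Prop) : P 0 -> P 1 -> P ord_max -> forall i, P i.
Proof.
move=> P0 P1 P2 [[|[|[|]]]] // lti.
- by rewrite (_ : Ordinal lti = 0) //; apply: val_inj.
- by rewrite (_ : Ordinal lti = 1) //; apply: val_inj.
- by rewrite (_ : Ordinal lti = ord_max) //; apply: val_inj.
Qed.

Lemma sum3E (F : 'I_3 -> A) : \sum_i F i = F 0 + F 1 + F ord_max.
Proof.
rewrite !big_ord_recl big_ord0 addr0 -addrA.
have -> : lift ord0 ord0 = 1 :> 'I_3 by apply: val_inj.
by have -> : lift ord0 (lift ord0 ord0) = ord_max :> 'I_3 by apply: val_inj.
Qed.

(** Each 2 by 2 minor of the pair (a x b, n) is a combination of the two orthogonality relations. *)
Lemma cross_parallel a b n : \sum_i a i * n i = 0 -> \sum_i b i * n i = 0 ->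
  forall i j, cross a b i * n j = cross a b j * n i.
Proof.
rewrite !sum3E => ea eb.
apply: ord3_ind; apply: ord3_ind => //; rewrite /cross /=; apply/eqP; rewrite -subr_eq0; apply/eqP.
- transitivity (b ord_max * (a 0 * n 0 + a 1 * n 1 + a ord_max * n ord_max)
    - a ord_max * (b 0 * n 0 + b 1 * n 1 + b ord_max * n ord_max)); first by ring.
  by rewrite ea eb !mulr0 subrr.
- transitivity (a 1 * (b 0 * n 0 + b 1 * n 1 + b ord_max * n ord_max)
    - b 1 * (a 0 * n 0 + a 1 * n 1 + a ord_max * n ord_max)); first by ring.
  by rewrite ea eb !mulr0 subrr.
- transitivity (a ord_max * (b 0 * n 0 + b 1 * n 1 + b ord_max * n ord_max)
    - b ord_max * (a 0 * n 0 + a 1 * n 1 + a ord_max * n ord_max)); first by ring.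
  by rewrite ea eb !mulr0 subrr.
- transitivity (b 0 * (a 0 * n 0 + a 1 * n 1 + a ord_max * n ord_max)
    - a 0 * (b 0 * n 0 + b 1 * n 1 + b ord_max * n ord_max)); first by ring.
  by rewrite ea eb !mulr0 subrr.
- transitivity (b 1 * (a 0 * n 0 + a 1 * n 1 + a ord_max * n ord_max)
    - a 1 * (b 0 * n 0 + b 1 * n 1 + b ord_max * n ord_max)); first by ring.
  by rewrite ea eb !mulr0 subrr.
- transitivity (a 0 * (b 0 * n 0 + b 1 * n 1 + b ord_max * n ord_max)
    - b 0 * (a 0 * n 0 + a 1 * n 1 + a ord_max * n ord_max)); first by ring.
  by rewrite ea eb !mulr0 subrr.
Qed.

Lemma cross_eq0 a b : (forall i, cross a b i = 0) <->
  (forall i j, b i * a j = b j * a i).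
Proof.
split=> [e|e].
  have [e0 e1 e2] := And3 (e 0) (e 1) (e ord_max).
  move: e0 e1 e2; rewrite /cross /= => /subr0_eq e0 /subr0_eq e1 /subr0_eq e2.
  by apply: ord3_ind; apply: ord3_ind => //; rewrite ![b _ * _]mulrC.
by apply: ord3_ind; rewrite /cross /=; apply/eqP; rewrite subr_eq0 mulrC e mulrC.
Qed.

Lemma cross_orthogonal a b : \sum_i a i * cross a b i = 0 /\ \sum_i b i * cross a b i = 0.
Proof. by rewrite !sum3E /cross /=; split; ring. Qed.

(* Cramer's rule in the module of the vectors orthogonal to n. *)
Lemma cross_basis a b n u c h h' : c != 0 -> (exists i, n i != 0) ->
  (forall i, cross a b i = c * n i) ->
  (forall i, cross u a i = h * n i) -> (forall i, cross u b i = h' * n i) ->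
  forall i, c * u i = h' * a i - h * b i.
Proof.
move=> c0 [i0 ni0] ab ua ub.
(* A vector parallel to both a and b is zero, because a x b is not zero; the coefficients h' and -h
   are those that make both cross products with z cancel. *)
pose z i := c * u i - (h' * a i - h * b i).
have crossz v w : (forall i, w i = c * u i - v i) -> forall x i,
    cross w x i = c * cross u x i - cross v x i.
  by move=> wE x; apply: ord3_ind; rewrite /cross /= !wE; ring.
have cross_lin x i : cross (fun i => h' * a i - h * b i) x i =
    h' * cross a x i - h * cross b x i.
  by move: i; apply: ord3_ind; rewrite /cross /=; ring.
have crossv x i : cross x x i = 0.
  by move: i; apply: ord3_ind; rewrite /cross /=; ring.
have crossC x y i : cross x y i = - cross y x i.
  by move: i; apply: ord3_ind; rewrite /cross /=; ring.
have za i : cross z a i = 0.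
  rewrite (crossz (fun i => h' * a i - h * b i)) // cross_lin crossv (crossC b a).
  by rewrite ua ab; ring.
have zb i : cross z b i = 0.
  rewrite (crossz (fun i => h' * a i - h * b i)) // cross_lin crossv.
  by rewrite ub ab; ring.
have zab i j : z i * cross a b j = 0.
  have ea : forall i j, a i * z j = a j * z i by apply/cross_eq0.
  have eb : forall i j, b i * z j = b j * z i by apply/cross_eq0.
  (* The product z_i a_k b_l is symmetric in k and l, as z can be exchanged with a and with b; hence
     z_i kills every minor of a and b. *)
  have swap k l : z i * (a k * b l) = z i * (a l * b k).
    have -> : z i * (a k * b l) = (a k * z i) * b l by ring.
    have -> : z i * (a l * b k) = (a l * z i) * b k by ring.
    rewrite (ea k i) (ea l i); have := eb k l => ekl.
    have -> : a i * z k * b l = a i * (b l * z k) by ring.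
    by rewrite -ekl; ring.
  move: j; apply: ord3_ind; rewrite /cross /= mulrBr swap ?subrr //;
    by rewrite swap ?subrr // -swap subrr.
move=> i; apply/eqP; rewrite -subr_eq0; have := zab i i0.
by rewrite ab => /eqP; rewrite !mulf_eq0 (negPf c0) (negPf ni0) !orbF.
Qed.
End CrossProduct.

(** * Saturated triples: partial derivatives and minimal syzygies *)

Section Gradient.
Variable C : numClosedFieldType.
Implicit Types (f h F G : {mpoly C[3]}) (g p q : {mpoly C[2]}).

(* Forms of degree e without common factor: the last clause excludes the factor
   x_0, which dehomogenization does not see. *)
Definition saturated e (w : 'I_3 -> {mpoly C[3]}) :=
  [/\ forall i, w i \is e.-homog, thin (fun i => dehom (w i))
    & exists i, msize (dehom (w i)) = e.+1].

Lemma saturated_neq0 e w : saturated e w -> exists i, w i != 0.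
Proof.
case=> _ _ [i wi]; exists i; apply: contra_eq_neq wi => ->.
by rewrite raddf0 msize0.
Qed.

(** The quotient h is found in the chart x_0 = 1. Some entry of w keeps its full degree e there, so
    h has degree at most m - e and can be homogenized. As [m - e] is truncated, the case e > m has
    to be recorded apart: h is then zero. *)
Lemma saturated_parallel e w m v : saturated e w ->
  (forall i, v i \is m.-homog) -> (forall i j, v i * w j = v j * w i) ->
  exists h, [/\ h \is (m - e).-homog, (h != 0 -> (e <= m)%N) & forall i, v i = h * w i].
Proof.
move=> [hw tw [i0 si0]] hv par.
have d0 : dehom (w i0) != 0 by apply: contra_eq_neq si0 => ->; rewrite msize0.
have [H HE] : exists h : {mpoly C[2]}, forall i, dehom (v i) = h * dehom (w i).
  apply: thin_parallel tw _ _; first by exists i0.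
  by move=> i j; rewrite -!rmorphM par.
have [H0|H0] := eqVneq H 0.
  exists 0; split=> [||i]; rewrite ?rpred0 ?eqxx // mul0r.
  by apply: (dehom_inj (hv i)); rewrite ?rpred0 // HE H0 mul0r raddf0.
have := msize_dehom (hv i0); rewrite HE msizeM // si0 => Hm.
have Hp : (0 < msize H)%N by rewrite lt0n mmeasure_poly_eq0.
set n := msize H in Hp Hm; have em : (e <= m)%N by lia.
have Hn : (n <= (m - e).+1)%N by lia.
have [h [hh hE]] := dehom_lift Hn.
exists h; split=> // i; apply: (dehom_inj (hv i)); last by rewrite rmorphM /= hE HE.
by have := dhomogM hh (hw i); rewrite subnK.
Qed.

Lemma euler d f : f \is d.-homog -> \sum_(i < 3) 'X_i * mderiv i f = d%:R *: f.
Proof.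
move=> /dhomogP hf; rewrite [f in RHS]mpolyE scaler_sumr.
have -> : \sum_(i < 3) 'X_i * mderiv i f =
    \sum_(m <- msupp f) f@_m *: \sum_(i < 3) 'X_i * mderiv i 'X_[m].
  rewrite {1}[f]mpolyE; under eq_bigr => i _ do rewrite raddf_sum mulr_sumr.
  rewrite exchange_big /=; apply: eq_bigr => m _; rewrite scaler_sumr.
  by apply: eq_bigr => i _; rewrite mderivZ scalerAr.
rewrite !big_seq; apply: eq_bigr => m mf; rewrite scalerA mulrC -scalerA; congr (_ *: _).
rewrite -(hf m mf) /= mdegE natr_sum scaler_suml; apply: eq_bigr => i _.
rewrite mderivX -scalerAr -mpolyXD; have [->|mi] := eqVneq (m i) 0%N.
  by rewrite !scale0r.
by rewrite addmC submK // lep1mP.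
Qed.

Lemma dehom_mderiv f k : dehom (mderiv (lift ord0 k) f) = mderiv k (dehom f).
Proof.
rewrite [f]mpolyE (raddf_sum (mderiv _)) !(raddf_sum (@dehom C)) (raddf_sum (mderiv k)) /=.
apply: eq_bigr => m _.
rewrite !mderivZ !linearZ /=; congr (_ *: _).
rewrite dehomX !mderivX linearZ /= dehomX mnmE; congr (_ *: 'X_[_]).
by apply/mnmP=> l; rewrite !(mnmE, mnmBE, mnm1E); congr (_ - _)%N.
Qed.

Lemma dhomog_mderiv d i f : f \is d.-homog -> mderiv i f \is d.-1.-homog.
Proof.
move=> /dhomogP hf; apply/dhomogP => m; rewrite mcoeff_msupp mcoeff_deriv => nz.
have : (m + U_(i))%MM \in msupp f.
  by rewrite mcoeff_msupp; apply: contraNneq nz => ->; rewrite mul0rn.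
by move=> /hf /=; rewrite mdegD mdeg1 => <-; rewrite addn1.
Qed.

Lemma dehom_mderiv0 d f : f \is d.-homog ->
  dehom (mderiv ord0 f) = d%:R *: dehom f - \sum_(k < 2) 'X_k * mderiv k (dehom f).
Proof.
move=> /euler /(congr1 (@dehom C)); rewrite raddf_sum linearZ big_ord_recl /= => <-.
rewrite rmorphM /= dehom_X0 mul1r -addrA -[LHS]addr0; congr (_ + _).
by rewrite -sumrB big1 // => k _; rewrite rmorphM /= dehom_XS dehom_mderiv subrr.
Qed.

Lemma in_idealD n (w : 'I_n -> {mpoly C[2]}) p q :
  in_ideal w p -> in_ideal w q -> in_ideal w (p + q).
Proof.
move=> [c ->] [c' ->]; exists (fun i => c i + c' i); rewrite -big_split.
by apply: eq_bigr => i _; rewrite mulrDl.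
Qed.

Lemma in_idealM n (w : 'I_n -> {mpoly C[2]}) p q : in_ideal w p -> in_ideal w (q * p).
Proof.
move=> [c ->]; exists (fun i => q * c i); rewrite mulr_sumr.
by apply: eq_bigr => i _; rewrite mulrA.
Qed.

Lemma in_ideal0 n (w : 'I_n -> {mpoly C[2]}) : in_ideal w 0.
Proof. by exists (fun=> 0); rewrite big1 // => i; rewrite mul0r. Qed.

Lemma in_ideal_gen n (w : 'I_n -> {mpoly C[2]}) i : in_ideal w (w i).
Proof.
exists (fun j => (j == i)%:R); rewrite (bigD1 i) //= eqxx mul1r big1 ?addr0 //.
by move=> j /negPf ->; rewrite mul0r.
Qed.

Lemma in_ideal_sum n (w : 'I_n -> {mpoly C[2]}) m (c : 'I_m -> {mpoly C[2]}) v :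
  (forall i, in_ideal w (v i)) -> in_ideal w (\sum_i c i * v i).
Proof.
move=> wv; elim/big_rec: _ => [|i p _]; first exact: in_ideal0.
by apply: in_idealD; apply: in_idealM.
Qed.

Lemma in_ideal_trans n m (w : 'I_n -> {mpoly C[2]}) (v : 'I_m -> {mpoly C[2]}) p :
  (forall i, in_ideal w (v i)) -> in_ideal v p -> in_ideal w p.
Proof. by move=> wv [c ->]; apply: in_ideal_sum. Qed.

Definition dehom_grad f (i : 'I_3) := dehom (mderiv i f).

(** Index 0 of [gradient] is the polynomial itself; Euler's relation, d being invertible, puts it in
    the ideal of the partial derivatives. *)
Lemma gradient_dehom_grad d f i : f \is d.-homog -> (0 < d)%N ->
  in_ideal (dehom_grad f) (gradient (dehom f) i).
Proof.
move=> hf d0; rewrite /gradient; case: (unlift ord0 i) => [k|].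
  by rewrite -dehom_mderiv; apply: (in_ideal_gen (dehom_grad f)).
have dC : (d%:R : C) != 0 by rewrite pnatr_eq0 -lt0n.
have /(congr1 ( *:%R d%:R^-1)) := euler hf.
rewrite scalerA mulVf // scale1r => /(congr1 (@dehom C)) <-.
rewrite linearZ /= raddf_sum /= -mul_mpolyC; apply: in_idealM.
under eq_bigr do rewrite rmorphM /=.
exact: in_ideal_sum (in_ideal_gen (dehom_grad f)).
Qed.

Lemma saturated_grad d f : f \is d.-homog -> (0 < d)%N -> msize (dehom f) = d.+1 ->
  thin (gradient (dehom f)) -> saturated d.-1 (fun i => mderiv i f).
Proof.
move=> hf d0 sf tg; split=> [i||]; first exact: dhomog_mderiv.
  move=> k; have [D [D0 iD]] := tg k; exists D; split=> //.
  by apply: in_ideal_trans iD => i; apply: gradient_dehom_grad d0.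
(* Otherwise x_0 would divide all partial derivatives, and Euler's relation would bound the degree
   of the dehomogenization of f by d - 1. *)
apply/not_existsP => noti.
have le i : (msize (dehom (mderiv i f)) <= d.-1)%N.
  have := msize_dehom (dhomog_mderiv i hf); rewrite prednK // leq_eqVlt.
  by case/orP=> [/eqP e|]; [case: (noti i); rewrite e prednK | lia].
have dC : (d%:R : C) != 0 by rewrite pnatr_eq0 -lt0n.
have := euler hf => /(congr1 (@dehom C)); rewrite linearZ raddf_sum /= => /(congr1 (fun p => msize p)).
rewrite msizeZ // sf => e; suff : (d.+1 <= d)%N by rewrite ltnn.
rewrite -{1}e; apply: (leq_trans (mmeasure_sum _ _ _ _)).
apply/bigmax_leqP => i _; rewrite rmorphM /=.
have [->|q0] := eqVneq (dehom (mderiv i f)) 0; first by rewrite mulr0 msize0.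
have := le i; case: (unliftP ord0 i) => [k ei|ei] h.
  have X0 : 'X_k != 0 :> {mpoly C[2]} by rewrite -(mmeasure_poly_eq0 mdeg) msizeX.
  rewrite ei dehom_XS -ei msizeM // msizeX /= mdeg1 -(prednK d0).
  exact: h.
by rewrite ei dehom_X0 -ei mul1r; apply: leq_trans h (leq_pred d).
Qed.

Definition syzygy (w a : 'I_3 -> {mpoly C[3]}) := \sum_i a i * w i = 0.

(** A common factor of the entries, be it x_0 or one visible in the chart, could be divided out,
    leaving a nonzero syzygy of lower degree. *)
Lemma saturated_minimal_syzygy e w r a : (forall i, w i \is e.-homog) ->
  (forall i, a i \is r.-homog) -> syzygy w a -> (exists i, a i != 0) ->
  (forall s b, (s < r)%N -> (forall i, b i \is s.-homog) -> syzygy w b ->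
     forall i, b i = 0) ->
  saturated r a.
Proof.
move=> hw ha syza [i0 ai0] min.
have ai0' : dehom (a i0) != 0.
  by apply: contra_neq ai0 => e0; apply: (dehom_inj (ha i0)); rewrite ?rpred0 // e0 raddf0.
(* Affine relations of degree below r lift to forms of degree r - 1, and minimality kills them. This
   is applied to the quotients by a common factor and, to exclude the factor x_0, to the
   dehomogenization of a itself. *)
have low (q : 'I_3 -> {mpoly C[2]}) : (0 < r)%N -> (forall i, (msize (q i) <= r)%N) ->
    \sum_i q i * dehom (w i) = 0 -> forall i, q i = 0.
  move=> r0 sq eq0; have /choice[b bE] i : exists b, b \is r.-1.-homog /\ dehom b = q i.
    by apply: dehom_lift; rewrite prednK.
  have b0 : forall i, b i = 0.
    apply: (min r.-1) => [|i|]; first by rewrite prednK.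
      by case: (bE i).
    apply: (@dehom_inj _ (r.-1 + e)); rewrite ?rpred0 //.
      by apply: rpred_sum => i _; apply: dhomogM => //; case: (bE i).
    rewrite raddf_sum /= [RHS]raddf0; apply: etrans eq0; apply: eq_bigr => i _.
    by rewrite rmorphM /=; case: (bE i) => _ ->.
  by move=> i; case: (bE i) => _ <-; rewrite b0 raddf0.
have dsyz : \sum_i dehom (a i) * dehom (w i) = 0.
  have := congr1 (@dehom C) syza; rewrite raddf0 raddf_sum /= => e0.
  by apply: etrans e0; apply: eq_bigr => i _; rewrite rmorphM.
split=> //.
  apply: thin_coprime; first by exists i0.
  move=> c /choice[q qE]; rewrite leqNgt; apply/negP => c1.
  have c0 : c != 0 by apply: contraTneq c1 => ->; rewrite msize0.
  have sz i : (msize (q i) <= r)%N.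
    have [->|q0] := eqVneq (q i) 0; first by rewrite msize0.
    have aux x y : (1 < x -> (x + y).-1 <= r.+1 -> y <= r)%N by lia.
    by apply: aux c1 _; rewrite -msizeM // -qE; apply: msize_dehom.
  have q0 : q i0 != 0 by apply: contraNneq ai0' => q0; rewrite qE q0 mulr0.
  have r0 : (0 < r)%N.
    by apply: leq_trans (sz i0); rewrite lt0n mmeasure_poly_eq0.
  case/eqP: q0; apply: low => //; apply: (mulfI c0).
  rewrite mulr0 mulr_sumr; apply: etrans dsyz; apply: eq_bigr => i _.
  by rewrite qE mulrA.
apply/not_existsP => noti.
have sz i : (msize (dehom (a i)) <= r)%N.
  have := msize_dehom (ha i); rewrite leq_eqVlt.
  by case/orP=> [/eqP /noti|].
have r0 : (0 < r)%N.
  by apply: leq_trans (sz i0); rewrite lt0n mmeasure_poly_eq0.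
by case/eqP: ai0'; apply: (low (fun i => dehom (a i))).
Qed.

End Gradient.

(** * Univariate polynomials *)

Section Univariate.
Variable C : numClosedFieldType.
Implicit Types p q : {poly C}.

Lemma exists_nonroot p : p != 0 -> exists x, p.[x] != 0.
Proof.
move=> p0; apply/not_existsP => h.
have /(max_poly_roots p0) : all (root p) [seq n%:R | n <- iota 0 (size p)].
  by apply/allP => x _; rewrite /root; apply/negPn/negP/h.
rewrite map_inj_uniq ?iota_uniq // => [/(_ isT)|]; first by rewrite size_map size_iota ltnn.
by move=> m n /eqP; rewrite eqr_nat => /eqP.
Qed.

Lemma exists_notin (s : seq C) : exists x, x \notin s.
Proof.
have [|x] := @exists_nonroot (\prod_(z <- s) ('X - z%:P)).
  by rewrite monic_neq0 // monic_prod_XsubC.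
by rewrite -[_ != 0]/(~~ root _ x) root_prod_XsubC; exists x.
Qed.

Lemma poly_unimodular (w : 'I_3 -> {poly C}) :
  (forall t, exists i, (w i).[t] != 0) -> exists s, \sum_i s i * w i = 1.
Proof.
move=> nz; pose G := gcdp (w 0) (w 1).
have cop : coprimep G (w ord_max).
  rewrite /coprimep; apply/negPn/negP => /closed_rootP[t].
  rewrite !root_gcd -andbA => /and3P[/rootP r0 /rootP r1 /rootP r2].
  by have [k] := nz t; move: k; apply: ord3_ind; rewrite ?r0 ?r1 ?r2 eqxx.
case/Bezout_eq1_coprimepP: cop => -[u v] /= e1.
case: (Bezoutp (w 0) (w 1)) => -[u' v'] /=; rewrite -/G => /eqpf_eq[c c0 e].
exists (fun i => if i == 0 then u * c^-1%:P * u' else if i == 1 then u * c^-1%:P * v' else v).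
rewrite sum3E /= -!mulrA -mulrDr -mulrDr e -e1; congr (u * _ + _).
by rewrite -mul_polyC mulrA -polyCM mulVf // mul1r.
Qed.

Lemma poly_parallel (s w v : 'I_3 -> {poly C}) : \sum_i s i * w i = 1 ->
  (forall i j, v i * w j = v j * w i) -> forall i, v i = (\sum_j s j * v j) * w i.
Proof.
move=> e par i; rewrite -[LHS]mul1r -e !mulr_suml; apply: eq_bigr => j _.
by rewrite -mulrA [w j * _]mulrC par mulrA.
Qed.

Lemma poly_parallel_size (c w v : {poly C}) k r : size w = r.+1 -> (size v <= k.+1)%N ->
  v = c * w -> c != 0 -> (r <= k)%N /\ (size c <= (k - r).+1)%N.
Proof.
move=> sw sv e c0; have w0 : w != 0 by rewrite -size_poly_gt0 sw.
have aux n : ((n + r.+1).-1 <= k.+1 -> 0 < n -> r <= k /\ n <= (k - r).+1)%N by lia.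
by apply: aux; [rewrite -sw -size_mul // -e | rewrite size_poly_gt0].
Qed.

End Univariate.

(** * Restriction to a line of the plane *)

Section Lines.
Variable C : numClosedFieldType.
Implicit Types (F G l : {mpoly C[3]}) (w a b : 'I_3 -> {mpoly C[3]}).

(* L is the restriction to the line of equation l of P^2, with a chosen affine
   coordinate on that line. *)
Definition line_restriction (L : {rmorphism {mpoly C[3]} -> {poly C}}) l :=
  [/\ l \is 1.-homog, l != 0 /\ L l = 0,
      (forall k F, F \is k.-homog -> (size (L F) <= k.+1)%N),
      (forall k (q : {poly C}), (size q <= k.+1)%N -> exists F, F \is k.-homog /\ L F = q)
    & forall k F, F \is k.-homog -> L F = 0 -> exists G, G \is k.-1.-homog /\ F = l * G].

(* The forms a i have no common zero on the line: the last clause deals with its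
   point outside the affine coordinate. *)
Definition nondegenerate_on (L : {mpoly C[3]} -> {poly C}) r a :=
  (exists s, \sum_i s i * L (a i) = 1) /\ exists i, size (L (a i)) = r.+1.

(** Since a has no zero on the line, b restricts there to a multiple of a. Subtracting from b a lift
    of the multiplier times a does not change a x b and makes b divisible by l. *)
Lemma cross_divide L l w r a s b h : line_restriction L l -> nondegenerate_on L r a ->
  (forall i, a i \is r.-homog) -> syzygy w a ->
  (forall i, b i \is s.-homog) -> syzygy w b ->
  (forall i, cross a b i = l * h * w i) ->
  exists b', [/\ forall i, b' i \is s.-1.-homog, syzygy w b'
    & forall i, cross a b' i = h * w i].
Proof.
move=> [_ [l0 Ll] sizeL liftL kerL] [[u eu] [i0 si0]] ha sa hb sb ab.
have La0 : forall i, cross (fun i => L (a i)) (fun i => L (b i)) i = 0.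
  move=> i; have := congr1 L (ab i); rewrite !rmorphM /= Ll !mul0r => <-.
  by rewrite /cross; case: ifP => _; [|case: ifP => _]; rewrite rmorphB !rmorphM.
pose c := \sum_j u j * L (b j).
have Lb i : L (b i) = c * L (a i).
  exact: (poly_parallel (w := fun i => L (a i)) (v := fun i => L (b i)) eu ((cross_eq0 _ _).1 La0)).
(* The multiplier is lifted to a form of degree s - r. When it vanishes, s < r is possible, and the
   lift is taken to be 0. *)
have [c' [hc' c'E]] : exists c', (forall i, c' * a i \is s.-homog) /\ L c' = c.
  have [c0|c0] := eqVneq c 0.
    by exists 0; split=> [i|]; rewrite ?mul0r ?rpred0 // c0 rmorph0.
  have [rs sc] := poly_parallel_size si0 (sizeL _ _ (hb i0)) (Lb i0) c0.
  have [c' [hc' c'E]] := liftL _ _ sc; exists c'; split=> // i.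
  by have := dhomogM hc' (ha i); rewrite subnK.
have /choice[b' b'E] i : exists G, G \is s.-1.-homog /\ b i - c' * a i = l * G.
  apply: kerL; first by apply: rpredB; [exact: hb | exact: hc'].
  by rewrite rmorphB rmorphM /= Lb c'E subrr.
exists b'; split=> [i||i]; first by case: (b'E i).
  apply: (mulfI l0); rewrite mulr0 mulr_sumr.
  transitivity (\sum_i b i * w i - c' * \sum_i a i * w i); last by rewrite sa sb mulr0 subrr.
  rewrite mulr_sumr -sumrB; apply: eq_bigr => i _.
  have [_ e] := b'E i.
  have -> : l * (b' i * w i) = (b i - c' * a i) * w i by rewrite e mulrA.
  by ring.
apply: (mulfI l0); rewrite mulrA -ab.
have bE j : b j = c' * a j + l * b' j by have [_ <-] := b'E j; ring.
by move: i; apply: ord3_ind; rewrite /cross /= !bE; ring.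
Qed.

End Lines.

Lemma bipoly_line (A : comNzRingType) k (al be : A) :
  bipoly k ('X_(other k) - al%:MP * 'X_k - be%:MP) = 'X - (al%:P * 'X + be%:P)%:P.
Proof.
rewrite raddfB /= raddfB /= rmorphM /= !bipolyX !bipolyC eqxx other_neq.
by rewrite polyCD polyCM opprD addrA.
Qed.

(** * The lines x_2 = al x_1 + be x_0 *)

Section AffineLine.
Variable C : numClosedFieldType.
Implicit Types (F G l : {mpoly C[3]}) (a b : 'I_3 -> {mpoly C[3]}).
Variables al be : C.

Local Notation i0 := (0%R : 'I_2).
Local Notation i1 := (1%R : 'I_2).

Let y : {poly C} := al%:P * 'X + be%:P.

Definition affine_line : {mpoly C[3]} -> {poly C} :=
  horner_eval y \o bipoly 0 \o dehom (C := C).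
HB.instance Definition _ := GRing.RMorphism.on affine_line.

Lemma affine_lineE F : affine_line F = (bipoly 0 (dehom F)).[y].
Proof. by []. Qed.

(** The coefficient of degree k is the value of the part of degree k of p at the point at infinity
    of the line, and thus depends on the slope [al] only. *)
Lemma horner_bipoly (p : {mpoly C[2]}) (k : nat) : (msize p <= k.+1)%N ->
  (size (bipoly i0 p).[y] <= k.+1)%N /\
  (bipoly i0 p).[y]`_k = \sum_(m <- msupp p | mdeg m == k) p@_m * al ^+ m i1.
Proof.
move=> pk.
have E : (bipoly i0 p).[y] = \sum_(m <- msupp p) p@_m *: ('X ^+ m i0 * y ^+ m i1).
  rewrite {1}[p]mpolyE (raddf_sum (bipoly i0)) -[_.[y]]/(horner_eval y _) raddf_sum /=.
  apply: eq_bigr => m _; rewrite -mul_mpolyC rmorphM /= bipolyC bipolyXm /horner_eval.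
  by rewrite !hornerE /= -mulrA mul_polyC.
have sy n : (size (y ^+ n) <= n.+1)%N /\ (y ^+ n)`_n = al ^+ n.
  elim: n => [|n [IHs IHc]]; first by rewrite expr0 size_poly1 coef1.
  have yM (q : {poly C}) : y * q = al *: ('X * q) + be *: q.
    by rewrite mulrDl -mulrA !mul_polyC.
  rewrite exprS yM; split.
    rewrite (leq_trans (size_polyD _ _)) // geq_max.
    apply/andP; split; apply: (leq_trans (size_scale_leq _ _)); last exact: leqW.
    have [->|yn0] := eqVneq (y ^+ n) 0; first by rewrite mulr0 size_poly0.
    by rewrite mulrC size_mulX.
  rewrite coefD !coefZ coefXM /= IHc [X in _ + _ * X]nth_default ?mulr0 ?addr0 //.
  by rewrite exprS.
have sm (m : 'X_{1..2}) : (size ('X ^+ m i0 * y ^+ m i1)%R <= (mdeg m).+1)%N.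
  have -> : mdeg m = (m i0 + m i1)%N.
    by rewrite mdegE !big_ord_recl big_ord0 addn0; congr (_ + m _)%N; apply: val_inj.
  have [->|yn0] := eqVneq (y ^+ m i1) 0; first by rewrite mulr0 size_poly0.
  by rewrite mulrC size_mulXn // -addnS leq_add2l; case: (sy (m i1)).
rewrite E; split.
  apply: (leq_trans (size_sum _ _ _)); apply/bigmax_leqP_seq => m mp _.
  rewrite (leq_trans (size_scale_leq _ _)) // (leq_trans (sm m)) //.
  by rewrite (leq_trans (msize_mdeg_lt mp)).
rewrite coef_sum [RHS]big_mkcond !big_seq; apply: eq_bigr => m mp; rewrite coefZ.
have := msize_mdeg_lt mp => mk; case: eqVneq => [mE|nE]; last first.
  rewrite nth_default ?mulr0 // (leq_trans (sm m)) //.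
  by rewrite ltn_neqAle nE -ltnS (leq_trans mk).
have : mdeg m = (m i0 + m i1)%N.
  by rewrite mdegE !big_ord_recl big_ord0 addn0; congr (_ + m _)%N; apply: val_inj.
rewrite mE coefXnM => ->; rewrite ltnNge leq_addr /= addKn; congr (_ * _).
by case: (sy (m i1)).
Qed.

Lemma msize_univ k (q : {poly C}) : (msize (univ k q) <= size q)%N.
Proof.
rewrite univE (leq_trans (mmeasure_sum _ _ _ _)) //.
apply/bigmax_leqP => i _; rewrite (leq_trans (msizeZ_le _ _)) //.
by rewrite mpolyXn msizeX mdegMn mdeg1 mul1n.
Qed.

Definition affine_form : {mpoly C[3]} := 'X_ord_max - al%:MP * 'X_1 - be%:MP * 'X_0.

Lemma affine_line_restriction :
  line_restriction affine_line affine_form.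
Proof.
have d1 : dehom 'X_1 = 'X_0 :> {mpoly C[2]}.
  by rewrite -[RHS]dehom_XS; congr (dehom 'X_ _); apply: val_inj.
have d2 : dehom 'X_ord_max = 'X_1 :> {mpoly C[2]}.
  by rewrite -[RHS]dehom_XS; congr (dehom 'X_ _); apply: val_inj.
have dl : dehom affine_form =
    'X_1 - al%:MP * 'X_0 - be%:MP.
  by rewrite /affine_form !rmorphB !rmorphM /= d1 d2 dehom_X0 mulr1 /dehom !localizeC.
have bl : bipoly 0 (dehom affine_form) = 'X - y%:P.
  by rewrite dl -(bipoly_line 0).
have l0 : affine_form != 0 :> {mpoly C[3]}.
  by apply: (contraFneq _ (polyXsubC_eq0 y)) => e; rewrite -bl e !raddf0.
have hl : affine_form \is [in C[3], 1.-homog].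
  rewrite /affine_form; apply: rpredB; first exact: dhomog_linear.
  by rewrite mul_mpolyC; apply: rpredZ; rewrite dhomogX /= mdeg1.
have L0 : affine_line affine_form = 0.
  by rewrite affine_lineE bl !hornerE subrr.
split=> //.
- by move=> k F /msize_dehom /horner_bipoly[].
- move=> k q sq.
  have [|F [hF FE]] := @dehom_lift _ k (univ 0 q).
    by apply: leq_trans sq; apply: msize_univ.
  by exists F; split=> //; rewrite [LHS]affine_lineE FE bipoly_univ hornerC.
move=> k F hF /eqP /factor_theorem[Q QE].
have [q qE] := bipoly_surj 0 Q.
have FE : dehom F = dehom affine_form * q.
  by apply: (@bipoly_inj _ 0); rewrite rmorphM /= bl qE mulrC.
have [q0|q0] := eqVneq q 0.
  exists 0; rewrite rpred0 mulr0; split=> //.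
  by apply: (dehom_inj hF); rewrite ?rpred0 // FE q0 mulr0 raddf0.
have dl0 : dehom affine_form != 0 :> {mpoly C[2]}.
  by apply: (contraFneq _ (polyXsubC_eq0 y)) => e; rewrite -bl e raddf0.
have ml : (1 < msize (dehom affine_form))%N.
  rewrite ltnNge; apply/negP => /(msize_bipoly_const 0).
  by rewrite bl size_XsubC.
have aux x z n : (1 < x -> 0 < z -> (x + z).-1 <= n.+1 -> 0 < n /\ z <= n.-1.+1)%N by lia.
have [kp qk] : (0 < k /\ msize q <= k.-1.+1)%N.
  apply: (aux _ _ _ ml); first by rewrite lt0n mmeasure_poly_eq0.
  by rewrite -msizeM // -FE; apply: msize_dehom.
have [G [hG GE]] := dehom_lift qk; exists G; split=> //.
apply: (dehom_inj hF); last by rewrite rmorphM /= GE FE.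
by have := dhomogM hl hG; rewrite add1n prednK.
Qed.

End AffineLine.

(** * The line at infinity *)

Section LineAtInfinity.
Variable C : numClosedFieldType.
Implicit Types (F G : {mpoly C[3]}) (a : 'I_3 -> {mpoly C[3]}).

Local Notation j0 := (0%R : 'I_3).
Local Notation j1 := (1%R : 'I_3).
Local Notation j2 := (ord_max : 'I_3).

(** The line is parametrized by t -> (0 : 1 : t), without passing through the chart x_0 = 1, where
    it is invisible. Only (0 : 0 : 1) is missed. *)
Definition infinity_point (i : 'I_3) : {poly C} :=
  if i == j0 then 0 else if i == j1 then 1 else 'X.

Definition infinity_line : {mpoly C[3]} -> {poly C} := mmap polyC infinity_point.

Lemma infinity_line_is_additive : additive infinity_line.
Proof. exact: mmap_is_additive. Qed.
Lemma infinity_line_is_multiplicative : multiplicative infinity_line.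
Proof. exact: mmap_is_multiplicative. Qed.
HB.instance Definition _ :=
  GRing.isAdditive.Build _ _ infinity_line infinity_line_is_additive.
HB.instance Definition _ :=
  GRing.isMultiplicative.Build _ _ infinity_line infinity_line_is_multiplicative.

Lemma infinity_lineXm m : infinity_line 'X_[m] = (m j0 == 0%N)%:R *: 'X ^+ m j2.
Proof.
rewrite /infinity_line mmapX /mmap1.
have -> : \prod_(i < 3) infinity_point i ^+ m i =
    infinity_point j0 ^+ m j0 * infinity_point j1 ^+ m j1 * infinity_point j2 ^+ m j2.
  rewrite !big_ord_recl big_ord0 mulr1 -mulrA.
  have -> : lift ord0 ord0 = j1 by apply: val_inj.
  by have -> : lift ord0 (lift ord0 ord0) = j2 by apply: val_inj.
rewrite /infinity_point /= expr1n mulr1.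
by case: (m j0) => [|n]; rewrite ?expr0 ?mul1r ?scale1r // exprS !mul0r scale0r.
Qed.

Lemma infinity_lineZ c F : infinity_line (c *: F) = c *: infinity_line F.
Proof. by rewrite /infinity_line mmapZ mul_polyC. Qed.

Lemma infinity_lineE F :
  infinity_line F = \sum_(m <- msupp F) (F@_m * (m j0 == 0%N)%:R) *: 'X ^+ m j2.
Proof.
rewrite {1}[F]mpolyE (raddf_sum infinity_line) /=; apply: eq_bigr => m _.
by rewrite infinity_lineZ infinity_lineXm scalerA.
Qed.

Lemma mdeg3E (m : 'X_{1..3}) : mdeg m = (m j0 + m j1 + m j2)%N.
Proof.
rewrite mdegE !big_ord_recl big_ord0 addn0 -addnA.
by congr (_ + (m _ + m _))%N; apply: val_inj.
Qed.

Lemma mnm3P (m m' : 'X_{1..3}) : m j0 = m' j0 -> m j1 = m' j1 -> m j2 = m' j2 -> m = m'.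
Proof. by move=> e0 e1 e2; apply/mnmP; apply: ord3_ind. Qed.

Definition infinity_monom k j : 'X_{1..3} :=
  [multinom (if i == j0 then 0 else if i == j1 then k - j else j)%N | i < 3].

Lemma infinity_monom2 k j : infinity_monom k j j2 = j.
Proof. by rewrite mnmE. Qed.

Lemma infinity_monomE k (m : 'X_{1..3}) : mdeg m = k ->
  (m j0 == 0%N) = (m == infinity_monom k (m j2)).
Proof.
rewrite mdeg3E => mk; apply/eqP/eqP => [m0|->]; last by rewrite mnmE.
by apply: mnm3P; rewrite mnmE //= -mk m0 add0n addnK.
Qed.

Lemma coef_infinity_line k F j : F \is k.-homog -> (j <= k)%N ->
  (infinity_line F)`_j = F@_(infinity_monom k j).
Proof.
move=> /dhomogP hF jk; rewrite infinity_lineE coef_sum [F in RHS]mpolyE raddf_sum /=.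
rewrite !big_seq; apply: eq_bigr => m mF; rewrite coefZ coefXn mcoeffZ mcoeffX -mulrA.
congr (_ * _); rewrite -natrM mulnb; congr (_%:R); congr nat_of_bool.
rewrite (infinity_monomE (hF m mF)); apply/andP/eqP => [[/eqP e /eqP ->]|->].
  exact: e.
by rewrite infinity_monom2 !eqxx.
Qed.

Lemma infinity_line_restriction : line_restriction infinity_line 'X_j0.
Proof.
split.
- by rewrite dhomogX /= mdeg1.
- split; first by rewrite -(mmeasure_poly_eq0 mdeg) msizeX.
  by rewrite [LHS]infinity_lineXm mnm1E eqxx scale0r.
- move=> k F /dhomogP hF; change (size (infinity_line F) <= k.+1)%N; rewrite infinity_lineE.
  apply: (leq_trans (size_sum _ _ _)); apply/bigmax_leqP_seq => m mF _.
  rewrite (leq_trans (size_scale_leq _ _)) // size_polyXn ltnS.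
  by rewrite -(hF m mF) /= mdeg3E leq_addl.
- move=> k q sq; exists (\sum_(j < k.+1) q`_j *: 'X_[infinity_monom k j]); split.
    apply: rpred_sum => j _; apply: rpredZ; rewrite dhomogX /= mdeg3E !mnmE /=.
    by apply/eqP; rewrite add0n subnK // -ltnS.
  change (infinity_line (\sum_(j < k.+1) q`_j *: 'X_[infinity_monom k j]) = q).
  rewrite (raddf_sum infinity_line) /= -[RHS]coefK; apply/polyP => i.
  rewrite coef_sum coef_poly.
  transitivity (\sum_(j < k.+1) (if i == j then q`_j else 0)).
    apply: eq_bigr => j _; rewrite infinity_lineZ infinity_lineXm.
    rewrite scalerA !mnmE /= mulr1 coefZ coefXn.
    by case: (_ == _); rewrite ?mulr1 ?mulr0.
  rewrite -big_mkcond; case: ltnP => [iq|qi].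
    by rewrite (big_pred1 (Ordinal (leq_trans iq sq))).
  by rewrite big1 // => j /eqP <-; rewrite nth_default.
move=> k F hF LF0; have /dhomogP hF' := hF.
have m0 m : m \in msupp F -> (0 < m j0)%N.
  move=> mF; rewrite lt0n; apply: contraTneq mF => m00.
  apply/negP => mF; have mk := hF' m mF.
  have := mF; rewrite mcoeff_msupp => /negP; apply; move/eqP: m00; rewrite (infinity_monomE mk) => /eqP ->.
  rewrite -(coef_infinity_line hF); first by apply/eqP; rewrite [infinity_line F]LF0 coef0.
  by rewrite -mk /= mdeg3E leq_addl.
exists (\sum_(m <- msupp F) F@_m *: 'X_[m - U_(j0)]); split.
  rewrite big_seq; apply: rpred_sum => m mF; apply: rpredZ.
  rewrite dhomogX /=; have /(congr1 mdeg) : (m - U_(j0) + U_(j0))%MM = m.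
    by rewrite submK // lep1mP -lt0n m0.
  by rewrite mdegD mdeg1 (hF' m mF) => <-; rewrite addn1.
rewrite {1}[F]mpolyE mulr_sumr !big_seq; apply: eq_bigr => m mF.
by rewrite -scalerAr -mpolyXD addmC submK // lep1mP -lt0n m0.
Qed.

Lemma horner_infinity_line F t :
  (infinity_line F).[t] = F.@[fun i => (infinity_point i).[t]].
Proof.
rewrite /infinity_line /mmap -[LHS]/(horner_eval t _) raddf_sum mevalE /=.
apply: eq_bigr => m _; rewrite /horner_eval hornerM hornerC horner_prod; congr (_ * _).
by apply: eq_bigr => i _; rewrite horner_exp.
Qed.

(** The right side is the value at (0 : 0 : 1), the one point outside the parametrization; the
    degree clause of [nondegenerate_on] says that some form does not vanish there. *)
Lemma coef_infinity_line_top k F : F \is k.-homog ->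
  (infinity_line F)`_k = F.@[fun i => (i == j2)%:R].
Proof.
move=> hF; rewrite (coef_infinity_line hF) // mevalE [F in LHS]mpolyE raddf_sum /=.
have /dhomogP hF' := hF; rewrite !big_seq; apply: eq_bigr => m mF.
rewrite mcoeffZ mcoeffX; congr (_ * _); have := hF' m mF => /= mk.
have -> : \prod_(i < 3) ((i == j2)%:R : C) ^+ m i = 0 ^+ m j0 * 0 ^+ m j1 * 1 ^+ m j2.
  rewrite !big_ord_recl big_ord0 mulr1 -mulrA.
  have -> : lift ord0 ord0 = j1 by apply: val_inj.
  by have -> : lift ord0 (lift ord0 ord0) = j2 by apply: val_inj.
rewrite expr1n mulr1 !expr0n -natrM mulnb; congr (_%:R); congr nat_of_bool.
apply/eqP/andP => [->|[/eqP m0 /eqP m1]]; first by rewrite !mnmE /= subnn.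
apply: mnm3P; rewrite !mnmE ?m0 ?m1 ?subnn //=.
by rewrite -mk mdeg3E m0 m1.
Qed.

End LineAtInfinity.

(** * Nonzerodivisors from good lines, and existence of general lines *)

Section GoodLines.
Variable C : numClosedFieldType.
Implicit Types (F G l : {mpoly C[3]}) (w a b c : 'I_3 -> {mpoly C[3]}).

(** The form l is a nonzerodivisor modulo the ideal of w. On the line c becomes a syzygy of w; as w
    has no zero there, Cramer's rule still expresses it through a and b. After lifting the
    coefficients, k c - H' a + H b is divisible by l, and the product of the quotient with w is k
    F. *)
Lemma line_regular L l w e a b r r' k c s F :
  line_restriction L l -> nondegenerate_on L e w -> (forall i, w i \is e.-homog) ->
  (forall i, a i \is r.-homog) -> (forall i, b i \is r'.-homog) -> (r + r' = e)%N ->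
  syzygy w a -> syzygy w b -> k != 0 -> (forall i, cross a b i = k%:MP * w i) ->
  (forall i, c i \is s.-homog) -> \sum_i c i * w i = l * F ->
  exists c', (forall i, c' i \is s.-1.-homog) /\ \sum_i c' i * w i = F.
Proof.
move=> [hl [l0 Ll] sizeL liftL kerL] [[u eu] [i0 si0]] hw ha hb rr' sa sb k0 ab hc sc.
pose Lf (x : 'I_3 -> {mpoly C[3]}) i := L (x i).
have Lcross x z i : cross (Lf x) (Lf z) i = L (cross x z i).
  by rewrite /cross /Lf; case: ifP => _; [|case: ifP => _]; rewrite rmorphB !rmorphM.
have Lsyz x : syzygy w x -> \sum_i Lf x i * Lf w i = 0.
  move=> sx; have := congr1 L sx; rewrite rmorph0 rmorph_sum /= => e0.
  by apply: etrans e0; apply: eq_bigr => i _; rewrite rmorphM.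
have Lc : \sum_i Lf c i * Lf w i = 0.
  have := congr1 L sc; rewrite rmorphM /= Ll mul0r rmorph_sum => e0; apply: etrans e0.
  by apply: eq_bigr => i _; rewrite rmorphM.
(* The cross product with x has degree s + t, so its multiplier lifts to a form H of degree s + t -
   e, and H times a form of degree e - t has degree s. A zero multiplier is lifted to 0, whatever
   the degrees. *)
have par x t : syzygy w x -> (forall i, x i \is t.-homog) -> exists h H,
   [/\ forall i, cross (Lf c) (Lf x) i = h * Lf w i, L H = h
     & forall (y : 'I_3 -> {mpoly C[3]}) n, (forall i, y i \is n.-homog) -> (t + n = e)%N ->
       forall i, H * y i \is s.-homog].
  move=> sx hx.
  pose h := \sum_j u j * cross (Lf c) (Lf x) j.
  have hE : forall i, cross (Lf c) (Lf x) i = h * Lf w i.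
    by apply: (poly_parallel eu); apply: cross_parallel => //; apply: Lsyz.
  exists h; have [hz|h0] := eqVneq h 0.
    by exists 0; split=> [i||y n _ _ i]; rewrite ?hE ?hz ?rmorph0 // mul0r rpred0.
  have hcr : cross c x i0 \is (s + t).-homog.
    rewrite /cross; case: ifP => _; [|case: ifP => _]; apply: rpredB;
      do ?[exact: dhomogM]; by rewrite mulrC; apply: dhomogM.
  have := sizeL _ _ hcr; rewrite -Lcross => sz.
  have [est /liftL[H [hH HE]]] := poly_parallel_size si0 sz (hE i0) h0.
  exists H; split=> // y n hy tn i.
  have <- : (s + t - e + n = s)%N by lia.
  exact: dhomogM hH (hy i).
have [h [H [hE HE Hhom]]] := par a r sa ha.
have [h' [H' [h'E H'E H'hom]]] := par b r' sb hb.
have Lk : L k%:MP != 0.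
  have ku : (k^-1)%:MP * k%:MP = 1 :> {mpoly C[3]} by rewrite -mpolyCM mulVf.
  by apply: contra_eq_neq (congr1 L ku) => e0; rewrite rmorphM /= e0 mulr0 rmorph1 eq_sym oner_eq0.
have Lw0 : exists i, Lf w i != 0.
  by exists i0; rewrite -size_poly_gt0 /Lf si0.
have Lab i : cross (Lf a) (Lf b) i = L k%:MP * Lf w i by rewrite Lcross ab rmorphM.
have basis := cross_basis Lk Lw0 Lab hE h'E.
have /choice[c' c'E] i : exists G, G \is s.-1.-homog /\ k%:MP * c i - (H' * a i - H * b i) = l * G.
  apply: kerL.
    apply: rpredB; first by rewrite mul_mpolyC; apply: rpredZ; apply: hc.
    apply: rpredB; first by apply: (H'hom _ r) => //; rewrite addnC.
    by apply: (Hhom _ r').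
  rewrite rmorphB rmorphM rmorphB !rmorphM /= HE H'E.
  by rewrite [L k%:MP * L (c i)]basis subrr.
exists (fun i => (k^-1)%:MP * c' i); split=> [i|].
  by rewrite mul_mpolyC; apply: rpredZ; case: (c'E i).
apply: (mulfI l0); rewrite -sc mulr_sumr.
have ku : (k^-1)%:MP * k%:MP = 1 :> {mpoly C[3]} by rewrite -mpolyCM mulVf.
transitivity (\sum_i c i * w i - (k^-1)%:MP * (H' * \sum_i a i * w i - H * \sum_i b i * w i)).
  rewrite !mulr_sumr -sumrB mulr_sumr -sumrB; apply: eq_bigr => i _.
  have -> : l * ((k^-1)%:MP * c' i * w i) = (k^-1)%:MP * (l * c' i) * w i by ring.
  have [_ <-] := c'E i.
  have -> : (k^-1)%:MP * (k%:MP * c i - (H' * a i - H * b i)) * w i =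
    ((k^-1)%:MP * k%:MP) * c i * w i - (k^-1)%:MP * (H' * (a i * w i) - H * (b i * w i)).
    by ring.
  by rewrite ku mul1r.
by rewrite sa sb !mulr0 subrr mulr0 subr0.
Qed.

(** The slope avoids the zeros of the top form of one entry, so that this entry keeps its degree on
    the line. The intercept then avoids the common zeros, which lie in the finite grid given by the
    two eliminants. *)
Lemma exists_line r a : saturated r a ->
  exists al be, nondegenerate_on (affine_line al be) r a.
Proof.
move=> [ha ta [i0 si0]].
pose p := dehom (a i0); have p0 : p != 0 by rewrite -(mmeasure_poly_eq0 mdeg) si0.
pose i1 : 'I_2 := 1%R.
pose T : {poly C} := \sum_(m <- msupp p | mdeg m == r) p@_m *: 'X ^+ m i1.
have T0 : T != 0.
  pose m := mlead p.
  have mr : mdeg m = r by have := mlead_deg p0; rewrite si0 => -[].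
  have mdeg2 (m' : 'X_{1..2}) : mdeg m' = (m' 0%R + m' i1)%N.
    by rewrite mdegE !big_ord_recl big_ord0 addn0; congr (_ + m' _)%N; apply: val_inj.
  apply: contraTneq (mlead_supp p0); rewrite -/m.
  move/(congr1 (fun q : {poly C} => q`_(m i1))); rewrite coef0 coef_sum.
  move=> e0; have : p@_m = 0.
    rewrite -[RHS]e0 [p in LHS]mpolyE raddf_sum /= [RHS]big_mkcond.
    rewrite !big_seq; apply: eq_bigr => m' m'p.
    rewrite mcoeffZ mcoeffX; have := msize_mdeg_lt m'p; rewrite si0 ltnS => m'r.
    have [m'E|m'N] := eqVneq (mdeg m') r; last first.
      case: eqVneq => [e|_]; last by rewrite mulr0.
      by rewrite e mr eqxx in m'N.
    rewrite coefZ coefXn; congr (_ * _%:R); congr nat_of_bool.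
    apply/eqP/eqP => [->//|e1]; rewrite (bimonomE 0 m') (bimonomE 0 m).
    have : mdeg m' = mdeg m by rewrite m'E mr.
    by rewrite !mdeg2 e1 => /addIn ->; congr bimonom; rewrite /other /= e1.
  by move/eqP; rewrite mcoeff_eq0.
have [al Tal] := exists_nonroot T0.
have [D [D0 iD]] := ta 0; have [D' [D'0 iD']] := ta 1.
have [rD eD] := closed_field_poly_normal D; have [rD' eD'] := closed_field_poly_normal D'.
have [be beN] := exists_notin [seq z.2 - al * z.1 | z <- [seq (x, y) | x <- rD, y <- rD']].
exists al, be; split.
  apply: poly_unimodular => t; apply/not_existsP => nz; move/negP: beN; apply.
  have z0 i : (affine_line al be (a i)).[t] = 0 by apply/eqP; rewrite -[_ == _]negbK; apply/negP/nz.
  pose ev (q : {mpoly C[2]}) := (bipoly 0 q).[al%:P * 'X + be%:P].[t].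
  have ev0 q : in_ideal (fun i => dehom (a i)) q -> ev q = 0.
    move=> [c ->]; rewrite /ev (raddf_sum (bipoly 0)) -[(\sum_i _).[_]]/(horner_eval _ _).
    rewrite raddf_sum -[(\sum_i _).[_]]/(horner_eval _ _) raddf_sum big1 // => i _.
    by rewrite /= rmorphM /horner_eval !hornerM -affine_lineE z0 mulr0.
  have tD : t \in rD.
    have := ev0 _ iD; rewrite /ev bipoly_univ hornerC => /rootP.
    by rewrite eD rootZ ?lead_coef_eq0 // root_prod_XsubC.
  have tD' : al * t + be \in rD'.
    have := ev0 _ iD'; rewrite /ev -[1]/(other 0) bipoly_univ_other.
    rewrite -/(comp_poly _ _) horner_comp !hornerE => /rootP.
    by rewrite eD' rootZ ?lead_coef_eq0 // root_prod_XsubC.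
  apply/mapP; exists (t, al * t + be); first exact: allpairs_f.
  by rewrite /= addrC addKr.
have /horner_bipoly h := msize_dehom (ha i0); have [hs hc] := h al be.
exists i0; apply/anti_leq; rewrite hs /= ltnNge; apply: contraNN Tal => szr.
have := hc; rewrite nth_default // => /esym e0; rewrite -e0 /T -[_.[_]]/(horner_eval al _).
rewrite raddf_sum /=; apply/eqP; apply: eq_bigr => m _.
by rewrite /horner_eval hornerZ hornerXn.
Qed.

End GoodLines.

(** * Graded pieces as finite-dimensional vector spaces *)

Section GradedMaps.
Variable C : numClosedFieldType.
Implicit Types (F G : {mpoly C[3]}).

Definition graded k : vectType C := dhomog 3 C k.

Definition proj k F : graded k := DHomog (pihomogP mdeg k F).

Lemma projE k F : F \is k.-homog -> proj k F = F :> {mpoly C[3]}.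
Proof. exact: pihomog_dE. Qed.

Lemma gradedP k (u : graded k) : mpoly_of_dhomog u \is k.-homog.
Proof. by case: u. Qed.

Definition gspace n k : vectType C := {ffun 'I_n -> graded k}.

Lemma dim_gspace n k : \dim {: gspace n k} = (n * 'C(k + 2, 2))%N.
Proof.
rewrite dimvf /dim /= card_ord /dim /=; congr (_ * _)%N.
by rewrite -(bin_sub (leq_addr 2 k)) addKn.
Qed.

Definition gvec n k (b : 'I_n -> {mpoly C[3]}) : gspace n k := [ffun i => proj k (b i)].
Definition gval n k (v : gspace n k) (i : 'I_n) : {mpoly C[3]} := mpoly_of_dhomog (v i).

Lemma gval_homog n k (v : gspace n k) i : gval v i \is k.-homog.
Proof. exact: gradedP. Qed.

Lemma gvecE n k (b : 'I_n -> {mpoly C[3]}) i :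
  (forall i, b i \is k.-homog) -> gval (gvec k b) i = b i.
Proof. by move=> hb; rewrite /gval ffunE projE. Qed.

Lemma gval_inj n k (u v : gspace n k) : (forall i, gval u i = gval v i) -> u = v.
Proof. by move=> e; apply/ffunP=> i; apply/val_inj/e. Qed.

Lemma gval0 n k i : gval (0 : gspace n k) i = 0.
Proof. by rewrite /gval ffunE. Qed.

Lemma gvalD n k (u v : gspace n k) i : gval (u + v) i = gval u i + gval v i.
Proof. by rewrite /gval ffunE. Qed.

Lemma gvalZ n k c (u : gspace n k) i : gval (c *: u) i = c *: gval u i.
Proof. by rewrite /gval ffunE. Qed.

Lemma gval_sum n k (I : finType) (u : I -> gspace n k) i :
  gval (\sum_j u j) i = \sum_j gval (u j) i.
Proof.
by apply: (big_morph (fun u => gval u i)) => [x y|]; rewrite ?gvalD ?gval0.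
Qed.

Section Gmap.
Variables (n m : nat) (M : 'I_n -> 'I_m -> {mpoly C[3]}) (s k : nat).

(** The projection to degree k hidden in [gvec] makes the map linear for any M; it acts as the
    identity when the entries of M have degree k - s. *)
Definition gfun (v : gspace n s) : gspace m k :=
  gvec k (fun j => \sum_i gval v i * M i j).

Lemma gfun_is_linear : linear gfun.
Proof.
move=> c u v; apply/ffunP=> j; rewrite !ffunE; apply: val_inj => /=.
rewrite -linearP /=; congr (pihomog _ _ _); rewrite scaler_sumr -big_split /=.
by apply: eq_bigr => i _; rewrite gvalD gvalZ mulrDl scalerAl.
Qed.
HB.instance Definition _ := GRing.isLinear.Build _ _ _ _ gfun gfun_is_linear.

Definition gmap := linfun gfun.

Lemma gmapE d v j : (forall i j, M i j \is d.-homog) -> (s + d)%N = k ->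
  gval (gmap v) j = \sum_i gval v i * M i j.
Proof.
move=> hM sd; rewrite lfunE /= gvecE // => j'; rewrite -sd; apply: rpred_sum => i _.
by apply: dhomogM => //; apply: gval_homog.
Qed.

End Gmap.

(** This writes b -> a x b by a matrix, as [gmap] requires, the rows being the cross products of a
    with the unit vectors. *)
Lemma cross_sum (a b : 'I_3 -> {mpoly C[3]}) j :
  cross a b j = \sum_i b i * cross a (fun l => (l == i)%:R) j.
Proof. by rewrite sum3E; move: j; apply: ord3_ind; rewrite /cross /=; ring. Qed.

Lemma dhomog_cross a b r s j : (forall i, a i \is r.-homog) -> (forall i, b i \is s.-homog) ->
  @cross {mpoly C[3]} a b j \is (s + r).-homog.
Proof.
move=> ha hb; rewrite /cross; case: ifP => _; [|case: ifP => _]; apply: rpredB;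
  rewrite mulrC; do ?[exact: dhomogM]; by rewrite mulrC addnC; apply: dhomogM.
Qed.

End GradedMaps.

(** * Dimensions of the spaces of syzygies *)

Section Syzygies.
Variable C : numClosedFieldType.
Variables (e r : nat) (w a : 'I_3 -> {mpoly C[3]}).
Hypotheses (satw : saturated e w) (sata : saturated r a) (syza : syzygy w a).

Local Notation P k := ('C(k + 2, 2)).

Let hw i : w i \is e.-homog. Proof. by case: satw. Qed.
Let ha i : a i \is r.-homog. Proof. by case: sata. Qed.

Definition syz_map s := gmap (fun i (j : 'I_1) => w i) s (s + e).
Definition syz_space s := lker (syz_map s).
Definition cross_map s := gmap (fun i j => cross a (fun l => (l == i)%:R) j) s (s + r).
Definition scale_map n (u : 'I_n -> {mpoly C[3]}) s k := gmap (fun (i : 'I_1) j => u j) s k.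

Lemma mem_syz_space s v : (v \in syz_space s) <-> syzygy w (gval v).
Proof.
rewrite memv_ker; split=> [/eqP v0|sv].
  have := gmapE (M := fun i (j : 'I_1) => w i) v ord0 (fun i _ => hw i) (erefl (s + e)%N).
  by rewrite -/(syz_map s) v0 gval0 => /esym.
apply/eqP/gval_inj => j; rewrite gval0.
by rewrite (gmapE (M := fun i (j : 'I_1) => w i) v j (fun i _ => hw i) (erefl (s + e)%N)).
Qed.

Lemma cross_mapE s v j : gval (cross_map s v) j = cross a (gval v) j.
Proof.
rewrite [RHS]cross_sum; apply: (gmapE (d := r)) => // i j'.
by rewrite -[X in X.-homog]add0n; apply: dhomog_cross => // l; case: (_ == _);
  rewrite ?dhomog1 ?rpred0.
Qed.

Lemma scale_mapE n (u : 'I_n -> {mpoly C[3]}) s k d v j :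
  (forall i, u i \is d.-homog) -> (s + d)%N = k ->
  gval (scale_map u s k v) j = gval v ord0 * u j.
Proof. by move=> hu sd; rewrite (gmapE _ _ (fun _ => hu) sd) big_ord1. Qed.

Lemma lker_scale_map n (u : 'I_n -> {mpoly C[3]}) s k d :
  (forall i, u i \is d.-homog) -> (s + d)%N = k -> (exists i, u i != 0) ->
  lker (scale_map u s k) = 0%VS.
Proof.
move=> hu sd [i0 ui0]; apply/eqP; rewrite -subv0; apply/subvP => v.
rewrite memv_ker memv0 => /eqP v0; apply/eqP/gval_inj => i; rewrite ord1 gval0.
apply: (mulIf ui0); rewrite mul0r -(scale_mapE v i0 hu sd) v0.
exact: gval0.
Qed.

Lemma dim_scale_map n (u : 'I_n -> {mpoly C[3]}) s k d (U : {vspace gspace C 1 s}) :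
  (forall i, u i \is d.-homog) -> (s + d)%N = k -> (exists i, u i != 0) ->
  \dim (scale_map u s k @: U) = \dim U.
Proof.
by move=> hu sd u0; apply: limg_dim_eq; rewrite (lker_scale_map hu sd u0) capv0.
Qed.

Lemma dim_syz_map s : (\dim (syz_space s) + \dim (limg (syz_map s)) = 3 * P s)%N.
Proof. by rewrite -(dim_gspace C) -(limg_ker_dim (syz_map s) fullv) capfv. Qed.

(** A zero cross product with a means being parallel to a, and the entries of a have no common
    factor. *)
Lemma ker_cross_map s : (r <= s)%N ->
  (syz_space s :&: lker (cross_map s))%VS = limg (scale_map a (s - r) s).
Proof.
move=> rs; apply/eqP; rewrite eqEsubv; apply/andP; split; apply/subvP => v.
  rewrite memv_cap memv_ker => /andP[_ /eqP cv].
  have [||h [hh _ hE]] := saturated_parallel (m := s) (v := gval v) sata.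
  - exact: gval_homog.
  - by apply/cross_eq0 => i; rewrite -cross_mapE cv gval0.
  have -> : v = scale_map a (s - r) s (gvec _ (fun=> h)).
    apply: gval_inj => i; rewrite (scale_mapE _ _ ha (subnK rs)) gvecE //.
  by rewrite memv_img ?memvf.
case/memv_imgP => h _ ->; rewrite memv_cap memv_ker; apply/andP; split.
  apply/mem_syz_space; rewrite /syzygy.
  under eq_bigr do rewrite (scale_mapE _ _ ha (subnK rs)) -mulrA.
  by rewrite -mulr_sumr syza mulr0.
apply/eqP/gval_inj => j; rewrite cross_mapE gval0; move: j; apply/cross_eq0 => i j.
by rewrite !(scale_mapE _ _ ha (subnK rs)); ring.
Qed.

Lemma cross_map_scale s t : (s + r = t + e)%N ->
  (cross_map s @: syz_space s <= limg (scale_map w t (s + r)))%VS.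
Proof.
move=> st; apply/subvP => v /memv_imgP[b /mem_syz_space sb ->].
have [||h [hh _ hE]] := saturated_parallel (m := s + r) (v := cross a (gval b)) satw.
- by move=> i; apply: dhomog_cross => //; apply: gval_homog.
- exact: cross_parallel.
have te : (s + r - e = t)%N by lia.
rewrite te in hh.
have -> : cross_map s b = scale_map w t (s + r) (gvec _ (fun=> h)).
  by apply: gval_inj => i; rewrite cross_mapE (scale_mapE _ _ hw (esym st)) gvecE.
by rewrite memv_img ?memvf.
Qed.

Lemma dim_syz_space s : (r <= s)%N ->
  (\dim (syz_space s) = P (s - r) + \dim (cross_map s @: syz_space s))%N.
Proof.
move=> rs; rewrite -(limg_ker_dim (cross_map s) (syz_space s)) ker_cross_map //.
rewrite (dim_scale_map _ ha (subnK rs)) ?dim_gspace ?mul1n //.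
exact: saturated_neq0 sata.
Qed.

Lemma dim_scale_w s t : (s + r = t + e)%N -> \dim (limg (scale_map w t (s + r))) = P t.
Proof.
move=> st; rewrite (dim_scale_map _ hw (esym st)) ?dim_gspace ?mul1n //.
exact: saturated_neq0 satw.
Qed.

Lemma dim_syz_space_le s t : (r <= s)%N -> (s + r = t + e)%N ->
  (\dim (syz_space s) <= P (s - r) + P t)%N.
Proof.
move=> rs st; rewrite dim_syz_space // leq_add2l -(dim_scale_w st).
exact/dimvS/cross_map_scale.
Qed.

Lemma cross_descent L l s b h j : line_restriction L l -> nondegenerate_on L r a ->
  (forall i, b i \is s.-homog) -> syzygy w b ->
  (forall i, cross a b i = l ^+ j * h * w i) ->
  exists b', [/\ forall i, b' i \is (s - j).-homog, syzygy w b'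
    & forall i, cross a b' i = h * w i].
Proof.
move=> Ll nd; elim: j s b => [|j IHj] s b hb sb ab.
  by exists b; split=> // [i|i]; rewrite ?subn0 ?ab ?mul1r.
have [|b1 [hb1 sb1 ab1]] := cross_divide (h := l ^+ j * h) Ll nd ha syza hb sb.
  by move=> i; rewrite ab exprS !mulrA.
by have [b' [hb' ? ?]] := IHj _ _ hb1 sb1 ab1; exists b'; split=> // i; rewrite subnS -subn1 subnAC subn1.
Qed.

Lemma dim_syz_space_le_max s t t0 : (forall q b, (q < r)%N ->
    (forall i, b i \is q.-homog) -> syzygy w b -> forall i, b i = 0) ->
  (r <= s)%N -> (s + r = t + e)%N -> (t0 + e < r.*2)%N -> (t0 <= t)%N ->
  (\dim (syz_space s) + P t0 <= P (s - r) + P t)%N.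
Proof.
move=> minr rs st t0r t0t; rewrite dim_syz_space // -addnA leq_add2l -(dim_scale_w st).
have [al [be nd]] := exists_line sata.
have Ll := affine_line_restriction al be; set l := affine_form al be in Ll.
have [hl [l0 _] _ _ _] := Ll.
have hlj (i : 'I_1) : (fun=> l ^+ (t - t0)) i \is (t - t0).-homog.
  by rewrite -[X in X.-homog]mul1n; apply: dhomogMn.
(* The multiples h w with h in l^(t - t0) S_t0: a space of dimension dim S_t0, to be shown to meet
   the image of the cross product in 0. *)
pose U := (scale_map w t (s + r) @: (scale_map (fun _ : 'I_1 => l ^+ (t - t0)) t0 t @: fullv))%VS.
have dU : \dim U = P t0.
  rewrite (dim_scale_map _ hw (esym st)); last exact: saturated_neq0 satw.
  rewrite (dim_scale_map _ hlj (subnKC t0t)) ?dim_gspace ?mul1n //.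
  by exists ord0; rewrite expf_neq0.
rewrite -dU -dimv_disjoint_sum.
  apply: dimvS; rewrite subv_add (cross_map_scale st) limgS ?subvf //.
apply/eqP; rewrite -subv0; apply/subvP => v; rewrite memv_cap => /andP[].
case/memv_imgP => b /mem_syz_space sb ->.
case/memv_imgP => x /memv_imgP[h _ ->] e1; rewrite memv0.
have ab i : cross a (gval b) i = l ^+ (t - t0) * gval h ord0 * w i.
  rewrite -cross_mapE e1 (scale_mapE _ _ hw (esym st)) (scale_mapE _ _ hlj (subnKC t0t)).
  by rewrite [l ^+ _ * _]mulrC.
have [b' [hb' sb' ab']] := cross_descent Ll nd (gval_homog b) sb ab.
(* The degree of b' is s - (t - t0) = t0 + e - r, which is below r by the hypothesis on t0. *)
have b'0 : forall i, b' i = 0 by apply: (minr (s - (t - t0))%N) => //; lia.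
have h0 : gval h ord0 = 0.
  have [i wi] := saturated_neq0 satw; apply: (mulIf wi); rewrite -ab' mul0r.
  by rewrite /cross !b'0 !mulr0 !subrr; do 2?case: ifP.
apply/eqP/gval_inj => i; rewrite cross_mapE ab h0 mulr0 mul0r.
by rewrite gval0.
Qed.

(** A syzygy b0 of the complementary degree e - r realizes every multiple of w, as a x (h b0) = c h
    w; the bound on the dimension is then reached. *)
Lemma dim_syz_space_eq s t b0 c : (r <= s)%N -> (s + r = t + e)%N -> (r <= e)%N ->
  (forall i, b0 i \is (e - r).-homog) -> syzygy w b0 -> c != 0 ->
  (forall i, cross a b0 i = c%:MP * w i) ->
  (\dim (syz_space s) = P (s - r) + P t)%N.
Proof.
move=> rs st re hb0 sb0 c0 ab0; rewrite dim_syz_space // -(dim_scale_w st).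
congr (_ + \dim _)%N; apply/eqP; rewrite eqEsubv cross_map_scale //=.
apply/subvP => v /memv_imgP[h _ ->].
pose b i := (c^-1)%:MP * (gval h ord0 * b0 i).
have hb i : b i \is s.-homog.
  have -> : s = (t + (e - r))%N by lia.
  rewrite /b mul_mpolyC; apply: rpredZ; apply: dhomogM => //; exact: gval_homog.
have -> : scale_map w t (s + r) h = cross_map s (gvec s b).
  apply: gval_inj => i; rewrite cross_mapE (scale_mapE _ _ hw (esym st)).
  have cu : (c^-1)%:MP * c%:MP = 1 :> {mpoly C[3]} by rewrite -mpolyCM mulVf.
  transitivity ((c^-1)%:MP * gval h ord0 * cross a b0 i).
    by rewrite ab0 -[LHS]mul1r -cu; ring.
  by move: i; apply: ord3_ind; rewrite /cross /= !gvecE // /b; ring.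
apply/memv_img/mem_syz_space; rewrite /syzygy.
under eq_bigr do rewrite gvecE // /b -!mulrA.
by rewrite -!mulr_sumr sb0 !mulr0.
Qed.

Lemma dim_syz_space_eq_exists s t : (r <= s)%N -> (s + r = t + e)%N -> (r <= e)%N ->
  (P (s - r) + P t <= \dim (syz_space s))%N ->
  exists b0, [/\ forall i, b0 i \is (e - r).-homog, syzygy w b0
    & forall i, cross a b0 i = w i].
Proof.
move=> rs st re; rewrite dim_syz_space // leq_add2l -(dim_scale_w st) => dle.
have [al [be nd]] := exists_line sata.
have Ll := affine_line_restriction al be; set l := affine_form al be in Ll.
have [hl _ _ _ _] := Ll.
have /eqP eqV : (cross_map s @: syz_space s == limg (scale_map w t (s + r)))%VS.
  by rewrite eqEdim cross_map_scale.
(* Surjectivity is used for the single form l^t: dividing t times by l leaves a x b' = w, with b' of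
   degree s - t = e - r. *)
pose h : gspace C 1 t := gvec t (fun=> l ^+ t).
have hlt (i : 'I_1) : (fun=> l ^+ t) i \is t.-homog by rewrite -[X in X.-homog]mul1n; apply: dhomogMn.
have : scale_map w t (s + r) h \in (cross_map s @: syz_space s)%VS.
  by rewrite eqV memv_img // memvf.
case/memv_imgP => b /mem_syz_space sb e1.
have ab i : cross a (gval b) i = l ^+ t * 1 * w i.
  by rewrite -cross_mapE -e1 (scale_mapE _ _ hw (esym st)) gvecE // mulr1.
have [b' [hb' sb' ab']] := cross_descent Ll nd (gval_homog b) sb ab.
exists b'; split=> // i; last by rewrite ab' mul1r.
by have <- : (s - t = e - r)%N by lia.
Qed.

End Syzygies.

Lemma leastP (P : set nat) : (exists n, P n) ->
  P (least P) /\ forall m, P m -> (least P <= m)%N.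
Proof.
move=> exP; have exP' : exists n, `[< P n >] by have [n Pn] := exP; exists n; apply/asboolP.
have [n /asboolP Pn minn] := ex_minnP exP'.
have /xgetPex -/(_ 0%N) : exists n, P n /\ forall m, P m -> (n <= m)%N; last exact.
by exists n; split=> // m /asboolP; apply: minn.
Qed.

Lemma binomE n : (2 * 'C(n + 2, 2) = (n + 2) * (n + 1))%N.
Proof. by elim: n => // n IHn; rewrite addSn binS bin1 mulnDr IHn; lia. Qed.

(** The left side is the codimension of J in degree s + e when dim AR(f)_s reaches its bound dim
    S_(s-r) + dim S_t. With t = s + r - e the quadratic and linear terms in s cancel. *)
Lemma first_formula d s r t (e := d.-1) : (0 < d)%N -> (r <= s)%N -> (s + r = t + e)%N ->
  ('C(s + e + 2, 2))%:Z - 3 * ('C(s + 2, 2))%:Z + ('C(s - r + 2, 2))%:Z + ('C(t + 2, 2))%:Z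
  = (d%:Z - 1) * (d%:Z - r%:Z - 1) + r%:Z ^+ 2.
Proof.
move=> d_gt0 rs st; have e1 := binomE (s + e); have e2 := binomE s.
have e3 := binomE (s - r); have e4 := binomE t.
have de : d = e.+1 by rewrite /e prednK.
have [u su] : exists u, s = (r + u)%N by exists (s - r)%N; lia.
have tE : t%:Z = (r + u + r)%:Z - e%:Z by lia.
have su' : (s - r = u)%N by lia.
move: e1 e2 e3 e4; rewrite su' su.
move: ('C(_, _)) => b1; move: ('C(_, _)) => b2; move: ('C(_, _)) => b3; move: ('C(_, _)) => b4.
move=> e1 e2 e3 e4; rewrite de.
have {}e1 : 2 * b1%:Z = (r%:Z + u%:Z + e%:Z + 2) * (r%:Z + u%:Z + e%:Z + 1) by lia.
have {}e2 : 2 * b2%:Z = (r%:Z + u%:Z + 2) * (r%:Z + u%:Z + 1) by lia.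
have {}e3 : 2 * b3%:Z = (u%:Z + 2) * (u%:Z + 1) by lia.
have {}e4 : 2 * b4%:Z = (t%:Z + 2) * (t%:Z + 1) by lia.
rewrite tE in e4; lia.
Qed.

(** * The curve, its homogenization and the two notions of minimal degree *)

Section Curve.
Variable R : realType.
Local Notation C := R[i].
Variables (d : nat) (g : {mpoly C[2]}).
Hypotheses (d_gt0 : (0 < d)%N) (deg_g : deg g = d) (red_g : reduced g).

Let f := homogenize g.
Definition partials (F : {mpoly C[3]}) (i : 'I_3) := mderiv i F.
Let w := partials f.

Lemma msize_reduced : msize g = d.+1.
Proof. by rewrite -deg_g /deg; apply: mpolySpred; case: red_g. Qed.

Lemma homogenize_homog : f \is d.-homog.
Proof.
rewrite /f /homogenize big_seq; apply: rpred_sum => m mg; apply: rpredZ.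
rewrite dhomogX /= -[X in mdeg X]/(hmonom (deg g) m) deg_g mdeg_hmonom //.
by rewrite -ltnS -msize_reduced msize_mdeg_lt.
Qed.

Lemma dehom_homogenize : dehom f = g.
Proof.
rewrite /f /homogenize (raddf_sum (@dehom C)) [RHS]mpolyE; apply: eq_bigr => m _ /=.
by rewrite linearZ /= -[X in 'X_[X]]/(hmonom (deg g) m) dehom_hmonom.
Qed.

Lemma homogenize_neq0 : f != 0.
Proof.
have [g0 _] := red_g; apply: contraNneq g0 => f0.
by rewrite -dehom_homogenize f0 raddf0.
Qed.

Lemma deg_homogenize : deg f = d.
Proof.
have := homogenize_neq0 => f0; rewrite /deg.
exact: (dhomog_uniq f0 (dhomog_msize homogenize_homog) homogenize_homog).
Qed.

Lemma thin_reduced : thin (gradient g).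
Proof.
apply: thin_gradient; first by rewrite msize_reduced ltnS.
move=> h q e; have [_ /(_ h q e)] := red_g.
by rewrite /deg; case: (msize h) => [|[|]].
Qed.

Lemma saturated_partials : saturated d.-1 w.
Proof.
apply: (saturated_grad homogenize_homog d_gt0); rewrite dehom_homogenize.
  exact: msize_reduced.
exact: thin_reduced.
Qed.

Lemma partials_homog i : w i \is d.-1.-homog.
Proof. by case: saturated_partials. Qed.

(** This Koszul syzygy shows that the set defining [mdr_proj] is not empty and that mdr(f) <= d -
    1. *)
Lemma koszul_homog : exists a, [/\ forall i, a i \is d.-1.-homog, syzygy w a
  & exists i, a i != 0].
Proof.
have [i wi] := saturated_neq0 saturated_partials.
pose j : 'I_3 := if i == ord0 then ord_max else ord0.
have ij : (i == j) = false by rewrite /j; case: (eqVneq i ord0) => [->|/negPf ->].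
have ji : (j == i) = false by rewrite eq_sym.
exists (fun k => if k == i then w j else if k == j then - w i else 0); split.
- move=> k; case: ifP => _; first exact: partials_homog.
  by case: ifP => _; rewrite ?rpredN ?rpred0 // partials_homog.
- rewrite /syzygy (bigD1 i) //= (bigD1 j) /=; last by rewrite ji.
  rewrite !eqxx ji big1; first by rewrite addr0 mulNr mulrC subrr.
  by move=> k /andP[/negPf -> /negPf ->]; rewrite mul0r.
by exists j; rewrite ji eqxx oppr_eq0.
Qed.

Lemma mdr_projP : exists a, [/\ forall i, a i \is (mdr_proj f).-homog, syzygy w a,
  (exists i, a i != 0), (mdr_proj f <= d.-1)%N
  & forall s b, (s < mdr_proj f)%N -> (forall i, b i \is s.-homog) -> syzygy w b ->
     forall i, b i = 0].
Proof.
have rowE (b : 'I_3 -> {mpoly C[3]}) i : (\row_j b j) ord0 i = b i by rewrite mxE.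
have syzE b : syzygy w (fun i => (\row_j b j) ord0 i) <-> syzygy w b.
  by rewrite /syzygy; under eq_bigr do rewrite rowE.
pose Pr : set nat := [set r | exists a, AR_proj_deg f r a /\ a != 0]%classic.
have nz (b : 'I_3 -> {mpoly C[3]}) i : b i != 0 -> \row_j b j != 0.
  by apply: contra_neq => /rowP/(_ i); rewrite !mxE.
have PrI b s : (forall i, b i \is s.-homog) -> syzygy w b -> (exists i, b i != 0) -> Pr s.
  move=> hb sb [i bi]; exists (\row_j b j); split; last exact: nz bi.
  by split=> [|i']; [apply/syzE | rewrite rowE].
have [a0 [ha0 sa0 a00]] := koszul_homog.
have [|[a [[sa ha] a0']] minr] := @leastP Pr; first by exists d.-1; apply: PrI a00.
exists (fun i => a ord0 i); split=> //.
- apply/not_existsP => z; case/eqP: a0'; apply/rowP => i; rewrite mxE.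
  by apply/eqP; rewrite -[_ == _]negbK; apply/negP/z.
- exact: minr (PrI _ _ ha0 sa0 a00).
move=> s b sr hb sb i; apply/eqP; rewrite -[_ == _]negbK; apply/negP => bi.
by move: sr; rewrite ltnNge (minr s) //; apply: PrI sb _ => //; exists i.
Qed.

Lemma saturated_mdr a : (forall i, a i \is (mdr_proj f).-homog) -> syzygy w a ->
  (exists i, a i != 0) -> saturated (mdr_proj f) a.
Proof.
move=> ha sa a0; have [_ [_ _ _ _ minr]] := mdr_projP.
exact: saturated_minimal_syzygy partials_homog ha sa a0 minr.
Qed.

(** Dehomogenizing f_0 by Euler's relation turns a syzygy (a_0, a_1, a_2) of f into (d a_0, a_1 -
    x_1 a_0, a_2 - x_2 a_0) for g, with the a_i dehomogenized. The three expressions in [sdeg]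
    become d a_0, d a_1, d a_2, so [sdeg] is the largest degree of the dehomogenized a_i. *)
Lemma mdr_affE : mdr_aff g = mdr_proj f.
Proof.
have dC : (d%:R : C) != 0 by rewrite pnatr_eq0 -lt0n.
have [a [ha sa a0 rd minr]] := mdr_projP.
pose Pg : set nat := [set s | exists a, [/\ AR_aff g a, a != 0 & sdeg (deg g) a = s]]%classic.
have dw0 : dehom (w ord0) = d%:R *: g - \sum_(k < 2) 'X_k * mderiv k g.
  by rewrite /w /partials (dehom_mderiv0 homogenize_homog) dehom_homogenize.
have dwS k : dehom (w (lift ord0 k)) = mderiv k g.
  by rewrite /w /partials dehom_mderiv dehom_homogenize.
have relE (al b : 'I_3 -> {mpoly C[2]}) : al ord0 = d%:R *: b ord0 ->
    (forall k, al (lift ord0 k) = b (lift ord0 k) - 'X_k * b ord0) ->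
    al ord0 * g + \sum_(k < 2) al (lift ord0 k) * mderiv k g = \sum_i b i * dehom (w i).
  move=> e0 eS; rewrite [RHS]big_ord_recl dw0 e0 mulrBr -scalerAl -scalerAr -addrA; congr (_ + _).
  rewrite addrC mulr_sumr -sumrB; apply: eq_bigr => k _.
  by rewrite eS dwS; ring.
pose al := \row_i (if unlift ord0 i is Some k then dehom (a i) - 'X_k * dehom (a ord0)
                   else d%:R *: dehom (a ord0)).
have al0E : al ord0 ord0 = d%:R *: dehom (a ord0) by rewrite mxE unlift_none.
have alSE k : al ord0 (lift ord0 k) = dehom (a (lift ord0 k)) - 'X_k * dehom (a ord0).
  by rewrite mxE liftK.
have sdegE (b : 'rV[{mpoly C[2]}]_3) (c : 'I_3 -> {mpoly C[2]}) :
    b ord0 ord0 = d%:R *: c ord0 ->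
    (forall k, b ord0 (lift ord0 k) = c (lift ord0 k) - 'X_k * c ord0) ->
    sdeg d b = (\max_i msize (c i)).-1.
  move=> e0 eS; rewrite /sdeg [in RHS]big_ord_recl e0 msizeZ //; congr (maxn _ _).-1.
  apply: eq_bigr => k _; rewrite eS -scaler_nat scalerBr -scalerAr subrK.
  by rewrite msizeZ.
have nz3 (c : 'I_3 -> {mpoly C[2]}) : (exists i, c i != 0) -> (0 < \max_i msize (c i))%N.
  move=> [i ci]; apply: leq_trans (leq_bigmax (F := fun i => msize (c i)) i).
  by rewrite lt0n mmeasure_poly_eq0.
have da0 i : a i != 0 -> dehom (a i) != 0.
  by apply: contra_neq => e0; apply: (dehom_inj (ha i)); rewrite ?rpred0 // e0 raddf0.
have Pal : Pg (sdeg (deg g) al).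
  exists al; split=> //.
    rewrite /AR_aff /= (relE _ (fun i => dehom (a i))) //.
    have := congr1 (@dehom C) sa; rewrite raddf0 raddf_sum /= => e0; apply: etrans e0.
    by apply: eq_bigr => i _; rewrite rmorphM.
  have [i /da0] := a0; apply: contraNneq => al0.
  have d0 : dehom (a ord0) = 0.
    have /esym/eqP := al0E; rewrite al0 mxE scaler_eq0 (negPf dC) /=.
    by move/eqP.
  case: (unliftP ord0 i) => [k|] ->; last exact/eqP.
  by have /esym/eqP := alSE k; rewrite al0 mxE d0 mulr0 subr0.
have [|[b [relb b0 sb]] minb] := @leastP Pg; first by exists (sdeg (deg g) al).
apply/anti_leq/andP; split.
  apply: leq_trans (minb _ Pal) _; rewrite deg_g (sdegE _ (fun i => dehom (a i))) //.
  suff : (\max_i msize (dehom (a i)) <= (mdr_proj f).+1)%N by case: (\max_i _)%N.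
  by apply/bigmax_leqP => i _; apply: msize_dehom.
rewrite leqNgt; apply/negP => sr.
(* The inverse change of coordinates: a value of [sdeg] below mdr(f) would lift to a nonzero syzygy
   of f of that degree. *)
pose c i := if unlift ord0 i is Some k then
   b ord0 (lift ord0 k) + 'X_k * (d%:R^-1 *: b ord0 ord0) else d%:R^-1 *: b ord0 ord0.
have c0E : b ord0 ord0 = d%:R *: c ord0.
  by rewrite /c unlift_none scalerA mulfV // scale1r.
have cSE k : b ord0 (lift ord0 k) = c (lift ord0 k) - 'X_k * c ord0.
  by rewrite /c liftK unlift_none addrK.
have c_neq0 : exists i, c i != 0.
  apply/not_existsP => cz; have c0 i : c i = 0 by apply/eqP; rewrite -[_ == _]negbK; apply/negP/cz.
  case/eqP: b0; apply/rowP => i; rewrite mxE; case: (unliftP ord0 i) => [k|] ->.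
    by rewrite cSE !c0 mulr0 subr0.
  by rewrite c0E c0 scaler0.
have csz i : (msize (c i) <= (mdr_aff g).+1)%N.
  apply: leq_trans (leq_bigmax (F := fun i => msize (c i)) i) _; rewrite /mdr_aff -/Pg -sb deg_g (sdegE _ c) //.
  by rewrite prednK // nz3.
have /choice[B hB] i := dehom_lift (csz i).
have sB : syzygy w B.
  apply: (@dehom_inj _ (mdr_aff g + d.-1)); rewrite ?rpred0 //.
    apply: rpred_sum => i _; apply: dhomogM; last exact: partials_homog.
    by case: (hB i).
  rewrite raddf_sum [RHS]raddf0 /=; apply: etrans relb; rewrite (relE _ c) //.
  by apply: eq_bigr => i _; rewrite rmorphM /=; case: (hB i) => _ ->.
have [k ck] := c_neq0; move: ck; case: (hB k) => _ <-.
by rewrite (minr _ B sr) ?raddf0 ?eqxx // => i; case: (hB i).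
Qed.

Lemma dim_jacobian_le : exists s0, forall s, (s0 <= s)%N ->
  ('C(s + d.-1 + 2, 2))%:Z - (\dim (limg (syz_map d.-1 w s)))%:Z <= tau_max d (mdr_proj f).
Proof.
have [a [ha sa a0 rd minr]] := mdr_projP.
have sata := saturated_mdr ha sa a0; set r := mdr_proj f in sata minr rd *.
exists (r + d)%N => s sge.
have [t st] : exists t, (s + r = t + d.-1)%N by exists (s + r - d.-1)%N; lia.
have rs : (r <= s)%N by lia.
have dimE := dim_syz_map d.-1 w s.
have ff := first_formula d_gt0 rs st.
rewrite /tau_max -ff; case: ltnP => rd2.
  have := dim_syz_space_le saturated_partials sata sa rs st; lia.
have t0E : (r.*2 - d + 2 = (r.*2 - d) + 2)%N by [].
(* The value t0 = 2 r - d is the largest one with t0 + (d - 1) < 2 r, and dim S_t0 is the binomial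
   subtracted in [tau_max]. *)
have := dim_syz_space_le_max saturated_partials sata sa minr rs st (t0 := (r.*2 - d)%N).
move=> /(_ _ _); lia.
Qed.

End Curve.

(** * Homogeneous components and bases of the syzygy module *)

Section FreeSyzygies.
Variable C : numClosedFieldType.
Implicit Types (F G h : {mpoly C[3]}) (u v y : 'I_3 -> {mpoly C[3]}).
Local Notation comp k u := (fun i => pihomog mdeg k (u i)).

Lemma pihomog_sum_decomposition F : exists N, forall n, (N <= n)%N ->
  F = \sum_(k < n) pihomog mdeg k F.
Proof. by exists (msize F) => n; apply: pihomog_partitionE. Qed.

Lemma pihomogM k F G :
  pihomog mdeg k (F * G) = \sum_(j < k.+1) pihomog mdeg j F * pihomog mdeg (k - j) G.
Proof.
have [NF eF] := pihomog_sum_decomposition F.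
have [NG eG] := pihomog_sum_decomposition G.
pose N := (NF + NG + k).+1.
have hF : F = \sum_(j < N) pihomog mdeg j F by apply: eF; rewrite /N; lia.
have hG : G = \sum_(j < N) pihomog mdeg j G by apply: eG; rewrite /N; lia.
rewrite {1}hF {1}hG mulr_suml (raddf_sum (pihomog mdeg k)) /=.
rewrite (big_ord_widen N (fun j => pihomog mdeg j F * pihomog mdeg (k - j) G)); last first.
  by rewrite /N; lia.
rewrite [RHS]big_mkcond /=; apply: eq_bigr => j _.
rewrite mulr_sumr (raddf_sum (pihomog mdeg k)) /=.
have term (l : 'I_N) : pihomog mdeg k (pihomog mdeg j F * pihomog mdeg l G) =
    if (j + l == k)%N then pihomog mdeg j F * pihomog mdeg l G else 0.
  have hjl := dhomogM (pihomogP mdeg j F) (pihomogP mdeg l G).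
  case: eqVneq => [<-|jlk]; first by rewrite pihomog_dE.
  exact: (pihomog_ne0 jlk).
under eq_bigr do rewrite term.
case: ltnP => [jk|kj]; last by rewrite big1 // => l _; case: eqP => //; lia.
have kN : (k - j < N)%N by rewrite /N; lia.
rewrite (bigD1 (Ordinal kN)) //= subnKC // eqxx big1 ?addr0 // => l.
by rewrite -val_eqE /= => lk; case: eqP => // e; case/eqP: lk; lia.
Qed.

Lemma pihomogMr k e F G : G \is e.-homog ->
  pihomog mdeg (k + e) (F * G) = pihomog mdeg k F * G.
Proof.
move=> hG; rewrite pihomogM.
have ke : (k < (k + e).+1)%N by lia.
rewrite (bigD1 (Ordinal ke)) //= addKn (pihomog_dE hG) big1 ?addr0 // => j.
rewrite -val_eqE /= => jk; rewrite [pihomog _ _ G](pihomog_ne0 _ hG) ?mulr0 //.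
by apply/eqP => e1; case/eqP: jk; have := ltn_ord j; lia.
Qed.

Lemma syzygy_comp e w u k : (forall i, w i \is e.-homog) -> syzygy w u ->
  syzygy w (comp k u).
Proof.
move=> hw su; rewrite /syzygy; have := congr1 (pihomog mdeg (k + e)) su.
rewrite raddf0 raddf_sum /= => e0; apply: etrans e0.
by apply: eq_bigr => i _; rewrite pihomogMr.
Qed.

(** The relation splits by degree, since the w_i are forms of the same degree; the multipliers of
    the components of v add up. *)
Lemma saturated_parallel_general e w v : saturated e w ->
  (forall i j, v i * w j = v j * w i) -> exists h, forall i, v i = h * w i.
Proof.
move=> sw par; have [hw _ _] := sw.
have /choice[h hE] k : exists h, forall i, pihomog mdeg k (v i) = h * w i.
  have [||h [_ _ hE]] := saturated_parallel (m := k) (v := comp k v) sw.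
  - by move=> i; apply: pihomogP.
  - by move=> i j; rewrite -!(pihomogMr _ _ (hw _)) par.
  by exists h.
pose N := \max_i msize (v i).
exists (\sum_(k < N) h k) => i.
have {1}-> : v i = \sum_(k < N) pihomog mdeg k (v i).
  by apply: pihomog_partitionE; apply: (leq_bigmax (F := fun i => msize (v i))).
by rewrite mulr_suml; apply: eq_bigr => k _.
Qed.

Lemma syzygy_cross e w u v : saturated e w -> syzygy w u -> syzygy w v ->
  exists h, forall i, cross u v i = h * w i.
Proof. by move=> sw su sv; apply: (saturated_parallel_general sw); apply: cross_parallel. Qed.

(** The witnesses are cross products of w with two unit vectors. These products test a basis of the
    syzygies: it must have at least two elements, and for a basis of two, whose cross product is h
    w, the factor h must divide every w_k. *)
Lemma koszul_cross w k : exists y y', [/\ syzygy w y, syzygy w y'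
  & forall i, cross y y' i = w k * w i].
Proof.
pose D (j : 'I_3) (l : 'I_3) : {mpoly C[3]} := (l == j)%:R.
have syzK j : syzygy w (cross w (D j)).
  have [e _] := cross_orthogonal w (D j).
  by rewrite /syzygy; under eq_bigr do rewrite mulrC.
move: k; apply: ord3_ind.
- exists (cross w (D 1)), (cross w (D ord_max)); split=> //.
  by apply: ord3_ind; rewrite /cross /D /=; ring.
- exists (cross w (D ord_max)), (cross w (D 0)); split=> //.
  by apply: ord3_ind; rewrite /cross /D /=; ring.
- exists (cross w (D 0)), (cross w (D 1)); split=> //.
  by apply: ord3_ind; rewrite /cross /D /=; ring.
Qed.

Lemma mpoly_unit_const n (h z : {mpoly C[n]}) : h * z = 1 -> exists2 c, c != 0 & h = c%:MP.
Proof.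
move=> hz; have h0 : h != 0 by apply: contra_eq_neq hz => ->; rewrite mul0r eq_sym oner_eq0.
have z0 : z != 0 by apply: contra_eq_neq hz => ->; rewrite mulr0 eq_sym oner_eq0.
have aux a b : ((a + b).-1 = 1 -> 0 < b -> a <= 1)%N by lia.
have /msize1_polyC hE : (msize h <= 1)%N.
  apply: (aux _ (msize z)); last by rewrite lt0n mmeasure_poly_eq0.
  by rewrite -msizeM // hz msize1.
exists h@_0; last exact: hE.
by apply: contraNneq h0 => e; rewrite hE e mpolyC0.
Qed.

Lemma homog0_const n (h : {mpoly C[n]}) : h \is 0.-homog -> h != 0 ->
  exists2 c, c != 0 & h = c%:MP.
Proof.
move=> /dhomogP hh h0.
have /msize1_polyC hE : (msize h <= 1)%N.
  by rewrite msizeE; apply/bigmax_leqP_seq => m mh _; rewrite (hh m mh).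
exists h@_0; last exact: hE.
by apply: contraNneq h0 => e; rewrite hE e mpolyC0.
Qed.

Lemma degree_balance (j r e : nat) : (j <= e -> r <= j -> r <= e - j ->
  (e <= j + r -> [/\ j + r - e = 0, r <= e & e - r = j]) /\
  (e <= e - j + r -> [/\ e - j + r - e = 0, r <= e & e - j = e - r]))%N.
Proof. by move=> *; split=> *; split; lia. Qed.

(** The basis u, v need not be homogeneous. Some components of degrees j and e - j have a nonzero
    cross product, which is a constant multiple of w, and both degrees are at least r. One of the
    two components is not parallel to a; its cross product with a is a nonzero multiple of w, which
    forces its degree to be e - r. *)
Lemma homogeneous_complement e r w a u v c : saturated e w -> saturated r a ->
  syzygy w a -> (forall s b, (s < r)%N -> (forall i, b i \is s.-homog) -> syzygy w b ->
     forall i, b i = 0) ->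
  syzygy w u -> syzygy w v -> c != 0 -> (forall i, cross u v i = c%:MP * w i) ->
  exists b0 c0, [/\ (r <= e)%N, forall i, b0 i \is (e - r).-homog, syzygy w b0,
    c0 != 0 & forall i, cross a b0 i = c0%:MP * w i].
Proof.
move=> sw sata sa minr su sv c0 uv; have [hw _ _] := sw; have [ha _ _] := sata.
have [i0 wi0] := saturated_neq0 sw.
have [j [je nz]] : exists j, (j <= e)%N /\ cross (comp j u) (comp (e - j) v) i0 != 0.
  apply/not_existsP => allz.
  have zj j : (j <= e)%N -> cross (comp j u) (comp (e - j) v) i0 = 0.
    by move=> je; apply/eqP; rewrite -[_ == _]negbK; apply/negP => nz; apply: (allz j).
  (* In degree e the cross product is the sum of those of components of complementary degrees. As w
     has degree e, this sum is c w, which is not zero. *)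
  have : pihomog mdeg e (cross u v i0) = 0.
    transitivity (\sum_(j < e.+1) cross (comp j u) (comp (e - j) v) i0); last first.
      by rewrite big1 // => j _; apply: zj; rewrite -ltnS.
    by rewrite /cross; case: ifP => _; [|case: ifP => _];
      rewrite (raddfB (pihomog mdeg e)) /= !pihomogM -sumrB.
  rewrite uv mul_mpolyC linearZ /= (pihomog_dE (hw i0)) => /eqP.
  by rewrite scaler_eq0 (negPf c0) (negPf wi0).
set u' := comp j u in nz; set v' := comp (e - j) v in nz.
have su' : syzygy w u' by apply: syzygy_comp su.
have sv' : syzygy w v' by apply: syzygy_comp sv.
have hu' i : u' i \is j.-homog by apply: pihomogP.
have hv' i : v' i \is (e - j).-homog by apply: pihomogP.
have cross_hom y t y' t' : (forall i, y i \is t.-homog) -> (forall i, y' i \is t'.-homog) ->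
    syzygy w y -> syzygy w y' -> exists h, [/\ h \is (t' + t - e).-homog,
      (h != 0 -> (e <= t' + t)%N) & forall i, cross y y' i = h * w i].
  move=> hy hy' sy sy'; apply: saturated_parallel sw _ _; last exact: cross_parallel.
  by move=> i; apply: dhomog_cross.
have [H [hH _ HE]] := cross_hom _ _ _ _ hu' hv' su' sv'.
have H0 : H != 0 by apply: contraNneq nz => H0; rewrite HE H0 mul0r.
have [k k0 Hk] : exists2 k, k != 0 & H = k%:MP.
  by apply: homog0_const H0; move: hH; rewrite subnK // subnn.
have rj : (r <= j)%N.
  rewrite leqNgt; apply: contraNN nz => jr.
  by rewrite /cross !(minr _ _ jr hu' su') !mul0r subrr; do 2?case: ifP.
have rej : (r <= e - j)%N.
  rewrite leqNgt; apply: contraNN nz => jr.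
  by rewrite /cross !(minr _ _ jr hv' sv') !mulr0 subrr; do 2?case: ifP.
have [h [hh hle hE]] := cross_hom _ _ _ _ ha hu' sa su'.
have [h' [hh' hle' h'E]] := cross_hom _ _ _ _ ha hv' sa sv'.
have [bal bal'] := degree_balance je rj rej.
have [h00|h0] := eqVneq h 0; last first.
  have [e1 e2 e3] := bal (hle h0).
  have hh0 : h \is 0.-homog by move: hh; rewrite e1.
  have [k' k'0 hk'] := homog0_const hh0 h0.
  by exists u', k'; split=> // i; rewrite ?e3 ?hE ?hk'.
have [h'00|h'0] := eqVneq h' 0; last first.
  have [e1 e2 e3] := bal' (hle' h'0).
  have hh0 : h' \is 0.-homog by move: hh'; rewrite e1.
  have [k' k'0 hk'] := homog0_const hh0 h'0.
  by exists v', k'; split=> // i; rewrite -?e3 ?h'E ?hk'.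
(* If a were parallel to both components, Cramer's rule would give a = 0. *)
have [i1 ai1] := saturated_neq0 sata.
have := cross_basis H0 (saturated_neq0 sw) HE hE h'E i1.
rewrite h00 h'00 !mul0r subrr => /eqP; rewrite mulf_eq0 (negPf H0) (negPf ai1).
by [].
Qed.

(** Cramer's rule has the constant denominator c, hence gives polynomial coordinates. The cross
    products of y with b0 and with a recover these coordinates, whence uniqueness. *)
Lemma free_basis e r w a b0 c : saturated e w -> saturated r a -> syzygy w a ->
  syzygy w b0 -> c != 0 -> (forall i, cross a b0 i = c%:MP * w i) ->
  forall y, syzygy w y -> exists p : {mpoly C[3]} * {mpoly C[3]},
    (forall i, y i = p.1 * a i + p.2 * b0 i) /\
    forall q : {mpoly C[3]} * {mpoly C[3]},
      (forall i, y i = q.1 * a i + q.2 * b0 i) -> q = p.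
Proof.
move=> sw sata sa sb c0 ab y sy.
have [h hE] := syzygy_cross sw sy sa; have [h' h'E] := syzygy_cross sw sy sb.
have ck : (c^-1)%:MP * c%:MP = 1 :> {mpoly C[3]} by rewrite -mpolyCM mulVf.
have cC : c%:MP != 0 :> {mpoly C[3]} by rewrite mpolyC_eq0.
have basis := cross_basis cC (saturated_neq0 sw) ab hE h'E.
have expr i : y i = (c^-1)%:MP * h' * a i + - ((c^-1)%:MP * h) * b0 i.
  have -> : y i = (c^-1)%:MP * (c%:MP * y i) by rewrite mulrA ck mul1r.
  by rewrite basis; ring.
exists ((c^-1)%:MP * h', - ((c^-1)%:MP * h)); split=> // -[x z] /= xz.
have [i wi] := saturated_neq0 sw.
have cwi : c%:MP * w i != 0 by rewrite mulf_neq0.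
have yb j : cross y b0 j = x * (c%:MP * w j).
  by rewrite -ab; move: j; apply: ord3_ind; rewrite /cross /= !xz; ring.
have ya j : cross y a j = - z * (c%:MP * w j).
  by rewrite -ab; move: j; apply: ord3_ind; rewrite /cross /= !xz; ring.
congr (_, _).
  have := yb i; rewrite h'E mulrA => /(mulIf wi) ->; rewrite mulrCA ck mulr1 //.
have := ya i; rewrite hE mulrA => /(mulIf wi) ->.
by rewrite mulNr mulrN opprK mulrCA ck mulr1.
Qed.

End FreeSyzygies.

Section FreeCurve.
Variable R : realType.
Local Notation C := R[i].
Implicit Types (f : {mpoly C[3]}).

Lemma free_curve_of_basis f e r a b0 c : saturated e (partials f) -> saturated r a ->
  syzygy (partials f) a -> syzygy (partials f) b0 -> c != 0 ->
  (forall i, cross a b0 i = c%:MP * partials f i) -> free_curve f.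
Proof.
move=> sw sata sa sb c0 ab.
pose b : 'M[{mpoly C[3]}]_(2, 3) := \matrix_(k, i) if k == ord0 then a i else b0 i.
have mulE (x : 'rV_2) i : (x *m b) ord0 i = x ord0 ord0 * a i + x ord0 ord_max * b0 i.
  by rewrite mxE big_ord_recr /= big_ord1 !mxE /=; congr (x _ _ * _ + _); apply: val_inj.
exists 2%N, b; split=> [k|y sy].
  rewrite /AR_proj /=; under eq_bigr do rewrite !mxE.
  by case: (k == ord0).
have [p [pE pU]] := free_basis sw sata sa sb c0 ab sy.
exists (\row_k if k == ord0 then p.1 else p.2); split.
  by apply/rowP => i; rewrite mulE !mxE /= -pE.
move=> x yx; have := pU (x ord0 ord0, x ord0 ord_max) => /= xE.
have {}xE : (x ord0 ord0, x ord0 ord_max) = p by apply: xE => i; rewrite -mulE -yx.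
apply/rowP => k; rewrite mxE -xE; case: eqVneq => [->//|k0] /=.
by congr (x _ _); apply: val_inj; move: k k0 => [[|[|]]].
Qed.

(** The rank is 2: three basis elements would be dependent because their determinant vanishes, and
    with fewer than two all syzygies would be parallel. The cross product of the two elements is h
    w. Every w_j is a multiple D_j h, so D is parallel to w, whence D = z w and h z = 1. *)
Lemma basis_of_free_curve f e : saturated e (partials f) -> free_curve f ->
  exists u v c, [/\ syzygy (partials f) u, syzygy (partials f) v, c != 0
    & forall i, cross u v i = c%:MP * partials f i].
Proof.
set w := partials f => sw [n [b [sb bU]]].
pose B k i := b k i.
have sB k : syzygy w (B k).
  have := sb k; rewrite /AR_proj /= /syzygy => e0; apply: etrans e0.
  by apply: eq_bigr => i _; rewrite mxE.
have indep (c : 'I_n -> {mpoly C[3]}) : (forall i, \sum_k c k * B k i = 0) ->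
    forall k, c k = 0.
  move=> cz k; have s0 : AR_proj f 0.
    by rewrite /AR_proj /= big1 // => i _; rewrite mxE mul0r.
  have [x [_ xU]] := bU 0 s0.
  have x0 : x = 0 by apply: xU; rewrite mul0mx.
  have : x = \row_k c k.
    by apply: xU; apply/rowP => i; rewrite !mxE -[LHS](cz i); apply: eq_bigr => l _; rewrite !mxE.
  by rewrite x0 => /rowP/(_ k); rewrite !mxE => <-.
have span y : syzygy w y -> exists c, forall i, y i = \sum_k c k * B k i.
  move=> sy; have s0 : AR_proj f (\row_i y i).
    by rewrite /AR_proj /=; under eq_bigr do rewrite mxE.
  have [x [yx _]] := bU _ s0; exists (x ord0) => i.
  by have /rowP/(_ i) := yx; rewrite !mxE.
have indep2 k l x z : k != l -> (forall i, x * B k i + z * B l i = 0) -> x = 0 /\ z = 0.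
  move=> kl xz; pose c j := if j == k then x else if j == l then z else 0.
  have cz i : \sum_j c j * B j i = 0.
    rewrite (bigD1 k) //= (bigD1 l) 1?eq_sym //= big1; last first.
      by move=> j /andP[/negPf jk /negPf jl]; rewrite /c jk jl mul0r.
    by rewrite /c !eqxx eq_sym (negPf kl) addr0 xz.
  by have := indep c cz k; have := indep c cz l; rewrite /c !eqxx eq_sym (negPf kl).
have cross0 k l h : k != l -> (forall i, cross (B k) (B l) i = h * w i) -> h != 0.
  move=> kl hE; apply/eqP => h0.
  have par : forall i j, B l i * B k j = B l j * B k i.
    by apply/cross_eq0 => i; rewrite hE h0 mul0r.
  have Bk0 i : B k i = 0.
    have [|_] := @indep2 k l (B l i) (- B k i) kl.
      by move=> j; rewrite mulNr par mulrC subrr.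
    by move/eqP; rewrite oppr_eq0 => /eqP.
  have [|/eqP] := @indep2 k l 1 0 kl; last by rewrite oner_eq0.
  by move=> j; rewrite Bk0 mulr0 mul0r addr0.
have [i0 wi0] := saturated_neq0 sw.
have two (k l m : 'I_n) : k != l -> l != m -> m != k -> False.
  move=> kl lm mk.
  have [al alE] := syzygy_cross sw (sB k) (sB l).
  have [be beE] := syzygy_cross sw (sB l) (sB m).
  have [ga gaE] := syzygy_cross sw (sB m) (sB k).
  (* Adjugate identity: the sum is zero off the diagonal and equals the determinant on it. The
     determinant vanishes since B_k x B_l is a multiple of w and B_m is orthogonal to w. *)
  have rel i j : cross (B k) (B l) i * B m j + cross (B l) (B m) i * B k j
      + cross (B m) (B k) i * B l j = (i == j)%:R * \sum_l' B m l' * cross (B k) (B l) l'.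
    by rewrite sum3E; move: i j; apply: ord3_ind; apply: ord3_ind; rewrite /cross /=; ring.
  have ort : \sum_l' B m l' * cross (B k) (B l) l' = 0.
    transitivity (al * \sum_l' B m l' * w l'); last by rewrite [\sum_l' _]sB mulr0.
    by rewrite mulr_sumr; apply: eq_bigr => i _; rewrite alE; ring.
  pose c j := if j == m then al else if j == k then be else if j == l then ga else 0.
  have cz i : \sum_j c j * B j i = 0.
    apply: (mulfI wi0); rewrite mulr0 (bigD1 m) //= (bigD1 k) 1?eq_sym //=.
    rewrite (bigD1 l) /=; last by rewrite lm eq_sym kl.
    rewrite big1; last first.
      by move=> j /andP[/andP[/negPf jm /negPf jk] /negPf jl]; rewrite /c jm jk jl mul0r.
    rewrite /c !eqxx [k == m]eq_sym (negPf mk) (negPf lm) [l == k]eq_sym (negPf kl) addr0.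
    by have := rel i0 i; rewrite ort mulr0 alE beE gaE => <-; ring.
  by have := indep c cz m; rewrite /c eqxx; apply/eqP/(cross0 k l).
have [k [l kl]] : exists k l : 'I_n, k != l.
  apply/not_existsP => nokl.
  have all1 (k l : 'I_n) : k = l.
    by apply/eqP; rewrite -[_ == _]negbK; apply/negP => kl; apply: (nokl k); exists l.
  have [y [y' [sy sy' yy']]] := koszul_cross w i0.
  have [c cE] := span y sy; have [c' c'E] := span y' sy'.
  have y0 : forall i, cross y y' i = 0.
    apply/cross_eq0 => i j; rewrite !cE !c'E !big_distrlr /=; apply: eq_bigr => k _.
    by apply: eq_bigr => l _; rewrite (all1 l k); ring.
  by have := yy' i0; rewrite y0 => /esym /eqP; rewrite mulf_eq0 orbb (negPf wi0).
have [h hE] := syzygy_cross sw (sB k) (sB l).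
have span2 y : syzygy w y -> exists x z, forall i, y i = x * B k i + z * B l i.
  move=> /span[c cE]; exists (c k), (c l) => i.
  rewrite cE (bigD1 k) //= (bigD1 l) 1?eq_sym //= big1 ?addr0 // => m /andP[mk ml].
  by case: (two k l m kl); rewrite // eq_sym.
(* The cross product of two combinations of B_k and B_l is the determinant of the coefficients times
   h w; for a Koszul pair it is w_j w. *)
have /choice[D DE] j : exists D, w j = D * h.
  have [y [y' [/span2[x [z yE]] /span2[x' [z' y'E]] yy']]] := koszul_cross w j.
  exists (x * z' - z * x'); apply: (mulIf wi0); rewrite -yy' -mulrA -hE.
  by move: (i0); apply: ord3_ind; rewrite /cross /= !yE !y'E; ring.
have [|z zE] := saturated_parallel_general (v := D) sw.
  by move=> i j; rewrite !DE; ring.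
have hz : h * z = 1.
  by apply: (mulIf wi0); rewrite mul1r [RHS]DE zE; ring.
have [c c0 hc] := mpoly_unit_const hz.
exists (B k), (B l), c; split; [exact: sB | exact: sB | exact: c0 |].
by move=> i; rewrite hE hc.
Qed.

End FreeCurve.

(** * Power series in two variables *)

Section SeriesAlgebra.
Variable R : realType.
Local Notation C := R[i].
Implicit Types (u v w : @series R) (p q : {mpoly C[2]}).

Definition coef2 (P : {poly {poly C}}) : @series R := fun i j => P`_i`_j.
(** The coefficients of a product up to (i, j) involve only coefficients up to (i, j), so the ring
    laws of series are inherited from polynomials through truncation. *)
Definition truncation n u : {poly {poly C}} := \poly_(i < n) \poly_(j < n) u i j.

Lemma coef2_truncation n u i j : (i < n)%N -> (j < n)%N -> coef2 (truncation n u) i j = u i j.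
Proof. by move=> ni nj; rewrite /coef2 coef_poly ni coef_poly nj. Qed.

Lemma coef2_truncation_le n u i j k l : (i < n)%N -> (j < n)%N -> (k <= i)%N -> (l <= j)%N ->
  coef2 (truncation n u) k l = u k l.
Proof.
by move=> ni nj ki lj; apply: coef2_truncation; [apply: leq_ltn_trans ni | apply: leq_ltn_trans nj].
Qed.

Lemma coef2M P Q : coef2 (P * Q) = series_mul (coef2 P) (coef2 Q).
Proof.
apply/funext => i; apply/funext => j; rewrite /coef2 coefM coef_sum.
by apply: eq_bigr => k _; rewrite coefM.
Qed.

Lemma series_mul_local u u' v v' i j :
  (forall k l, (k <= i)%N -> (l <= j)%N -> u k l = u' k l) ->
  (forall k l, (k <= i)%N -> (l <= j)%N -> v k l = v' k l) ->
  series_mul u v i j = series_mul u' v' i j.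
Proof.
move=> eu ev; apply: eq_bigr => k _; apply: eq_bigr => l _.
by rewrite eu ?ev ?leq_subr // -ltnS.
Qed.

Lemma series_mul_truncation n u v i j : (i < n)%N -> (j < n)%N ->
  series_mul u v i j = coef2 (truncation n u * truncation n v) i j.
Proof.
move=> ni nj; rewrite coef2M; apply: series_mul_local => k l ki lj;
  by rewrite (coef2_truncation_le _ ni nj).
Qed.

Lemma series_mulC u v : series_mul u v = series_mul v u.
Proof.
apply/funext => i; apply/funext => j; pose n := (i + j).+1.
have ni : (i < n)%N by rewrite ltnS leq_addr.
have nj : (j < n)%N by rewrite ltnS leq_addl.
by rewrite (series_mul_truncation u v ni nj) (series_mul_truncation v u ni nj) mulrC.
Qed.

Lemma series_mulA u v w : series_mul u (series_mul v w) = series_mul (series_mul u v) w.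
Proof.
apply/funext => i; apply/funext => j; pose n := (i + j).+1.
have ni : (i < n)%N by rewrite ltnS leq_addr.
have nj : (j < n)%N by rewrite ltnS leq_addl.
transitivity (coef2 (truncation n u * truncation n v * truncation n w) i j).
  rewrite -mulrA coef2M; apply: series_mul_local => k l ki lj.
    by rewrite (coef2_truncation_le _ ni nj).
  by rewrite (series_mul_truncation (n := n)) //; [apply: leq_ltn_trans ni | apply: leq_ltn_trans nj].
rewrite coef2M; apply: series_mul_local => k l ki lj.
  by rewrite (series_mul_truncation (n := n)) //; [apply: leq_ltn_trans ni | apply: leq_ltn_trans nj].
by rewrite (coef2_truncation_le _ ni nj).
Qed.

Lemma series_mulDl u v w : series_mul (fun i j => u i j + v i j) w =
  fun i j => series_mul u w i j + series_mul v w i j.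
Proof.
apply/funext => i; apply/funext => j; rewrite /series_mul -big_split.
apply: eq_bigr => k _; rewrite -big_split; apply: eq_bigr => l _.
by rewrite mulrDl.
Qed.

Lemma series_mulDr u v w : series_mul w (fun i j => u i j + v i j) =
  fun i j => series_mul w u i j + series_mul w v i j.
Proof.
rewrite series_mulC series_mulDl; apply/funext => i; apply/funext => j.
by rewrite ![series_mul _ w]series_mulC.
Qed.

Local Notation sigma := (@series_of_mpoly R).

Lemma series_of_mpolyE p : sigma p = coef2 (bipoly 1 p).
Proof.
apply/funext => i; apply/funext => j; rewrite /coef2 coef_bipoly /series_of_mpoly.
congr (_@__); apply/mnmP => l; rewrite mnmE multinomE (tnth_nth 0%N).
by case: l => [[|[|]]].
Qed.

Lemma series_of_mpolyM p q : sigma (p * q) = series_mul (sigma p) (sigma q).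
Proof. by rewrite !series_of_mpolyE -coef2M rmorphM. Qed.

Lemma series_of_mpolyD p q : sigma (p + q) = fun i j => sigma p i j + sigma q i j.
Proof. by apply/funext => i; apply/funext => j; rewrite /series_of_mpoly mcoeffD. Qed.

Lemma series_of_mpolyZ c p : sigma (c *: p) = fun i j => c * sigma p i j.
Proof. by apply/funext => i; apply/funext => j; rewrite /series_of_mpoly mcoeffZ. Qed.

Lemma series_d1_mpoly p : series_d1 (sigma p) = sigma (mderiv 0 p).
Proof.
apply/funext => i; apply/funext => j; rewrite /series_d1 /series_of_mpoly mcoeff_deriv.
rewrite mulr_natl multinomE (tnth_nth 0%N) /=; congr (_@__ *+ _).
apply/mnmP => l; rewrite mnmDE mnm1E !multinomE !(tnth_nth 0%N).
by case: l => [[|[|]]] //= ?; rewrite ?addn1 ?addn0.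
Qed.

Lemma series_d2_mpoly p : series_d2 (sigma p) = sigma (mderiv 1 p).
Proof.
apply/funext => i; apply/funext => j; rewrite /series_d2 /series_of_mpoly mcoeff_deriv.
rewrite mulr_natl multinomE (tnth_nth 0%N) /=; congr (_@__ *+ _).
apply/mnmP => l; rewrite mnmDE mnm1E !multinomE !(tnth_nth 0%N).
by case: l => [[|[|]]] //= ?; rewrite ?addn1 ?addn0.
Qed.

Lemma series_mul_monomial (m : 'X_{1..2}) u i j :
  series_mul (sigma 'X_[m]) u i j =
  if (m 0%R <= i)%N && (m 1%R <= j)%N then u (i - m 0%R)%N (j - m 1%R)%N else 0.
Proof.
pose n := (i + j).+1.
have ni : (i < n)%N by rewrite ltnS leq_addr.
have nj : (j < n)%N by rewrite ltnS leq_addl.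
transitivity (coef2 (bipoly 1 'X_[m] * truncation n u) i j).
  rewrite coef2M series_of_mpolyE; apply: series_mul_local => // k l ki lj.
  by rewrite (coef2_truncation_le _ ni nj).
rewrite bipolyXm /coef2 -mulrA coefCM !coefXnM /=.
case: (ltnP j (m 1%R)) => mj; first by rewrite andbF.
case: (ltnP i (m 0%R)) => mi; first by rewrite coef0.
by rewrite -[LHS]/(coef2 _ _ _) (coef2_truncation_le _ ni nj) ?leq_subr.
Qed.

End SeriesAlgebra.

(** * Convergence *)

Section Convergence.
Variable R : realType.
Local Notation C := R[i].
Local Notation sigma := (@series_of_mpoly R).
Implicit Types (u v w : @series R) (p q : {mpoly C[2]}).

Lemma real_complexM (x y : R) : (x * y)%:C = x%:C * y%:C.
Proof. exact: (rmorphM (real_complex R)). Qed.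

Lemma sum_geometric_half n : \sum_(i < n) (2^-1 : R) ^+ i <= 2.
Proof.
suff -> : \sum_(i < n) (2^-1 : R) ^+ i = 2 - 2 * 2^-1 ^+ n.
  by rewrite lerBlDr lerDl mulr_ge0 ?exprn_ge0 ?invr_ge0 // ler0n.
elim: n => [|n IHn]; first by rewrite big_ord0 expr0 mulr1 subrr.
by rewrite big_ord_recr /= IHn exprS; field.
Qed.

(** Cauchy estimates: a geometric bound on the coefficients is easier to carry through sums,
    products and shifts than bounded partial sums. *)
Lemma convergentP u : convergent u <-> exists M K : R,
  [/\ 0 <= M, 0 < K & forall i j, `|u i j| <= (M * K ^+ (i + j))%:C].
Proof.
split=> [[r [M [r0 bound]]]|[M [K [M0 K0 bound]]]].
  have rC n : 0 <= (r ^+ n)%:C :> C by rewrite (lecR 0) exprn_ge0 // ltW.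
  have term i j : `|u i j| * (r ^+ (i + j))%:C <= M%:C.
    apply: le_trans (bound (i + j).+1).
    have ni : (i < (i + j).+1)%N by rewrite ltnS leq_addr.
    have nj : (j < (i + j).+1)%N by rewrite ltnS leq_addl.
    rewrite (bigD1 (Ordinal ni)) //= (bigD1 (Ordinal nj)) //= -addrA lerDl.
    apply: addr_ge0; first by apply: sumr_ge0 => l _; apply: mulr_ge0.
    by apply: sumr_ge0 => k _; apply: sumr_ge0 => l _; apply: mulr_ge0.
  exists M, r^-1; split; last 1 first.
  - move=> i j; have rij : 0 < (r ^+ (i + j))%:C :> C by rewrite (ltcR 0) exprn_gt0.
    rewrite -(ler_pM2r rij).
    have -> : (M * r^-1 ^+ (i + j))%:C * (r ^+ (i + j))%:C = M%:C.
      by rewrite -real_complexM -mulrA -exprMn mulVf ?gt_eqF // expr1n mulr1.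
    exact: term.
  - by rewrite -lecR; apply: le_trans (term 0%N 0%N); apply: mulr_ge0.
  - by rewrite invr_gt0.
(* At radius 1 / (2 K) the terms are at most M 2^-(i + j), and each of the two geometric sums is at
   most 2. *)
exists (2 * K)^-1, (M * 2 * 2); split; first by rewrite invr_gt0 mulr_gt0.
move=> n.
have le1 i j : `|u i j| * ((2 * K)^-1 ^+ (i + j))%:C <= (M * (2^-1 ^+ i * 2^-1 ^+ j))%:C.
  have p0 : 0 <= ((2 * K)^-1 ^+ (i + j))%:C :> C.
    by rewrite (lecR 0) exprn_ge0 // invr_ge0 mulr_ge0 // ltW.
  apply: le_trans (ler_wpM2r p0 (bound i j)) _.
  rewrite -real_complexM lecR -mulrA -exprMn invfM mulrCA mulfV ?gt_eqF // mulr1.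
  by rewrite exprD.
have -> : (M * 2 * 2)%:C = (M * (2 * 2))%:C by rewrite mulrA.
apply: (@le_trans _ _ (\sum_(i < n) \sum_(j < n) (M * (2^-1 ^+ i * 2^-1 ^+ j))%:C)).
  by apply: ler_sum => i _; apply: ler_sum => j _; apply: le1.
under eq_bigr do rewrite -(rmorph_sum (real_complex R)).
rewrite -(rmorph_sum (real_complex R)) lecR.
under eq_bigr do rewrite -mulr_sumr -mulr_sumr.
rewrite -mulr_sumr -mulr_suml; apply: ler_wpM2l => //.
apply: ler_pM; rewrite ?sum_geometric_half //;
  by apply: sumr_ge0 => i _; rewrite exprn_ge0 // invr_ge0.
Qed.

Lemma convergent0 : convergent (fun _ _ => 0 : C).
Proof.
apply/convergentP; exists 0, 1; split=> // i j.
by rewrite normr0 mul0r.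
Qed.

Lemma exists_common_bound u v : convergent u -> convergent v -> exists M K : R,
  [/\ 0 <= M, 0 < K, forall i j, `|u i j| <= (M * K ^+ (i + j))%:C
    & forall i j, `|v i j| <= (M * K ^+ (i + j))%:C].
Proof.
move=> /convergentP[M [K [M0 K0 bu]]] /convergentP[M' [K' [M'0 K'0 bv]]].
exists (Num.max M M'), (Num.max K K'); split=> [||i j|i j].
- by rewrite le_max M0.
- by rewrite lt_max K0.
- apply: le_trans (bu i j) _; rewrite lecR; apply: ler_pM => //.
  + by rewrite exprn_ge0 // ltW.
  + by rewrite le_max lexx.
  + by apply: lerXn2r; rewrite ?nnegrE ?le_max ?lexx // ltW.
- apply: le_trans (bv i j) _; rewrite lecR; apply: ler_pM => //.
  + by rewrite exprn_ge0 // ltW.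
  + by rewrite le_max lexx orbT.
  + by apply: lerXn2r; rewrite ?nnegrE ?le_max ?lexx ?orbT // ltW.
Qed.

Lemma convergentD u v : convergent u -> convergent v -> convergent (fun i j => u i j + v i j).
Proof.
move=> cu cv; have [M [K [M0 K0 bu bv]]] := exists_common_bound cu cv.
apply/convergentP; exists (M + M), K; split=> [||i j] //; first exact: addr_ge0.
apply: le_trans (ler_normD _ _) _; rewrite mulrDl (rmorphD (real_complex R)).
exact: lerD.
Qed.

Lemma normC_real (c : C) : exists2 x : R, 0 <= x & `|c| = x%:C.
Proof.
exists (Num.sqrt (complex.Re c ^+ 2 + complex.Im c ^+ 2)); first exact: sqrtr_ge0.
exact: normc_def.
Qed.

Lemma convergentZ c u : convergent u -> convergent (fun i j => c * u i j).
Proof.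
move=> /convergentP[M [K [M0 K0 bu]]]; have [x x0 xE] := normC_real c.
apply/convergentP; exists (x * M), K; split=> [||i j] //; first exact: mulr_ge0.
rewrite normrM xE -mulrA real_complexM; apply: ler_wpM2l => //.
by rewrite (lecR 0).
Qed.

Lemma convergentM u v : convergent u -> convergent v -> convergent (series_mul u v).
Proof.
move=> cu cv; have [M [K [M0 K0 bu bv]]] := exists_common_bound cu cv.
(* A coefficient of the product has (i + 1) (j + 1) terms, a number at most 2^(i + j), which the
   factor 2 of 2 K absorbs. *)
apply/convergentP; exists (M * M), (2 * K); split=> [||i j] //; try exact: mulr_ge0.
  by rewrite mulr_gt0.
apply: le_trans (ler_norm_sum _ _ _) _.
apply: (@le_trans _ _ (\sum_(k < i.+1) \sum_(l < j.+1) (M * M * K ^+ (i + j))%:C)).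
  apply: ler_sum => k _; apply: le_trans (ler_norm_sum _ _ _) _.
  apply: ler_sum => l _; rewrite normrM.
  have -> : M * M * K ^+ (i + j) = (M * K ^+ (k + l)) * (M * K ^+ (i - k + (j - l))).
    have -> : (i + j = (k + l) + (i - k + (j - l)))%N.
      by have := ltn_ord k; have := ltn_ord l; lia.
    by rewrite exprD; ring.
  by rewrite real_complexM; apply: ler_pM.
rewrite !sumr_const !card_ord -mulrnA -(rmorphMn (real_complex R)) lecR.
rewrite exprMn -mulr_natr [2 ^+ _ * _]mulrC mulrA; apply: ler_wpM2l.
  by rewrite !mulr_ge0 // exprn_ge0 // ltW.
rewrite -natrX ler_nat addnC expnD.
by apply: leq_mul; apply: ltn_expl.
Qed.

Lemma convergent_mpoly p : convergent (sigma p).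
Proof.
elim/mpolyind: p => [|c m p _ _ IHp].
  rewrite (_ : sigma 0 = fun _ _ => 0); first exact: convergent0.
  by apply/funext => i; apply/funext => j; rewrite /series_of_mpoly mcoeff0.
rewrite series_of_mpolyD; apply: convergentD => //.
rewrite series_of_mpolyZ; apply: convergentZ; apply/convergentP; exists 1, 1.
split=> [||i j]; rewrite ?ler01 ?ltr01 // expr1n mulr1 /series_of_mpoly mcoeffX normr_nat.
by rewrite (rmorph1 (real_complex R)); case: (_ == _); rewrite ?lexx ?ler01.
Qed.

Lemma convergent_shift a b u : convergent u -> convergent (fun i j => u (i + a)%N (j + b)%N).
Proof.
move=> /convergentP[M [K [M0 K0 bu]]]; apply/convergentP.
exists (M * K ^+ (a + b)), K; split=> [||i j] //.
  by rewrite mulr_ge0 // exprn_ge0 // ltW.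
apply: le_trans (bu _ _) _; rewrite lecR -mulrA -exprD.
by have -> : (i + a + (j + b) = a + b + (i + j))%N by lia.
Qed.

Lemma convergent_restrict (A : nat -> nat -> bool) u : convergent u ->
  convergent (fun i j => if A i j then u i j else 0).
Proof.
move=> /convergentP[M [K [M0 K0 bu]]]; apply/convergentP; exists M, K; split=> // i j.
case: ifP => _ //; rewrite normr0 (lecR 0) mulr_ge0 // exprn_ge0 //.
exact: ltW.
Qed.

(** Expansion at the origin of 1 / (x_k - a) for nonzero a; the test on indices keeps the pure
    powers of x_k. *)
Definition geometric (k : 'I_2) (a : C) : @series R := fun i j =>
  if (if k == 0 then j else i) == 0%N then - a^-1 ^+ (i + j).+1 else 0.

Lemma convergent_geometric k a : convergent (geometric k a).
Proof.
have [x x0 xE] := normC_real a^-1.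
apply/convergentP; exists (x + 1), (x + 1); split=> [||i j].
- by rewrite addr_ge0.
- by rewrite ltr_wpDl.
rewrite /geometric; case: ifP => _; last first.
  by rewrite normr0 (lecR 0) -exprS exprn_ge0 // addr_ge0.
rewrite normrN normrX xE -(rmorphXn (real_complex R)) lecR -exprS.
by apply: lerXn2r; rewrite ?nnegrE ?addr_ge0 // lerDl.
Qed.

Lemma geometric_inverse k a : a != 0 ->
  series_mul (sigma ('X_k - a%:MP)) (geometric k a) = sigma 1.
Proof.
move=> a0; have -> : 'X_k - a%:MP = 'X_k + (- a) *: 'X_[0] :> {mpoly C[2]}.
  by rewrite mpolyX0 -mul_mpolyC mulr1 mpolyCN.
rewrite series_of_mpolyD series_mulDl; apply/funext => i; apply/funext => j.
rewrite series_of_mpolyZ -[1]mpolyX0.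
have -> : series_mul (fun i0 j0 => - a * sigma 'X_[0] i0 j0) (geometric k a) i j
  = - a * series_mul (sigma 'X_[0]) (geometric k a) i j.
  rewrite /series_mul mulr_sumr; apply: eq_bigr => i' _; rewrite mulr_sumr.
  by apply: eq_bigr => j' _; rewrite mulrA.
rewrite !series_mul_monomial !mnm0E !mnm1E !leq0n !subn0 /=.
rewrite /series_of_mpoly mcoeffX.
have -> : (0%MM == [multinom [tuple i; j]]) = (i == 0%N) && (j == 0%N).
  apply/eqP/andP => [/mnmP e|[/eqP -> /eqP ->]].
    have := e 0; have := e 1; rewrite !mnm0E !multinomE !(tnth_nth 0%N) /= => <- <-.
    by rewrite !eqxx.
  by apply/mnmP => -[[|[|]]] // ?; rewrite mnm0E multinomE (tnth_nth 0%N).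
have rec n : - a^-1 ^+ n.+1 + - a * (- a^-1 ^+ n.+2) = 0.
  by rewrite [a^-1 ^+ n.+2]exprS mulrNN mulrA mulfV // mul1r addNr.
have ini : - a * (- a^-1 ^+ 1) = 1 by rewrite mulrNN expr1 mulfV.
rewrite /geometric; case: k => [[|[|]]] //= lek.
  case: i => [|i] /=; first by case: j => [|j] /=; rewrite add0r ?ini ?mulr0.
  case: j => [|j] /=; last by rewrite mulr0 addr0.
  by rewrite !subn1 !addn0 /= rec.
case: i => [|i] /=; last by rewrite mulr0 addr0 if_same.
case: j => [|j] /=; first by rewrite add0r ini.
by rewrite !subn1 !add0n /= rec.
Qed.

End Convergence.

Section UnivariateSubstitution.
Variable C : numClosedFieldType.

Lemma univM k (D E : {poly C}) : univ k (D * E) = univ k D * univ k E.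
Proof. by rewrite /univ rmorphM hornerM. Qed.

Lemma univC k (a : C) : univ k a%:P = a%:MP.
Proof. by rewrite /univ map_polyC hornerC. Qed.

Lemma univ_XsubC k (a : C) : univ k ('X - a%:P) = 'X_k - a%:MP.
Proof. by rewrite /univ rmorphB /= map_polyX map_polyC !hornerE. Qed.

Definition power_vars m (i : 'I_2) : {mpoly C[2]} := 'X_i ^+ m.

Lemma in_power_vars m (p : {mpoly C[2]}) :
  (forall n : 'X_{1..2}, n \in msupp p -> exists i, (m <= n i)%N) -> in_ideal (power_vars m) p.
Proof.
move=> big; rewrite [p]mpolyE big_seq.
elim/big_ind: _ => [||n /big[i mi]]; first exact: in_ideal0.
  by move=> q q'; apply: in_idealD.
have -> : p@_n *: 'X_[n] = (p@_n *: 'X_[n - U_(i) *+ m]) * power_vars m i.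
  rewrite /power_vars mpolyXn -scalerAl -mpolyXD submK //.
  apply/mnm_lepP => j; rewrite mulmnE mnm1E; case: eqVneq => [<-|]; rewrite ?mul1n //.
by apply: in_idealM; apply: in_ideal_gen.
Qed.

End UnivariateSubstitution.

(** * The Tjurina ideal of a polynomial germ *)

Section TjurinaIdeal.
Variable R : realType.
Local Notation C := R[i].
Local Notation sigma := (@series_of_mpoly R).
Implicit Types (u v w : @series R) (p q Z : {mpoly C[2]}).
Variable h : {mpoly C[2]}.
Local Notation T := (tjurina_ideal (sigma h)).

Lemma tjurina_idealD u v : T u -> T v -> T (fun i j => u i j + v i j).
Proof.
move=> [a [b [c [ca cb cc e]]]] [a' [b' [c' [ca' cb' cc' e']]]].
exists (fun i j => a i j + a' i j), (fun i j => b i j + b' i j), (fun i j => c i j + c' i j).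
split; try exact: convergentD.
by move=> i j; rewrite e e' !series_mulDl addrACA [X in X + _ = _]addrACA.
Qed.

Lemma tjurina_idealM u v : convergent v -> T u -> T (series_mul v u).
Proof.
move=> cv [a [b [c [ca cb cc e]]]].
exists (series_mul v a), (series_mul v b), (series_mul v c).
split; try exact: convergentM.
move=> i j; have -> : u = fun i j => series_mul a (sigma h) i j
    + (series_mul b (series_d1 (sigma h)) i j + series_mul c (series_d2 (sigma h)) i j).
  by apply/funext => k; apply/funext => l; rewrite e addrA.
by rewrite !series_mulDr !series_mulA addrA.
Qed.

Lemma series_mulC_mpoly c u : series_mul (sigma c%:MP) u = fun i j => c * u i j.
Proof.
apply/funext => i; apply/funext => j.
have -> : c%:MP = c *: 'X_[0] :> {mpoly C[2]} by rewrite mpolyX0 alg_mpolyC.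
rewrite series_of_mpolyZ.
have -> : series_mul (fun i0 j0 => c * sigma 'X_[0] i0 j0) u i j =
    c * series_mul (sigma 'X_[0]) u i j.
  rewrite /series_mul mulr_sumr; apply: eq_bigr => k _; rewrite mulr_sumr.
  by apply: eq_bigr => l _; rewrite mulrA.
by rewrite series_mul_monomial !mnm0E !leq0n !subn0.
Qed.

Lemma tjurina_idealZ c u : T u -> T (fun i j => c * u i j).
Proof.
by move=> Tu; rewrite -series_mulC_mpoly; apply: tjurina_idealM => //; apply: convergent_mpoly.
Qed.

Lemma tjurina_ideal_sum n (c : 'I_n -> C) (u : 'I_n -> @series R) :
  (forall k, T (u k)) -> T (fun i j => \sum_k c k * u k i j).
Proof.
move=> Tu; elim: n c u Tu => [|n IHn] c u Tu.
  have := tjurina_idealZ 0 (_ : T (sigma h)); rewrite (_ : (fun i j => _) = fun i j => 0 * sigma h i j).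
    apply; exists (sigma 1), (sigma 0), (sigma 0); split; try exact: convergent_mpoly.
    move=> i j; rewrite series_d1_mpoly series_d2_mpoly -!series_of_mpolyM mul1r !mul0r.
    by rewrite /series_of_mpoly !mcoeff0 !addr0.
  by apply/funext => i; apply/funext => j; rewrite big_ord0 mul0r.
rewrite (_ : (fun i j => _) = fun i j => \sum_(k < n) c (widen_ord (leqnSn n) k)
    * u (widen_ord (leqnSn n) k) i j + c ord_max * u ord_max i j).
  by apply: tjurina_idealD; [apply: IHn | apply: tjurina_idealZ].
by apply/funext => i; apply/funext => j; rewrite big_ord_recr.
Qed.

Lemma gradient_sumE (c : 'I_3 -> {mpoly C[2]}) : \sum_i c i * gradient h i =
  c 0 * h + c 1 * mderiv 0 h + c ord_max * mderiv 1 h.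
Proof.
rewrite sum3E; congr (_ * _ + _ * _ + _ * _).
- by rewrite /gradient (_ : 0 = ord0) ?unlift_none //; apply: val_inj.
- by rewrite /gradient (_ : 1 = lift ord0 0) ?liftK //; apply: val_inj.
- by rewrite /gradient (_ : ord_max = lift ord0 1) ?liftK //; apply: val_inj.
Qed.

Lemma tjurina_ideal_mpoly p : in_ideal (gradient h) p -> T (sigma p).
Proof.
move=> [c]; rewrite gradient_sumE => ->.
exists (sigma (c 0)), (sigma (c 1)), (sigma (c ord_max)); split; try exact: convergent_mpoly.
move=> i j; rewrite series_d1_mpoly series_d2_mpoly -!series_of_mpolyM.
by rewrite !series_of_mpolyD.
Qed.

Lemma tjurina_ideal_mpolyM p q : T (sigma p) -> T (sigma (q * p)).
Proof. by move=> Tp; rewrite series_of_mpolyM; apply: tjurina_idealM => //; apply: convergent_mpoly. Qed.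

Lemma tjurina_ideal_mpolyD p q : T (sigma p) -> T (sigma q) -> T (sigma (p + q)).
Proof. by move=> Tp Tq; rewrite series_of_mpolyD; apply: tjurina_idealD. Qed.

Lemma tjurina_ideal_strip k a Z : a != 0 -> T (sigma (('X_k - a%:MP) * Z)) -> T (sigma Z).
Proof.
move=> a0 TZ; have := tjurina_idealM (convergent_geometric k a) TZ.
rewrite series_of_mpolyM series_mulA [series_mul (geometric _ _) _]series_mulC geometric_inverse //.
by rewrite -series_of_mpolyM mul1r.
Qed.

(** Linear factors of D with nonzero root are units of O_2 and can be cancelled; the factors with
    root 0 make up the power of x_k. *)
Lemma tjurina_ideal_power k (D : {poly C}) : D != 0 -> T (sigma (univ k D)) ->
  exists m, T (sigma ('X_k ^+ m)).
Proof.
move=> D0; have [s ->] := closed_field_poly_normal D.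
rewrite -mul_polyC univM univC => TD.
have {TD} TD : T (sigma (univ k (\prod_(z <- s) ('X - z%:P)) * 1)).
  have := tjurina_ideal_mpolyM (lead_coef D)^-1%:MP TD.
  by rewrite mulrA -mpolyCM mulVf ?lead_coef_eq0 // mul1r mulr1.
suff [m] : exists m, T (sigma ('X_k ^+ m * 1)) by rewrite mulr1; exists m.
(* The cofactor Z collects the factors x_k met on the way. *)
elim: s (1 : {mpoly C[2]}) TD => [|z s IHs] Z.
  by rewrite big_nil univC => TZ; exists 0%N; rewrite expr0.
rewrite big_cons univM -mulrA univ_XsubC => TZ.
have [z0|z0] := eqVneq z 0; last by apply: IHs; apply: tjurina_ideal_strip z0 TZ.
have [|m Tm] := IHs ('X_k * Z).
  by rewrite mulrCA; move: TZ; rewrite z0 mpolyC0 subr0.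
by exists m.+1; rewrite exprSr -mulrA.
Qed.

Lemma tjurina_ideal_power_vars m p : (forall k, T (sigma ('X_k ^+ m))) ->
  in_ideal (power_vars C m) p -> T (sigma p).
Proof.
move=> Tm [c ->]; rewrite big_ord_recl big_ord1.
by apply: tjurina_ideal_mpolyD; apply: tjurina_ideal_mpolyM; apply: Tm.
Qed.

Definition box_mpoly m u : {mpoly C[2]} :=
  \sum_(i < m) \sum_(j < m) u i j *: 'X_[bimonom 0 i j].

Lemma mcoeff_box m u i j : (box_mpoly m u)@_[multinom [tuple i; j]] =
  if (i < m)%N && (j < m)%N then u i j else 0.
Proof.
have mE k l : (bimonom 0 k l == [multinom [tuple i; j]]) = (k == i) && (l == j).
  apply/eqP/andP => [/mnmP e|[/eqP -> /eqP ->]].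
    have := e 0; have := e 1; rewrite !mnmE !multinomE !(tnth_nth 0%N) /= => -> ->.
    by rewrite !eqxx.
  by apply/mnmP => -[[|[|]]] // ?; rewrite mnmE multinomE (tnth_nth 0%N).
rewrite /box_mpoly raddf_sum /=.
under eq_bigr => k _.
  rewrite raddf_sum /=; under eq_bigr do rewrite mcoeffZ mcoeffX mE.
  over.
case: ltnP => im /=; last first.
  rewrite big1 // => k _; rewrite big1 // => l _.
  by rewrite [_ == i](ltn_eqF (leq_trans (ltn_ord k) im)) mulr0.
rewrite (bigD1 (Ordinal im)) //= [X in _ + X]big1 ?addr0; last first.
  by move=> k; rewrite -val_eqE /= => /negPf ki; rewrite big1 // => l _; rewrite ki mulr0.
case: ltnP => jm.
  rewrite (bigD1 (Ordinal jm)) //= !eqxx mulr1 big1 ?addr0 // => l.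
  by rewrite -val_eqE /= => /negPf ->; rewrite ?andbF mulr0.
by rewrite big1 // => l _; rewrite [_ == j](ltn_eqF (leq_trans (ltn_ord l) jm)) andbF mulr0.
Qed.

(** The terms with i >= m form a multiple of x_0^m, and the remaining ones with j >= m a multiple of
    x_1^m, with convergent cofactors. Every class modulo the ideal thus has a polynomial
    representative. *)
Lemma tjurina_ideal_box m u : (forall k, T (sigma ('X_k ^+ m))) -> convergent u ->
  T (fun i j => u i j - sigma (box_mpoly m u) i j).
Proof.
move=> Tm cu.
pose u0 : @series R := fun i j => u (i + m)%N (j + 0)%N.
pose u1 : @series R := fun i j => if (i < m)%N then u (i + 0)%N (j + m)%N else 0.
have T0 := tjurina_idealM (convergent_shift m 0 cu : convergent u0) (Tm 0).
have T1 := tjurina_idealM (convergent_restrict (fun i _ => (i < m)%N)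
  (convergent_shift 0 m cu) : convergent u1) (Tm 1).
have := tjurina_idealD T0 T1; congr T; apply/funext => i; apply/funext => j.
rewrite ![series_mul _ (sigma _)]series_mulC !mpolyXn !series_mul_monomial !mulmnE !mnm1E /=.
rewrite /series_of_mpoly mcoeff_box /u0 /u1 mul1n mul0n !leq0n andbT !subn0 !addn0 /=.
case: (leqP m i) => [mi|im] /=.
  by rewrite subnK // subr0 if_same addr0.
case: (leqP m j) => [mj|jm] /=; first by rewrite add0r subnK // subr0.
by rewrite add0r subrr.
Qed.

(** Truncating the convergent coefficients to exponents below m leaves a polynomial combination; the
    error only has monomials with an exponent at least m. Analytic membership is thus algebraic
    membership up to arbitrarily high powers of the variables. *)
Lemma mem_tjurina_ideal_mpoly p m : T (sigma p) ->
  exists q, in_ideal (gradient h) q /\ in_ideal (power_vars C m) (p - q).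
Proof.
move=> [a [b [c [_ _ _ e]]]].
pose A := box_mpoly m a; pose B := box_mpoly m b; pose D := box_mpoly m c.
pose q := A * h + B * mderiv 0 h + D * mderiv 1 h.
exists q; split.
  exists (fun i => if i == 0 then A else if i == 1 then B else D).
  by rewrite gradient_sumE.
apply: in_power_vars => n; rewrite mcoeff_msupp; apply: contraNP => /forallNP small.
have n0 : (n 0%R < m)%N by rewrite ltnNge; apply/negP/small.
have n1 : (n 1%R < m)%N by rewrite ltnNge; apply/negP/small.
have -> : n = [multinom [tuple n 0%R; n 1%R]].
  by apply/mnmP => -[[|[|]]] // lei; rewrite multinomE (tnth_nth 0%N) /=; congr (n _); apply: val_inj.
have boxE u k l : (k <= n 0%R)%N -> (l <= n 1%R)%N -> u k l = sigma (box_mpoly m u) k l.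
  by move=> kn ln; rewrite /series_of_mpoly mcoeff_box (leq_ltn_trans kn n0) (leq_ltn_trans ln n1).
rewrite mcoeffB subr_eq0; apply/eqP.
rewrite -[LHS]/(sigma p _ _) e -[RHS]/(sigma q _ _) /q !series_of_mpolyD !series_of_mpolyM.
rewrite series_d1_mpoly series_d2_mpoly.
by congr (_ + _ + _); apply: series_mul_local => // k l kn ln; apply: boxE.
Qed.

End TjurinaIdeal.

(** * Localization of the jacobian ideal *)

Section LocalizedGradient.
Variable C : numClosedFieldType.
Implicit Types (F G : {mpoly C[3]}) (c : 'I_3 -> C).

Lemma mderivXU n (i l : 'I_n) : mderiv i 'X_l = (l == i)%:R :> {mpoly C[n]}.
Proof.
rewrite mderivX mnm1E; case: eqVneq => [->|_]; last by rewrite scale0r.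
rewrite scale1r (_ : (_ - _)%MM = 0%MM) ?mpolyX0 //.
by apply/mnmP => k; rewrite mnmBE mnm0E subnn.
Qed.

Lemma mderiv_localize j c k F :
  mderiv k (localize j c F) = localize j c (mderiv (lift j k) F).
Proof.
pose P F := mderiv k (localize j c F) = localize j c (mderiv (lift j k) F).
have PM F1 F2 : P F1 -> P F2 -> P (F1 * F2).
  rewrite /P => e1 e2; rewrite [localize _ _ (F1 * F2)]rmorphM /= !mderivM e1 e2.
  by rewrite rmorphD !rmorphM.
have P1 : P 1 by rewrite /P rmorph1 -!mpolyC1 !mderivC raddf0.
have PX i : P 'X_i.
  rewrite /P localizeX mderivXU; case: (unliftP j i) => [l ->|->].
    rewrite mderivD mderivC add0r mderivXU (inj_eq lift_inj).
    by rewrite rmorph_nat.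
  by rewrite -mpolyC1 mderivC (negPf (neq_lift _ _)) rmorph0.
have PXn i n : P ('X_i ^+ n).
  by elim: n => [|n IHn]; rewrite ?expr0 // exprS; apply: PM.
have Pm m : P 'X_[m].
  by rewrite mpolyXE_id; elim/big_ind: _ => // i _; apply: PXn.
suff : P F by [].
elim/mpolyind: F => [|a m F _ _ PF]; first by rewrite /P !raddf0.
have Pa : P a%:MP by rewrite /P localizeC !mderivC raddf0.
by rewrite /P !raddfD /= PF -mul_mpolyC; congr (_ + _); apply: (PM _ _ Pa).
Qed.

(** Only the derivative with respect to x_j is not a derivative of the local equation; as x_j
    becomes 1, Euler's relation recovers it from f and the other two. *)
Lemma localize_partials d f j c i : f \is d.-homog -> c j = 1 ->
  in_ideal (gradient (localize j c f)) (localize j c (mderiv i f)).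
Proof.
move=> hf cj; set h := localize j c f.
have hS k : in_ideal (gradient h) (mderiv k h).
  by have := in_ideal_gen (gradient h) (lift ord0 k); rewrite {2}/gradient liftK.
have h0 : in_ideal (gradient h) h.
  by have := in_ideal_gen (gradient h) ord0; rewrite {2}/gradient unlift_none.
case: (unliftP j i) => [k|] ->; first by rewrite -mderiv_localize.
have := congr1 (localize j c) (euler hf); rewrite raddf_sum linearZ /= (bigD1 j) //=.
rewrite rmorphM /= localizeX unlift_none mul1r => /eqP; rewrite -subr_eq0 -addrA addr_eq0 => /eqP ->.
rewrite -mulN1r; apply: in_idealM; rewrite -[_ - _]addrC.
apply: in_idealD; first by rewrite -scaleNr -mul_mpolyC; apply: in_idealM.
elim/big_ind: _ => [||l lj]; first exact: in_ideal0.
  by move=> p q; apply: in_idealD.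
rewrite rmorphM /=; apply: in_idealM.
by case: (unliftP j l) lj => [k ->|->]; rewrite ?eqxx // -mderiv_localize.
Qed.

Lemma localize_jacobian d f j c n (a : 'I_3 -> {mpoly C[3]}) : f \is d.-homog -> c j = 1 ->
  n = \sum_i a i * mderiv i f -> in_ideal (gradient (localize j c f)) (localize j c n).
Proof.
move=> hf cj ->; rewrite raddf_sum /=; under eq_bigr do rewrite rmorphM /=.
by apply: in_ideal_sum => i; apply: localize_partials hf cj.
Qed.

Lemma mcoeff0_localize j c F : c j = 1 -> (localize j c F)@_0 = F.@[c].
Proof.
move=> cj; rewrite localizeE comp_mpolyEX raddf_sum mevalE /=; apply: eq_bigr => m _.
rewrite mcoeffZ comp_mpolyX; congr (_ * _).
rewrite (rmorph_prod (mcoeff 0%MM)) /=; apply: eq_bigr => i _.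
rewrite (rmorphXn (mcoeff 0%MM)) /= tnth_mktuple; congr (_ ^+ _).
case: (unliftP j i) => [k _|->]; last by rewrite -[1]/(1%:MP) mpolyCK cj.
by rewrite mcoeffD mcoeffC eqxx mulr1 mcoeffX -mdeg_eq0 mdeg1 addr0.
Qed.

(** The polynomial lies in (x_0, x_1), and in each term of the binomial expansion of its power 2 m
    one of the two exponents is at least m. *)
Lemma power_vars_power m (p : {mpoly C[2]}) : p@_0 = 0 -> in_ideal (power_vars C m) (p ^+ m.*2).
Proof.
move=> p0; have [|a ->] := @in_power_vars C 1 p.
  move=> n; rewrite mcoeff_msupp; apply: contraNP => /forallNP small.
  suff -> : n = 0%MM by rewrite p0.
  by apply/mnmP => i; rewrite mnm0E; have /negP := small i; rewrite -leqNgt leqn0 => /eqP.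
rewrite big_ord_recl big_ord1 exprDn; elim/big_ind: _ => [||i _]; first exact: in_ideal0.
  by move=> x y; apply: in_idealD.
rewrite -mulr_natl; apply: in_idealM; rewrite /power_vars !expr1 !exprMn.
case: (leqP m i) => mi.
  have := in_ideal_gen (power_vars C m) (lift ord0 ord0); rewrite {2}/power_vars => I1.
  set Y := 'X_(lift ord0 ord0) in I1 *.
  have -> : Y ^+ i = Y ^+ (i - m) * Y ^+ m by rewrite -exprD subnK.
  rewrite !mulrA; exact: in_idealM.
have m2 : (m <= m.*2 - i)%N by lia.
have := in_ideal_gen (power_vars C m) ord0; rewrite {2}/power_vars => I0.
set Y := 'X_ord0 in I0 *.
have -> : Y ^+ (m.*2 - i) = Y ^+ (m.*2 - i - m) * Y ^+ m by rewrite -exprD subnK.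
rewrite mulrC !mulrA; exact: in_idealM.
Qed.

End LocalizedGradient.

(** * Codimension of the jacobian ideal in one degree *)

Section JacobianCodimension.
Variable C : numClosedFieldType.
Variables (e : nat) (w : 'I_3 -> {mpoly C[3]}).
Hypothesis hw : forall i, w i \is e.-homog.

Lemma mem_limg_syz_map s (F : {mpoly C[3]}) (v : gspace C 1 (s + e)) :
  gval v ord0 = F -> v \in limg (syz_map e w s) ->
  exists a, (forall i, a i \is s.-homog) /\ F = \sum_i a i * w i.
Proof.
move=> <- /memv_imgP[a _ ->]; exists (gval a); split; first exact: gval_homog.
by rewrite (gmapE _ _ (fun i _ => hw i) (erefl (s + e)%N)).
Qed.

Lemma independent_mod_jacobian s n (F : 'I_n -> {mpoly C[3]}) :
  (forall t, F t \is (s + e).-homog) ->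
  (forall c : 'I_n -> C, (exists a : 'I_3 -> {mpoly C[3]}, (forall i, a i \is s.-homog) /\
     \sum_t c t *: F t = \sum_i a i * w i) -> forall t, c t = 0) ->
  (n + \dim (limg (syz_map e w s)) <= 'C(s + e + 2, 2))%N.
Proof.
move=> hF indep.
pose v t : gspace C 1 (s + e) := gvec _ (fun=> F t).
pose X := [tuple v t | t < n].
have XE (t : 'I_n) : X`_t = v t by rewrite -tnth_nth tnth_mktuple.
have vE (c : 'I_n -> C) : gval (\sum_t c t *: v t) ord0 = \sum_t c t *: F t.
  by rewrite gval_sum; apply: eq_bigr => t _; rewrite gvalZ gvecE.
have dX : \dim <<X>> = n.
  have : free X.
    apply/freeP => c c0 t; apply: indep; exists (fun=> 0); split=> [i|]; first exact: rpred0.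
    rewrite -vE; under eq_bigr do rewrite -XE.
    by rewrite c0 gval0 big1 // => i _; rewrite mul0r.
  by rewrite /free size_tuple => /eqP.
have disj : (<<X>> :&: limg (syz_map e w s) = 0)%VS.
  apply/eqP; rewrite -subv0; apply/subvP => x; rewrite memv_cap memv0 => /andP[/coord_span xE xJ].
  have xF : gval x ord0 = \sum_t coord X t x *: F t.
    by rewrite {1}xE -vE; congr gval; apply: eq_bigr => t _; rewrite XE.
  have c0 := indep _ (mem_limg_syz_map xF xJ).
  by rewrite xE big1 // => t _; rewrite c0 scale0r.
rewrite -dX -dimv_disjoint_sum // -(mul1n 'C(_, 2)) -(dim_gspace C).
exact/dimvS/subvf.
Qed.

End JacobianCodimension.

(** * Points of the projective plane *)

Section ProjectivePoints.
Variable R : realType.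
Local Notation C := R[i].
Implicit Types (p q : @P2 R).
Local Notation coord := (@Defs.coord R).

Lemma coord_chart p : coord p (chart (val p)) = 1.
Proof. exact/eqP/(valP p). Qed.

Lemma local_eq_projE (f : {mpoly C[3]}) p :
  local_eq_proj f p = localize (chart (val p)) (coord p) f.
Proof. by rewrite localizeE. Qed.

Lemma chart_le p (k : 'I_3) : (k < chart (val p))%N -> coord p k = 0.
Proof.
rewrite /chart; have [e0|n0] //= := eqVneq (val p ord0 0) 0.
have k0 : k = 0 :> nat -> coord p k = 0.
  by move=> kz; rewrite -e0; congr (val p _ _); apply: val_inj.
have [e1|n1] /= := eqVneq (val p ord0 1) 0; last by case: (nat_of_ord k) k0 => // /(_ erefl).
have k1 : k = 1 :> nat -> coord p k = 0.
  by move=> kz; rewrite -e1; congr (val p _ _); apply: val_inj.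
by case: (nat_of_ord k) k0 k1 => [/(_ erefl)//|[_ /(_ erefl)//|]].
Qed.

Lemma proportional_points p q :
  (forall i l, coord p i * coord q l = coord p l * coord q i) -> p = q.
Proof.
move=> par; set i := chart (val p); set j := chart (val q).
have pE l : coord q l = coord p l * coord q i.
  by rewrite -par coord_chart mul1r.
have qi0 : coord q i != 0.
  apply: contra_eq_neq (coord_chart q) => e0.
  by rewrite pE e0 mulr0 eq_sym oner_eq0.
have ij : i = j.
  apply/val_inj/anti_leq/andP; split; rewrite leqNgt; apply/negP => lt.
    have := coord_chart q; rewrite pE (chart_le lt) mul0r => /esym/eqP.
    by rewrite oner_eq0.
  by case/eqP: qi0; apply: chart_le.
have qi1 : coord q i = 1 by rewrite ij coord_chart.
apply/val_inj/rowP => l; rewrite -[LHS]/(coord p l) -[RHS]/(coord q l).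
by rewrite pE qi1 mulr1.
Qed.

(** For distinct points the form is a 2 by 2 minor of the coordinates of q and the variables, chosen
    not to vanish at p. Admitting p = q allows products over all points without exception. *)
Lemma separating_form p q : exists l : {mpoly C[3]},
  [/\ l \is 1.-homog, l.@[coord p] != 0 & p != q -> l.@[coord q] = 0].
Proof.
have [->|pq] := eqVneq p q.
  exists 'X_(chart (val q)); split=> //; first by rewrite dhomogX /= mdeg1.
  by rewrite mevalXU coord_chart oner_eq0.
have [i [l il]] : exists i l, coord p i * coord q l - coord p l * coord q i != 0.
  apply/not_existsP => nz; case/eqP: pq; apply: proportional_points => i l.
  by apply/eqP; rewrite -subr_eq0 -[_ == _]negbK; apply/negP => n; apply: (nz i); exists l.
exists (coord q l *: 'X_i - coord q i *: 'X_l); split.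
- by apply: rpredB; apply: rpredZ; rewrite dhomogX /= mdeg1.
- by rewrite mevalB !mevalZ !mevalXU mulrC [coord q i * _]mulrC.
- by move=> _; rewrite mevalB !mevalZ !mevalXU mulrC subrr.
Qed.

End ProjectivePoints.

(** * Upper bound for the total Tjurina number by interpolation *)

Section TotalBound.
Variable R : realType.
Local Notation C := R[i].
Local Notation sigma := (@series_of_mpoly R).
Local Notation coord := (@Defs.coord R).
Variables (d : nat) (f : {mpoly C[3]}) (B : int).
Hypothesis hf : f \is d.-homog.
Local Notation e := d.-1.
Local Notation w := (partials f).
Hypothesis codim_le : exists s0, forall s, (s0 <= s)%N ->
  ('C(s + e + 2, 2))%:Z - (\dim (limg (syz_map e w s)))%:Z <= B.

Let hw i : w i \is e.-homog. Proof. exact: dhomog_mderiv. Qed.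

(** Forms of one degree that localize to the powers x_k^t, t < n, are dependent modulo J once n
    exceeds B, and the relation localizes to the eliminant. *)
Lemma local_elimination j c k : c j = 1 ->
  exists D, D != 0 /\ in_ideal (gradient (localize j c f)) (univ k D).
Proof.
move=> cj; have [s0 bound] := codim_le.
pose n := `|B|.+1%N; pose s := (s0 + n)%N.
have /choice[F hF] (t : 'I_n) : exists F, F \is (s + e).-homog /\ localize j c F = 'X_k ^+ t.
  apply: localize_lift; rewrite mpolyXn msizeX mdegMn mdeg1 mul1n.
  by rewrite ltnS /s -addnA (leq_trans _ (leq_addl _ _)) // (leq_trans _ (leq_addr _ _)) // ltnW.
have /existsNP[x] : ~ (forall x : 'I_n -> C, (exists a : 'I_3 -> {mpoly C[3]},
    (forall i, a i \is s.-homog) /\ \sum_t x t *: F t = \sum_i a i * w i) -> forall t, x t = 0).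
  move=> indep; have := independent_mod_jacobian hw (fun t => (hF t).1) indep.
  have := bound s (leq_addr _ _); rewrite /n; lia.
move=> /not_implyP[[a [ha aE]] /existsNP[t /eqP xt]].
exists (\sum_(t < n) x t *: 'X^t); split.
  apply: contra_neq xt => /(congr1 (fun p : {poly C} => p`_t)).
  rewrite coef0 coef_sum (bigD1 t) //= coefZ coefXn eqxx mulr1 big1 ?addr0 // => t' /negPf t't.
  by rewrite coefZ coefXn [_ == _]eq_sym [_ == _ :> nat]t't mulr0.
have -> : univ k (\sum_(t < n) x t *: 'X^t) = localize j c (\sum_t x t *: F t).
  rewrite raddf_sum /univ raddf_sum -[_.['X_k]]/(horner_eval _ _) raddf_sum /=.
  apply: eq_bigr => t' _; rewrite [RHS]linearZ /= (hF t').2 -mul_polyC rmorphM /= map_polyC map_polyXn.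
  by rewrite /horner_eval hornerM hornerC hornerXn mul_mpolyC.
exact: localize_jacobian hf cj aE.
Qed.

Lemma local_powers j c : c j = 1 -> exists m, forall k,
  tjurina_ideal (sigma (localize j c f)) (sigma ('X_k ^+ m)).
Proof.
move=> cj; set h := localize j c f.
have /choice[m hm] k : exists m, tjurina_ideal (sigma h) (sigma ('X_k ^+ m)).
  have [D [D0 iD]] := local_elimination k cj.
  by apply: tjurina_ideal_power D0 _; apply: tjurina_ideal_mpoly.
exists (\sum_k m k)%N => k; rewrite (bigD1 k) //= addnC exprD.
exact: tjurina_ideal_mpolyM.
Qed.

Local Notation at_point p := (localize (chart (val p)) (coord p)).

(** Each germ u_(a,i) is interpolated by a form: at the point a the form equals a nonzero constant
    times u_(a,i) modulo the Tjurina ideal, and at the other points it lies in the ideal. A relation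
    modulo J between these forms localizes at each point to a relation between the germs there, so
    the forms are independent modulo J. *)
Lemma total_bound M (pt : 'I_M -> @P2 R) (n : 'I_M -> nat)
    (u : forall a, 'I_(n a) -> @series R) : injective pt ->
  (forall a i, convergent (u a i)) ->
  (forall a, independent_mod (tjurina_ideal (sigma (local_eq_proj f (pt a)))) (u a)) ->
  (\sum_a n a)%N%:Z <= B.
Proof.
move=> inj_pt cu indep_u; have [s0 bound] := codim_le.
have cj a : coord (pt a) (chart (val (pt a))) = 1 := coord_chart (pt a).
pose T a := tjurina_ideal (sigma (at_point (pt a) f)).
have {}indep_u a : independent_mod (T a) (u a).
  by have := indep_u a; rewrite local_eq_projE.
have [m Tm] : exists m, forall a k, T a (sigma ('X_k ^+ m)).
  have /choice[m hm] a := local_powers (cj a).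
  exists (\sum_a m a)%N => a k; rewrite (bigD1 a) //= addnC exprD.
  by apply: tjurina_ideal_mpolyM; apply: hm.
have /choice[l lP] (ab : 'I_M * 'I_M) := separating_form (pt ab.1) (pt ab.2).
(* This form does not vanish at the point a; at another point it has a factor l^(2 m) with l
   vanishing there, which lies in (x_0^m, x_1^m). Its degree is the same for all a. *)
pose Phi a := \prod_b l (a, b) ^+ m.*2.
pose D := (\sum_(b < M) m.*2)%N.
have hPhi a : Phi a \is D.-homog.
  by apply: (dhomog_prod_exp (fun=> m.*2)) => b; case: (lP (a, b)).
pose y a := at_point (pt a) (Phi a); pose c a := (y a)@_0.
have c0 a : c a != 0.
  rewrite /c /y mcoeff0_localize // /Phi rmorph_prod /=; apply/prodf_neq0 => b _.
  by rewrite rmorphXn expf_neq0 //; case: (lP (a, b)).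
have Phi_other a b : a != b -> in_ideal (power_vars C m) (at_point (pt b) (Phi a)).
  move=> ab; rewrite /Phi (bigD1 b) //= rmorphM rmorphXn mulrC; apply: in_idealM.
  apply: power_vars_power; rewrite mcoeff0_localize //.
  by case: (lP (a, b)) => _ _; apply; apply: contra_neq ab => /inj_pt.
pose nil a := (c a)%:MP - y a.
(* An inverse of y_a modulo (x_0^m, x_1^m), up to the constant c_a^(2 m): the geometric series in
   c_a - y_a, cut off where the powers enter that ideal. *)
pose V a := \sum_(i < m.*2) (c a)%:MP ^+ (m.*2.-1 - i) * nil a ^+ i.
have yV a : y a * V a = (c a ^+ m.*2)%:MP - nil a ^+ m.*2.
  by rewrite rmorphXn subrXX /V; congr (_ * _); rewrite /nil; ring.
have nilP a : in_ideal (power_vars C m) (nil a ^+ m.*2).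
  by apply: power_vars_power; rewrite mcoeffB mcoeffC eqxx mulr1 subrr.
pose I : finType := {a : 'I_M & 'I_(n a)}.
pose tg a (i : 'I_(n a)) : I := existT (fun a => 'I_(n a)) a i.
pose t (x : I) := box_mpoly m (u (tag x) (tagged x)).
(* A bound for the degrees of all the polynomials to be lifted, so that they have lifts of one
   common degree K. *)
pose L := (\sum_(x : I) msize (t x * V (tag x)))%N.
pose s := (s0 + D + L)%N; pose K := (s + e - D)%N.
have KD : (K + D = s + e)%N by rewrite /K /s; lia.
have /choice[G hG] (x : I) : exists G, G \is K.-homog /\ at_point (pt (tag x)) G = t x * V (tag x).
  apply: localize_lift; apply: leq_trans (_ : (L <= _)%N); last by rewrite /K /s; lia.
  by rewrite /L (bigD1 x) //= leq_addr.
pose F x := G x * Phi (tag x).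
have hF x : F x \is (s + e).-homog by rewrite -KD; apply: dhomogM => //; case: (hG x).
have cardI : #|{: I}| = (\sum_a n a)%N.
  rewrite card_tagged sumnE big_map big_enum; apply: eq_bigr => a _.
  by rewrite card_ord.
rewrite -cardI.
have := bound s; rewrite /s -addnA leq_addr addnA -/s => /(_ isT).
suff : (#|{: I}| + \dim (limg (syz_map e w s)) <= 'C(s + e + 2, 2))%N by lia.
apply: (independent_mod_jacobian hw (F := fun k => F (enum_val k))) => // x [a [ha aE]].
pose lam (z : I) := x (enum_rank z).
have sumE : \sum_(z : I) lam z *: F z = \sum_i a i * w i.
  rewrite -aE (reindex (@enum_val I I)) /=; last by apply: onW_bij; apply: enum_val_bij.
  by apply: eq_bigr => k _; rewrite /lam enum_valK.
suff lam0 z : lam z = 0 by move=> k; have := lam0 (enum_val k); rewrite /lam enum_valK.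
case: z => b i.
have inI := localize_jacobian hf (cj b) sumE.
pose Q := \sum_(i < n b) lam (tg _ i) *: t (tg _ i).
have TQ : T b (sigma Q).
  have TS := tjurina_ideal_mpoly inI.
  (* At the point b the forms attached to b give c_b^(2 m) Q up to multiples of (c_b - y_b)^(2 m),
     and those attached to other points contain a factor that is in (x_0^m, x_1^m). *)
  have PV : in_ideal (power_vars C m) ((c b ^+ m.*2)%:MP * Q - at_point (pt b) (\sum_(z : I) lam z *: F z)).
    rewrite raddf_sum /=.
    have -> : \sum_(z : I) at_point (pt b) (lam z *: F z) =
        \sum_a \sum_(i < n a) at_point (pt b) (lam (tg _ i) *: F (tg _ i)).
      rewrite (sig_big_dep (fun=> true) (fun _ _ => true)
         (fun a i => at_point (pt b) (lam (tg _ i) *: F (tg _ i)))) /=.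
      by apply: eq_bigr => -[].
    rewrite (bigD1 b) //= opprD addrA; apply: in_idealD.
      rewrite mulr_sumr -sumrB; elim/big_ind: _ => [||k _]; first exact: in_ideal0.
        by move=> p q; apply: in_idealD.
      rewrite linearZ /= /F rmorphM /= (hG (tg _ k)).2 /=.
      rewrite -/(y b) -mulrA [V b * _]mulrC yV mulrBr scalerBr -scalerAr [_ * t _]mulrC opprB addrC subrK.
      by rewrite -mul_mpolyC; apply: in_idealM; apply: in_idealM; apply: nilP.
    rewrite -sumrN; elim/big_ind: _ => [||a' a'b]; first exact: in_ideal0.
      by move=> p q; apply: in_idealD.
    rewrite -sumrN; elim/big_ind: _ => [||k _]; first exact: in_ideal0.
      by move=> p q; apply: in_idealD.
    rewrite -mulN1r linearZ /= /F rmorphM /= -mul_mpolyC; do 3 apply: in_idealM.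
    exact: Phi_other.
  have := tjurina_ideal_mpolyD TS (tjurina_ideal_power_vars (Tm b) PV).
  rewrite addrC subrK => TcQ.
  have := tjurina_ideal_mpolyM ((c b ^+ m.*2)^-1)%:MP TcQ.
  by rewrite mulrA -mpolyCM mulVf ?mul1r // expf_neq0.
have /(indep_u b) : T b (fun k l => \sum_i lam (tg _ i) * u b i k l); last exact.
have Tdiff i' : T b (fun k l => u b i' k l - sigma (t (tg _ i')) k l).
  exact: tjurina_ideal_box (Tm b) (cu b i').
have := tjurina_idealD TQ (tjurina_ideal_sum (fun i' => lam (tg _ i')) Tdiff).
congr (T b); apply/funext => k; apply/funext => l'.
rewrite /Q {1}/series_of_mpoly raddf_sum -big_split /=; apply: eq_bigr => i' _.
by rewrite mcoeffZ -mulrDr addrC subrK.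
Qed.

End TotalBound.

(** * From local membership to membership *)

Section Nullstellensatz.
Variable C : numClosedFieldType.
Implicit Types (p q H W Z : {mpoly C[2]}) (v : 'I_2 -> C).

Definition ideal_like (K : {mpoly C[2]} -> Prop) :=
  (forall p q, K p -> K q -> K (p + q)) /\ (forall p q, K p -> K (q * p)).

Definition vars_sub v (i : 'I_2) : {mpoly C[2]} := 'X_i - (v i)%:MP.

Lemma taylor_in_ideal v p : in_ideal (vars_sub v) (p - (p.@[v])%:MP).
Proof.
pose P p := in_ideal (vars_sub v) (p - (p.@[v])%:MP).
have PM p1 p2 : P p1 -> P p2 -> P (p1 * p2).
  move=> h1 h2; rewrite /P mevalM mpolyCM.
  have -> : p1 * p2 - p1.@[v]%:MP * p2.@[v]%:MP =
    p1 * (p2 - p2.@[v]%:MP) + p2.@[v]%:MP * (p1 - p1.@[v]%:MP) by ring.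
  by apply: in_idealD; apply: in_idealM.
have PC c : P c%:MP by rewrite /P mevalC subrr; apply: in_ideal0.
have PX i : P 'X_i by rewrite /P mevalXU; apply: (in_ideal_gen (vars_sub v)).
have PXn i n : P ('X_i ^+ n).
  by elim: n => [|n IHn]; rewrite ?expr0 ?exprS; [apply: PC | apply: PM].
have Pm m : P 'X_[m].
  by rewrite mpolyXE_id; elim/big_ind: _ => [||i _]; [apply: PC | apply: PM | apply: PXn].
suff : P p by [].
elim/mpolyind: p => [|a m q _ _ Pq]; first by rewrite /P meval0 subr0; apply: in_ideal0.
rewrite /P mevalD mpolyCD -mul_mpolyC opprD addrACA; apply: in_idealD => //.
exact: PM.
Qed.

Lemma ideal_strip K k a Z : ideal_like K -> (exists W, K (1 - ('X_k - a%:MP) * W)) ->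
  K (('X_k - a%:MP) * Z) -> K Z.
Proof.
move=> [KD KM] [W KW] KZ.
have -> : Z = Z * (1 - ('X_k - a%:MP) * W) + W * (('X_k - a%:MP) * Z) by ring.
by apply: KD; apply: KM.
Qed.

Lemma ideal_strip_univ K k (D : {poly C}) : ideal_like K -> D != 0 -> K (univ k D) ->
  (forall a, exists W, K (1 - ('X_k - a%:MP) * W)) -> K 1.
Proof.
move=> iK D0; have [s ->] := closed_field_poly_normal D.
rewrite -mul_polyC univM univC => KD strip.
have {KD} : K (univ k (\prod_(z <- s) ('X - z%:P)) * 1).
  have := iK.2 _ (lead_coef D)^-1%:MP KD.
  by rewrite mulrA -mpolyCM mulVf ?lead_coef_eq0 // mul1r mulr1.
elim: s (1 : {mpoly C[2]}) => [|z s IHs] Z; first by rewrite big_nil univC mul1r.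
rewrite big_cons univM -mulrA univ_XsubC => KZ.
by apply: IHs; apply: ideal_strip iK (strip z) KZ.
Qed.

(** If every x_0 - a is invertible modulo K, the linear factors of D can be cancelled one by one
    until 1 remains. Invertibility means that K + (x_0 - a) contains 1; this follows in the same way
    from D', using an element of K that does not vanish at (a, b). *)
Lemma weak_nullstellensatz K (D D' : {poly C}) : ideal_like K -> D != 0 -> D' != 0 ->
  K (univ 0 D) -> K (univ 1 D') -> (forall v, exists H, K H /\ H.@[v] != 0) -> K 1.
Proof.
move=> iK D0 D'0 KD KD' nz; have [KA KM] := iK.
apply: (ideal_strip_univ iK D0 KD) => a.
pose Ka H := exists W, K (H - ('X_0 - a%:MP) * W).
have KKa H : K H -> Ka H by move=> KH; exists 0; rewrite mulr0 subr0.
have iKa : ideal_like Ka.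
  split=> [p q [W KW] [W' KW']|p q [W KW]].
    exists (W + W'); have -> : p + q - ('X_0 - a%:MP) * (W + W') =
      (p - ('X_0 - a%:MP) * W) + (q - ('X_0 - a%:MP) * W') by ring.
    exact: KA.
  exists (q * W); have -> : q * p - ('X_0 - a%:MP) * (q * W) = q * (p - ('X_0 - a%:MP) * W) by ring.
  exact: KM.
suff [W KW] : Ka 1 by exists W.
apply: (ideal_strip_univ iKa D'0 (KKa _ KD')) => b.
pose v (i : 'I_2) := if i == 0 then a else b.
have [H [KH Hv]] := nz v; have [c cE] := taylor_in_ideal v H.
have {cE} HE : H = H.@[v]%:MP + c 0 * ('X_0 - a%:MP) + c 1 * ('X_1 - b%:MP).
  move/eqP: cE; rewrite subr_eq big_ord_recl big_ord1 => /eqP {1}->.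
  have -> : lift ord0 ord0 = 1 :> 'I_2 by apply: val_inj.
  by rewrite /vars_sub /v /=; ring.
have ku : (H.@[v]^-1)%:MP * (H.@[v])%:MP = 1 :> {mpoly C[2]} by rewrite -mpolyCM mulVf.
(* Dividing the expansion of H at v by its value there writes 1 as an element of K plus multiples of
   x_0 - a and x_1 - b. *)
exists (- (H.@[v]^-1)%:MP * c 1); exists ((- (H.@[v]^-1)%:MP) * c 0).
have -> : 1 - ('X_1 - b%:MP) * (- (H.@[v]^-1)%:MP * c 1)
   - ('X_0 - a%:MP) * (- (H.@[v]^-1)%:MP * c 0) = (H.@[v]^-1)%:MP * H.
  by rewrite {4}HE -ku; ring.
exact: KM.
Qed.

Lemma meval_univ v k (D : {poly C}) : (univ k D).@[v] = D.[v k].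
Proof.
rewrite univE raddf_sum horner_coef /=; apply: eq_bigr => i _.
by rewrite mevalZ rmorphXn /= mevalXU.
Qed.

(* The ideal quotient (I : p) has no zeros, hence contains 1. *)
Lemma local_global n (I : 'I_n -> {mpoly C[2]}) p : thin I ->
  (forall v, (forall i, (I i).@[v] = 0) -> forall m, exists q, in_ideal I q /\
     in_ideal (fun i => vars_sub v i ^+ m) (p - q)) ->
  in_ideal I p.
Proof.
move=> tI loc; pose K H := in_ideal I (H * p).
have iK : ideal_like K.
  split=> [H H' KH KH'|H q KH]; first by rewrite /K mulrDl; apply: in_idealD.
  by rewrite /K -mulrA; apply: in_idealM.
have IK H : in_ideal I H -> K H by move=> IH; rewrite /K mulrC; apply: in_idealM.
have [D [D0 ID]] := tI 0; have [D' [D'0 ID']] := tI 1.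
suff : K 1 by rewrite /K mul1r.
apply: (weak_nullstellensatz iK D0 D'0 (IK _ ID) (IK _ ID')) => v.
have [[i Iv]|allz] := pselect (exists i, (I i).@[v] != 0).
  by exists (I i); split=> //; apply: IK; apply: in_ideal_gen.
have {}allz i : (I i).@[v] = 0.
  by apply/eqP; rewrite -[_ == _]negbK; apply/negP => nz; apply: allz; exists i.
(* Splitting off the multiplicities leaves cofactors E and E' that do not vanish at v.
   Multiplication by E(x_0) E'(x_1) turns the powers (x_0 - v_0)^mu and (x_1 - v_1)^nu into
   multiples of the eliminants, which are in I; approximating p to order mu + nu is therefore
   enough. *)
have [mu [E Ea DE]] := multiplicity_XsubC D (v 0).
have [nu [E' E'a D'E]] := multiplicity_XsubC D' (v 1).
rewrite D0 /= in Ea; rewrite D'0 /= in E'a.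
have [q [Iq [c cE]]] := loc v allz (mu + nu)%N.
exists (univ 0 E * univ 1 E'); split; last first.
  by rewrite mevalM !meval_univ mulf_neq0.
have uX k m : univ k (('X - (v k)%:P) ^+ m) = vars_sub v k ^+ m.
  by elim: m => [|m IHm]; rewrite ?expr0 ?univC // !exprS univM IHm univ_XsubC.
have D0E : univ 0 D = univ 0 E * vars_sub v 0 ^+ mu by rewrite DE univM uX.
have D1E : univ 1 D' = univ 1 E' * vars_sub v 1 ^+ nu by rewrite D'E univM uX.
move/eqP: cE; rewrite subr_eq big_ord_recl big_ord1 => /eqP pE; rewrite /K pE.
have -> : lift ord0 ord0 = 1 :> 'I_2 by apply: val_inj.
rewrite -[ord0]/(0 : 'I_2) !exprD.
have -> : univ 0 E * univ 1 E' * (c 0 * (vars_sub v 0 ^+ mu * vars_sub v 0 ^+ nu)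
      + c 1 * (vars_sub v 1 ^+ mu * vars_sub v 1 ^+ nu) + q) =
   (univ 1 E' * c 0 * vars_sub v 0 ^+ nu) * (univ 0 E * vars_sub v 0 ^+ mu)
   + (univ 0 E * c 1 * vars_sub v 1 ^+ mu) * (univ 1 E' * vars_sub v 1 ^+ nu)
   + (univ 0 E * univ 1 E') * q by ring.
rewrite -D0E -D1E; apply: in_idealD; last exact: in_idealM.
by apply: in_idealD; apply: in_idealM.
Qed.

End Nullstellensatz.

(** * The affine chart and the translations of its points to the origin *)

Section AffineChart.
Variable C : numClosedFieldType.
Implicit Types (F : {mpoly C[3]}) (p q : {mpoly C[2]}) (v : 'I_2 -> C).

Definition affine_point v (i : 'I_3) : C := if unlift ord0 i is Some k then v k else 1.

Lemma affine_point0 v : affine_point v ord0 = 1.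
Proof. by rewrite /affine_point unlift_none. Qed.

Lemma localize_affine v F : localize ord0 (affine_point v) F =
  dehom F \mPo [tuple (v i)%:MP + 'X_i | i < 2].
Proof.
rewrite /dehom !localizeE; elim/mpolyind: F => [|a m F _ _ IHF]; first by rewrite !raddf0.
rewrite !raddfD /= IHF !comp_mpolyZ; congr (_ *: _ + _).
rewrite !comp_mpolyX rmorph_prod; apply: eq_bigr => i _; rewrite rmorphXn /= !tnth_mktuple.
congr (_ ^+ _); rewrite /affine_point; case: (unlift ord0 i) => [k|]; last by rewrite rmorph1.
by rewrite raddfD /= comp_mpolyC mpolyC0 add0r comp_mpolyXU -tnth_nth tnth_mktuple.
Qed.

Definition untranslate v p := p \mPo [tuple 'X_i - (v i)%:MP | i < 2].

Lemma untranslateM v p q : untranslate v (p * q) = untranslate v p * untranslate v q.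
Proof. exact: rmorphM. Qed.

Lemma untranslate_localize v F : untranslate v (localize ord0 (affine_point v) F) = dehom F.
Proof.
rewrite localize_affine /untranslate; elim/mpolyind: (dehom F) => [|a m p _ _ IHp].
  by rewrite !raddf0.
rewrite !raddfD /= IHp !comp_mpolyZ; congr (_ *: _ + _).
rewrite comp_mpolyX rmorph_prod [RHS]mpolyXE_id; apply: eq_bigr => i _.
rewrite rmorphXn /= tnth_mktuple raddfD /= comp_mpolyC comp_mpolyXU -tnth_nth tnth_mktuple.
by rewrite addrC subrK.
Qed.

Lemma untranslate_ideal v n (I J : 'I_n -> {mpoly C[2]}) p :
  (forall i, untranslate v (I i) = J i) -> in_ideal I p -> in_ideal J (untranslate v p).
Proof.
move=> IJ [c ->]; exists (fun i => untranslate v (c i)).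
rewrite /untranslate raddf_sum; apply: eq_bigr => i _ /=.
by rewrite -IJ; exact: untranslateM.
Qed.

Lemma untranslate_gradient v F i :
  untranslate v (gradient (localize ord0 (affine_point v) F) i) = gradient (dehom F) i.
Proof.
rewrite /gradient; case: (unlift ord0 i) => [k|]; last exact: untranslate_localize.
by rewrite mderiv_localize untranslate_localize dehom_mderiv.
Qed.

Lemma untranslate_power_vars v m i : untranslate v (power_vars C m i) = vars_sub v i ^+ m.
Proof.
by rewrite /untranslate /power_vars rmorphXn /= comp_mpolyXU -tnth_nth tnth_mktuple.
Qed.

End AffineChart.

(** * Smoothness at infinity: removing powers of x_0 *)

Section SmoothAtInfinity.
Variable C : numClosedFieldType.
Variables (e r r' : nat) (w a b : 'I_3 -> {mpoly C[3]}) (c : C).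
Hypotheses (nd : nondegenerate_on (infinity_line (C := C)) e w) (hw : forall i, w i \is e.-homog).
Hypotheses (ha : forall i, a i \is r.-homog) (hb : forall i, b i \is r'.-homog).
Hypotheses (rr' : (r + r' = e)%N) (sa : syzygy w a) (sb : syzygy w b) (c0 : c != 0).
Hypothesis ab : forall i, cross a b i = c%:MP * w i.

Lemma jacobian_saturated s j x F : (forall i, x i \is (s + j).-homog) ->
  \sum_i x i * w i = 'X_0 ^+ j * F ->
  exists y, (forall i, y i \is s.-homog) /\ \sum_i y i * w i = F.
Proof.
elim: j x => [|j IHj] x hx; first by rewrite addn0 in hx; rewrite mul1r => xE; exists x.
rewrite exprS -mulrA => xE.
have [y [hy yE]] := line_regular (infinity_line_restriction C) nd hw ha hb rr' sa sb c0 ab hx xE.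
by apply: IHj yE => i; move: (hy i); rewrite addnS.
Qed.

(** Lifting the coefficients of the affine relation to a common degree s + j gives x_0^j F in J, and
    x_0 is a nonzerodivisor modulo J. *)
Lemma jacobian_of_dehom s F : F \is (s + e).-homog ->
  in_ideal (fun i => dehom (w i)) (dehom F) ->
  exists y, (forall i, y i \is s.-homog) /\ \sum_i y i * w i = F.
Proof.
move=> hF [q qE]; pose j := (\sum_i msize (q i))%N.
have /choice[x hx] i : exists G, G \is (s + j).-homog /\ dehom G = q i.
  by apply: dehom_lift; rewrite /j (bigD1 i) //= leqW // addnCA leq_addr.
apply: (@jacobian_saturated s j x) => [i|]; first by case: (hx i).
apply: (@dehom_inj _ (s + j + e)).
- by apply: rpred_sum => i _; apply: dhomogM; [case: (hx i) | apply: hw].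
- have -> : (s + j + e = 1 * j + (s + e))%N by lia.
  by apply: dhomogM => //; apply: dhomogMn; rewrite dhomogX /= mdeg1.
rewrite rmorphM rmorphXn /= dehom_X0 expr1n mul1r qE raddf_sum /=.
by apply: eq_bigr => i _; rewrite rmorphM /=; case: (hx i) => _ ->.
Qed.

End SmoothAtInfinity.

(** * Local Tjurina numbers: finiteness and positivity *)

Section LocalTjurina.
Variable R : realType.
Local Notation C := R[i].
Local Notation sigma := (@series_of_mpoly R).
Local Notation coord := (@Defs.coord R).
Implicit Types (p : @P2 R).

Lemma maximal_independent_span (h : {mpoly C[2]}) n (u : 'I_n -> @series R) v :
  (forall k, convergent (u k)) -> independent_mod (tjurina_ideal (sigma h)) u ->
  (forall m (u' : 'I_m -> @series R), (forall k, convergent (u' k)) ->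
     independent_mod (tjurina_ideal (sigma h)) u' -> (m <= n)%N) ->
  convergent v ->
  exists c : 'I_n -> C, tjurina_ideal (sigma h) (fun i j => v i j - \sum_k c k * u k i j).
Proof.
move=> cu iu maxu cv.
pose u' (k : 'I_n.+1) := if unlift ord0 k is Some k' then u k' else v.
have u'S k : u' (lift ord0 k) = u k by rewrite /u' liftK.
have u'0 : u' ord0 = v by rewrite /u' unlift_none.
have : ~ independent_mod (tjurina_ideal (sigma h)) u'.
  move=> iu'; have cu' k : convergent (u' k) by rewrite /u'; case: unlift.
  by have := maxu _ u' cu' iu'; rewrite ltnn.
move=> /existsNP[c /not_implyP[Tc /existsNP[k0 /eqP ck0]]].
have [c00|c0] := eqVneq (c ord0) 0.
  have cS k : c (lift ord0 k) = 0.
    apply: (iu (fun k => c (lift ord0 k))); congr (tjurina_ideal _): Tc.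
    apply/funext => i; apply/funext => j; rewrite big_ord_recl c00 mul0r add0r.
    by apply: eq_bigr => k' _; rewrite u'S.
  by case/eqP: ck0; case: (unliftP ord0 k0) => [k|] ->.
exists (fun k => - (c ord0)^-1 * c (lift ord0 k)).
have := tjurina_idealZ (c ord0)^-1 Tc; congr (tjurina_ideal _).
apply/funext => i; apply/funext => j; rewrite big_ord_recl u'0 mulrDr mulrA mulVf // mul1r.
congr (_ + _); rewrite mulr_sumr -sumrN; apply: eq_bigr => k _.
by rewrite u'S !mulNr opprK mulrA.
Qed.

Variables (d : nat) (f : {mpoly C[3]}) (B : int).
Hypothesis hf : f \is d.-homog.
Local Notation e := d.-1.
Local Notation w := (partials f).
Hypothesis codim_le : exists s0, forall s, (s0 <= s)%N ->
  ('C(s + e + 2, 2))%:Z - (\dim (limg (syz_map e w s)))%:Z <= B.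

Definition attained p n (u : 'I_n -> @series R) :=
  [/\ forall k, convergent (u k),
     independent_mod (tjurina_ideal (sigma (local_eq_proj f p))) u,
     local_tjurina (sigma (local_eq_proj f p)) = (n%:R : R)%:E
   & forall m (u' : 'I_m -> @series R), (forall k, convergent (u' k)) ->
     independent_mod (tjurina_ideal (sigma (local_eq_proj f p))) u' -> (m <= n)%N].

(** The bound for families of points, used for a single point, limits the size of independent
    families; the supremum is then a maximum. *)
Lemma local_tjurina_attained p : exists n (u : 'I_n -> @series R), attained p u.
Proof.
set T := tjurina_ideal (sigma (local_eq_proj f p)).
pose Q n := `[< exists u : 'I_n -> @series R, (forall k, convergent (u k)) /\ independent_mod T u >].
have Q0 : Q 0%N by apply/asboolP; exists (fun _ _ _ => 0); split=> [[]|c _ []].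
have Qle n : Q n -> (n <= `|B|)%N.
  move=> /asboolP[u [cu iu]].
  have := @total_bound R d f B hf codim_le 1 (fun=> p) (fun=> n) (fun=> u).
  rewrite big_ord1 => h; have {}h : n%:Z <= B.
    by apply: h => // a b _; rewrite !ord1.
  by lia.
have [n Qn maxn] := @ex_maxnP Q _ (ex_intro (fun n : nat => is_true (Q n)) 0%N Q0) Qle.
have /asboolP[u [cu iu]] := Qn.
have maxu m (u' : 'I_m -> @series R) : (forall k, convergent (u' k)) ->
    independent_mod T u' -> (m <= n)%N.
  by move=> cu' iu'; apply: maxn; apply/asboolP; exists u'.
exists n, u; split=> //; apply/eqP; rewrite eq_le; apply/andP; split.
  apply: ge_ereal_sup => _ [m [u' [cu' iu']] <-].
  by rewrite lee_fin ler_nat; apply: maxu iu'.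
by apply: ereal_sup_ubound; exists n => //; exists u.
Qed.

(** The class of 1 is not zero, as all generators of the ideal have zero constant term at a singular
    point. *)
Lemma local_tjurina_singular p n (u : 'I_n -> @series R) :
  sing_proj f p -> attained p u -> (0 < n)%N.
Proof.
move=> [fp dfp] [_ _ _ maxu]; apply: (maxu 1%N (fun=> sigma 1)).
  by move=> _; apply: convergent_mpoly.
move=> c Tc k; rewrite ord1; move: Tc => [a1 [a2 [a3 [_ _ _ /(_ 0%N 0%N)]]]].
rewrite big_ord1 series_d1_mpoly series_d2_mpoly /series_mul !big_ord1 !subnn.
have c00 q : sigma q 0%N 0%N = q@_0.
  rewrite /series_of_mpoly; congr (_@__); apply/mnmP => -[[|[|]]] // ?;
  by rewrite mnm0E multinomE (tnth_nth 0%N).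
rewrite !c00 mcoeff1 eqxx mulr1 local_eq_projE.
have cj := coord_chart p.
rewrite !mderiv_localize !mcoeff0_localize // fp !dfp !mulr0 !addr0.
by have -> : ord0 = 0 :> 'I_1 by apply: val_inj.
Qed.

End LocalTjurina.

(** * Affine points inside the projective plane *)

Section AffinePoints.
Variable R : realType.
Local Notation C := R[i].
Local Notation coord := (@Defs.coord R).
Local Notation sigma := (@series_of_mpoly R).

Lemma embed_subproof (v : 'rV[C]_2) :
  (\row_i affine_point (v ord0) i : 'rV[C]_3) ord0 (chart (\row_i affine_point (v ord0) i)) == 1.
Proof.
have c0 : chart (\row_i affine_point (v ord0) i : 'rV[C]_3) = 0.
  by rewrite /chart mxE (affine_point0 (v ord0)) oner_eq0.
by rewrite c0 mxE (affine_point0 (v ord0)).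
Qed.

Definition embed (v : 'rV[C]_2) : @P2 R :=
  exist (fun p : 'rV[C]_3 => p ord0 (chart p) == 1) _ (embed_subproof v).

Lemma coord_embed v i : coord (embed v) i = affine_point (v ord0) i.
Proof. by rewrite /Defs.coord /= mxE. Qed.

Lemma chart_embed v : chart (val (embed v)) = ord0.
Proof.
rewrite /chart -[_ ord0 0]/(coord (embed v) 0) coord_embed.
by rewrite (affine_point0 (v ord0)) oner_eq0 /=; apply: val_inj.
Qed.

Lemma embed_inj : injective embed.
Proof.
move=> u v uv; apply/rowP => k; have := coord_embed u (lift ord0 k).
by rewrite uv coord_embed /affine_point liftK.
Qed.

Lemma embed_surj (p : @P2 R) : coord p 0 != 0 -> exists v, embed v = p.
Proof.
move=> p0; have cp : chart (val p) = 0 by rewrite /chart -[_ ord0 0]/(coord p 0) p0.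
have p1 : coord p ord0 = 1 by have := coord_chart p; rewrite cp.
exists (\row_k coord p (lift ord0 k)); apply/val_inj/rowP => i.
rewrite -[LHS]/(coord (embed _) i) -[RHS]/(coord p i) coord_embed /affine_point.
by case: (unliftP ord0 i) => [k|] ->; rewrite ?mxE.
Qed.

Lemma coord0_embed v : coord (embed v) 0 = 1.
Proof. by rewrite coord_embed (affine_point0 (v ord0)). Qed.

Variables (d : nat) (f : {mpoly C[3]}).
Hypotheses (hf : f \is d.-homog) (d_gt0 : (0 < d)%N).

Lemma meval_dehom (F : {mpoly C[3]}) v : (dehom F).@[v] = F.@[affine_point v].
Proof.
rewrite /dehom localizeE comp_mpoly_meval; apply: meval_eq => i.
rewrite tnth_mktuple /affine_point; case: (unlift ord0 i) => [k|]; last by rewrite meval1.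
by rewrite mevalD mevalC mevalXU add0r.
Qed.

Lemma local_eq_embed v : local_eq_proj f (embed v) = local_eq_aff (dehom f) v.
Proof.
have cE : coord (embed v) = affine_point (v ord0) by apply/funext => i; apply: coord_embed.
rewrite local_eq_projE chart_embed cE; exact: localize_affine.
Qed.

Lemma sing_projE (p : @P2 R) : sing_proj f p <-> forall i, (partials f i).@[coord p] = 0.
Proof.
split=> [[]//|h]; split=> //.
have dC : (d%:R : C) != 0 by rewrite pnatr_eq0 -lt0n.
have := congr1 (meval (coord p)) (euler hf); rewrite mevalZ raddf_sum big1 /=; last first.
  by move=> i _; rewrite mevalM h mulr0.
by move/esym/eqP; rewrite mulf_eq0 (negPf dC) /= => /eqP.
Qed.

Lemma sing_embed v : sing_proj f (embed v) <-> sing_aff (dehom f) v.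
Proof.
have E F : F.@[coord (embed v)] = (dehom F).@[v ord0].
  by rewrite meval_dehom; apply: meval_eq => i; rewrite coord_embed.
rewrite sing_projE; split=> [h|[h0 h] i].
  split=> [|k]; last by rewrite -dehom_mderiv -E; apply: h.
  by have [fp _] := (sing_projE (embed v)).2 h; rewrite -E.
rewrite E /partials; case: (unliftP ord0 i) => [k|] ->; first by rewrite dehom_mderiv.
rewrite (dehom_mderiv0 hf) mevalB mevalZ h0 mulr0 (raddf_sum (meval (v ord0))) big1 ?subr0 //= => k _.
by rewrite mevalM h mulr0.
Qed.

Lemma sing_aff_finite : thin (gradient (dehom f)) -> exists M (pt : 'I_M -> 'rV[C]_2),
  [/\ injective pt, forall a, sing_aff (dehom f) (pt a)
    & forall v, sing_aff (dehom f) v -> exists a, pt a = v].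
Proof.
move=> tg; have [D [D0 ID]] := tg 0; have [D' [D'0 ID']] := tg 1.
have [rD eD] := closed_field_poly_normal D; have [rD' eD'] := closed_field_poly_normal D'.
pose mk (z : C * C) : 'rV[C]_2 := \row_i if i == 0 then z.1 else z.2.
pose s := undup [seq v <- [seq mk (x, y) | x <- rD, y <- rD'] | `[< sing_aff (dehom f) v >]].
have gen v : sing_aff (dehom f) v -> forall q, in_ideal (gradient (dehom f)) q -> q.@[v ord0] = 0.
  move=> [h0 h] q [c ->]; rewrite raddf_sum big1 //= => i _; rewrite mevalM /gradient.
  by case: (unlift ord0 i) => [k|]; rewrite ?h ?h0 mulr0.
have ins v : sing_aff (dehom f) v -> v \in s.
  move=> sv; rewrite mem_undup mem_filter; apply/andP; split; first exact/asboolP.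
  have -> : v = mk (v ord0 0, v ord0 1).
    by apply/rowP => i; rewrite mxE; case: i => [[|[|]]] //= ?; congr (v _ _); apply: val_inj.
  apply: allpairs_f.
    have := gen v sv _ ID; rewrite meval_univ => /rootP.
    by rewrite eD rootZ ?lead_coef_eq0 // root_prod_XsubC.
  have := gen v sv _ ID'; rewrite meval_univ => /rootP.
  by rewrite eD' rootZ ?lead_coef_eq0 // root_prod_XsubC.
exists (size s), (fun a => nth 0 s a); split.
- move=> a b /eqP; rewrite nth_uniq ?undup_uniq // => /eqP ab; exact: val_inj.
- move=> a; have := mem_nth 0 (ltn_ord a); rewrite mem_undup mem_filter.
  by case/andP=> /asboolP.
move=> v /ins vs; have vi : (index v s < size s)%N by rewrite index_mem.
by exists (Ordinal vi); rewrite nth_index.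
Qed.

(** At each point (0 : 1 : t) some partial derivative is not zero, which gives the Bezout relation;
    at (0 : 0 : 1) one is not zero, and it keeps its full degree on the line. *)
Lemma smooth_nondegenerate : smooth_at_infinity f ->
  nondegenerate_on (infinity_line (C := C)) d.-1 (partials f).
Proof.
move=> sm.
have key (x : 'I_3 -> C) : x 0 = 0 -> x 1 = 1 \/ x 1 = 0 /\ x ord_max = 1 ->
    exists i, (partials f i).@[x] != 0.
  move=> x0 x12; pose v : 'rV[C]_3 := \row_i x i.
  have vE i : v ord0 i = x i by rewrite mxE.
  have vP : v ord0 (chart v) == 1.
    case: x12 => [x1|[x1 x2]].
      have -> : chart v = 1 by rewrite /chart !vE x0 x1 eqxx oner_eq0.
      by rewrite vE x1.
    have -> : chart v = ord_max by rewrite /chart !vE x0 x1 eqxx.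
    by rewrite vE x2.
  pose p : @P2 R := exist (fun p : 'rV[C]_3 => p ord0 (chart p) == 1) v vP.
  have pE : coord p = x by apply/funext => i; rewrite -vE.
  apply/not_existsP => allz; apply: (sm p); first by rewrite pE.
  apply/sing_projE => i; rewrite pE.
  by apply/eqP; rewrite -[_ == _]negbK; apply/negP/allz.
split.
  apply: poly_unimodular => t.
  have [||i hi] := key (fun i => (infinity_point C i).[t]).
  - exact: horner0.
  - by left; rewrite /infinity_point hornerC.
  by exists i; rewrite horner_infinity_line.
have [||i hi] := key (fun i => (i == ord_max)%:R); rewrite //; first by right.
have hw : partials f i \is d.-1.-homog by apply: dhomog_mderiv.
exists i; apply/anti_leq; have [_ _ sz _ _] := infinity_line_restriction C.
rewrite (sz _ _ hw) /= ltnNge; apply: contraNN hi => le.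
apply/eqP; transitivity (infinity_line (partials f i))`_d.-1.
  by rewrite (coef_infinity_line_top hw).
by rewrite nth_default.
Qed.

End AffinePoints.

Lemma exists_left_kernel (K : fieldType) N (I : finType) (A : 'I_N -> I -> K) : (#|I| < N)%N ->
  exists c : 'I_N -> K, (exists l, c l != 0) /\ forall x, \sum_l c l * A l x = 0.
Proof.
move=> IN; pose M := \matrix_(l < N, k < #|I|) A l (enum_val k).
have : kermx M != 0.
  by rewrite kermx_eq0 /row_free neq_ltn (leq_ltn_trans (rank_leq_col M) IN).
case/rowV0Pn => v /sub_kermxP vM v0; exists (v ord0); split.
  by apply/existsP; apply: contraNT v0 => /existsPn v0; apply/eqP/rowP => l; rewrite mxE; apply/eqP/negbNE.
move=> x; have := congr1 (fun B : 'rV_ _ => B ord0 (enum_rank x)) vM; rewrite !mxE => {}vM.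
by rewrite -[RHS]vM; apply: eq_bigr => l _; rewrite mxE enum_rankK.
Qed.

(** * Lower bound: the affine germs detect the jacobian ideal *)

Section LowerBound.
Variable R : realType.
Local Notation C := R[i].
Local Notation sigma := (@series_of_mpoly R).
Variables (d r r' : nat) (f : {mpoly C[3]}) (a b : 'I_3 -> {mpoly C[3]}) (c : C).
Hypotheses (hf : f \is d.-homog) (d_gt0 : (0 < d)%N) (tf : thin (gradient (dehom f))).
Hypothesis sm : smooth_at_infinity f.
Local Notation e := d.-1.
Local Notation w := (partials f).
Hypotheses (ha : forall i, a i \is r.-homog) (hb : forall i, b i \is r'.-homog).
Hypotheses (rr' : (r + r' = e)%N) (sa : syzygy w a) (sb : syzygy w b) (c0 : c != 0).
Hypothesis ab : forall i, cross a b i = c%:MP * w i.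
Local Notation germ v := (localize ord0 (affine_point (v ord0))).

Let hw i : w i \is e.-homog. Proof. exact: dhomog_mderiv. Qed.

(** Affine membership is tested at the zeros of the polynomial and its derivatives, which are the
    affine singular points; there the analytic hypothesis is made algebraic up to high powers and
    translated back from the origin. *)
Lemma jacobian_of_germs s F : F \is (s + e).-homog ->
  (forall v : 'rV[C]_2, sing_aff (dehom f) v ->
     tjurina_ideal (sigma (germ v f)) (sigma (germ v F))) ->
  exists y, (forall i, y i \is s.-homog) /\ \sum_i y i * w i = F.
Proof.
move=> hF TF; apply: (jacobian_of_dehom (smooth_nondegenerate hf d_gt0 sm) hw ha hb rr' sa sb c0 ab hF).
suff : in_ideal (gradient (dehom f)) (dehom F).
  by apply: in_ideal_trans => i; apply: gradient_dehom_grad hf d_gt0.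
apply: local_global => // v0 hv m.
pose v : 'rV[C]_2 := \row_i v0 i.
have vE : v ord0 = v0 by apply/funext => i; rewrite mxE.
have sv : sing_aff (dehom f) v.
  split=> [|k]; rewrite vE; first by have := hv ord0; rewrite /gradient unlift_none.
  by have := hv (lift ord0 k); rewrite /gradient liftK.
have [q [qI qV]] := mem_tjurina_ideal_mpoly m (TF v sv).
exists (untranslate v0 q); split.
  by apply: untranslate_ideal qI => i; rewrite -vE; apply: untranslate_gradient.
rewrite -(untranslate_localize v0 F).
have -> : untranslate v0 (localize ord0 (affine_point v0) F) - untranslate v0 q =
    untranslate v0 (germ v F - q) by rewrite vE /untranslate raddfB.
by apply: untranslate_ideal qV => i; apply: untranslate_power_vars.
Qed.

(** Let U be a complement of J in degree s + e. If dim U exceeded the sum, the coordinates of the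
    germs at all points would be fewer linear conditions than dim U, and some nonzero element of U
    would have all its germs in the Tjurina ideals, hence lie in J. *)
Lemma codim_le_total s M (pt : 'I_M -> 'rV[C]_2) (n : 'I_M -> nat)
    (u : forall x, 'I_(n x) -> @series R) :
  (forall v, sing_aff (dehom f) v -> exists x, pt x = v) ->
  (forall x, attained f (embed (pt x)) (u x)) ->
  ('C(s + e + 2, 2) <= \sum_x n x + \dim (limg (syz_map e w s)))%N.
Proof.
move=> ptP attu.
pose U : {vspace gspace C 1 (s + e)} := (limg (syz_map e w s))^C%VS.
have dimU : (\dim U + \dim (limg (syz_map e w s)) = 'C(s + e + 2, 2))%N.
  rewrite dimv_compl dim_gspace mul1n subnK // -[X in (_ <= X)%N]mul1n -(@dim_gspace C).
  exact/dimvS/subvf.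
rewrite -dimU leq_add2r leqNgt; apply/negP => ltU.
pose X := vbasis U; pose F l := gval X`_l ord0.
pose I : finType := {x : 'I_M & 'I_(n x)}.
have cardI : #|{: I}| = (\sum_x n x)%N.
  rewrite card_tagged sumnE big_map big_enum; apply: eq_bigr => x _.
  by rewrite card_ord.
have germE x : local_eq_proj f (embed (pt x)) = germ (pt x) f.
  rewrite local_eq_projE chart_embed; congr localize.
  by apply/funext => i; apply: coord_embed.
have cof (l : 'I_(\dim U)) x : exists k : 'I_(n x) -> C,
    tjurina_ideal (sigma (germ (pt x) f))
      (fun i j => sigma (germ (pt x) (F l)) i j - \sum_t k t * u x t i j).
  have [cu iu _ maxu] := attu x; rewrite germE in iu maxu.
  by apply: maximal_independent_span => //; apply: convergent_mpoly.
pose A l (z : I) : C := sval (cid (cof l (tag z))) (tagged z).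
have [lam [[l0 /eqP lam0] lamA]] : exists lam : 'I_(\dim U) -> C,
    (exists l, lam l != 0) /\ forall z, \sum_l lam l * A l z = 0.
  by apply: exists_left_kernel; rewrite cardI.
apply: lam0.
pose G : {mpoly C[3]} := \sum_l lam l *: F l.
have hG : G \is (s + e).-homog by apply: rpred_sum => l _; apply/rpredZ/gval_homog.
have germG v i j : sigma (germ v G) i j = \sum_l lam l * sigma (germ v (F l)) i j.
  rewrite /G (raddf_sum (germ v)) {1}/series_of_mpoly raddf_sum.
  by apply: eq_bigr => l _; rewrite /= linearZ_LR mcoeffZ.
have [|y [hy yG]] := jacobian_of_germs hG.
  move=> _ /ptP[x <-].
  have := tjurina_ideal_sum lam (fun l => svalP (cid (cof l x))).
  congr (tjurina_ideal _); apply/funext => i; apply/funext => j.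
  under eq_bigr => l _ do rewrite mulrBr mulr_sumr.
  rewrite sumrB exchange_big /= [X in _ - X]big1 ?subr0; last first.
    move=> t _; under eq_bigr => l _ do rewrite mulrA.
    rewrite -mulr_suml; have := lamA (Tagged (fun x => 'I_(n x)) t); rewrite /A /= => ->.
    by rewrite mul0r.
  by rewrite germG.
pose x := \sum_l lam l *: X`_l.
have xG : gval x ord0 = G.
  by rewrite gval_sum; apply: eq_bigr => l _; rewrite gvalZ.
have xU : x \in U by apply: rpred_sum => l _; apply/rpredZ/vbasis_mem/mem_nth; rewrite size_tuple.
have xJ : x \in limg (syz_map e w s).
  apply/memv_imgP; exists (gvec s y); first exact: memvf.
  apply: gval_inj => i; rewrite ord1 xG -yG (gmapE _ _ (fun i _ => hw i) (erefl (s + e)%N)).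
  by apply: eq_bigr => k _; rewrite gvecE.
have x0 : x = 0.
  by apply/eqP; rewrite -memv0 -(capv_compl (limg (syz_map e w s))) memv_cap xJ.
by have /freeP := basis_free (vbasisP U); apply.
Qed.

End LowerBound.

(** * Comparison of the total Tjurina numbers *)

Section TotalTjurina.
Variable R : realType.
Local Notation C := R[i].
Local Notation sigma := (@series_of_mpoly R).
Local Notation coord := (@Defs.coord R).
Variables (d : nat) (f : {mpoly C[3]}) (B : int).
Hypotheses (hf : f \is d.-homog) (d_gt0 : (0 < d)%N).
Local Notation e := d.-1.
Local Notation w := (partials f).
Hypothesis codim_le : exists s0, forall s, (s0 <= s)%N ->
  ('C(s + e + 2, 2))%:Z - (\dim (limg (syz_map e w s)))%:Z <= B.
Local Notation tjurina p := (local_tjurina (sigma (local_eq_proj f p))).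

Lemma local_tjurina_ge0 (h : @series R) : (0 <= local_tjurina h)%E.
Proof.
by apply: ereal_sup_ubound; exists 0%N => //; exists (fun _ _ _ => 0); split=> [[]|c _ []].
Qed.

Lemma attained_family M (pt : 'I_M -> @P2 R) :
  exists (n : 'I_M -> nat) (u : forall x, 'I_(n x) -> @series R),
    forall x, attained f (pt x) (u x).
Proof.
have W x : {v : {n : nat & 'I_n -> @series R} | attained f (pt x) (tagged v)}.
  by apply: cid; have [n [u attu]] := local_tjurina_attained hf codim_le (pt x); exists (Tagged _ u).
by exists (fun x => tag (sval (W x))), (fun x => tagged (sval (W x))) => x; apply: svalP (W x).
Qed.

Lemma tau_proj_le : (tau_proj f <= (B%:~R)%:E)%E.
Proof.
apply: ge_ereal_sup => _ [A [finA As] <-].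
set s := finite_support _ _ _; have us : uniq s by apply: finite_support_uniq.
rewrite big_tnth; pose pt (x : 'I_(size s)) : @P2 R := tnth (in_tuple s) x.
have [n [u attu]] := attained_family pt.
have -> : (\sum_(x < size s) tjurina (tnth (in_tuple s) x) = (\sum_x n x)%N%:R%:E)%E.
  by rewrite natr_sum -sumEFin; apply: eq_bigr => x _; case: (attu x).
rewrite lee_fin -[X in X <= _]/((Posz (\sum_x n x)%N)%:~R) ler_int.
apply: (total_bound hf codim_le (pt := pt) (u := u)).
- by move=> x y /eqP; rewrite /pt !(tnth_nth (pt x)) nth_uniq // => /eqP; apply: val_inj.
- by move=> x; case: (attu x).
- by move=> x; case: (attu x).
Qed.

Lemma tau_aff_embed :
  tau_aff (dehom f) = (\esum_(p in sing_proj f `&` [set p | coord p 0%R != 0%R]%classic) tjurina p)%E.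
Proof.
rewrite /tau_aff [RHS](@reindex_esum _ _ _ (sing_aff (dehom f)) _ (@embed R)).
  by apply: eq_esum => v _; rewrite local_eq_embed.
split.
- move=> v sv; split; first exact/(sing_embed hf d_gt0).
  by rewrite /= coord0_embed oner_eq0.
- by move=> u v _ _; apply: embed_inj.
move=> p [sp /embed_surj[v vp]]; exists v => //.
by apply/(sing_embed hf d_gt0); rewrite vp.
Qed.

Lemma tau_proj_split : tau_proj f = (tau_aff (dehom f) +
  \esum_(p in sing_proj f `&` ~` [set p | coord p 0%R != 0%R]%classic) tjurina p)%E.
Proof.
rewrite tau_aff_embed /tau_proj; apply: esumID => p _; exact: local_tjurina_ge0.
Qed.

Lemma tau_aff_le_proj : (tau_aff (dehom f) <= tau_proj f)%E.
Proof.
by rewrite tau_proj_split leeDl //; apply: esum_ge0 => p _; apply: local_tjurina_ge0.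
Qed.

(** The difference is the sum over the singular points at infinity, each of which contributes at
    least 1; finiteness allows the cancellation. *)
Lemma tau_aff_eq_proj : tau_aff (dehom f) = tau_proj f <-> smooth_at_infinity f.
Proof.
split=> [E p p0 sp|sm].
  have [n [u attu]] := local_tjurina_attained hf codim_le p.
  have n0 := local_tjurina_singular sp attu.
  have fin : tau_aff (dehom f) \is a fin_num.
    rewrite fin_numElt; apply/andP; split.
      by apply: lt_le_trans (ltNyr 0) _; apply: esum_ge0 => *; apply: local_tjurina_ge0.
    by apply: le_lt_trans tau_aff_le_proj (le_lt_trans tau_proj_le (ltry _)).
  suff : (tau_aff (dehom f) + (n%:R)%:E <= tau_aff (dehom f) + 0)%E.
    by rewrite leeD2lE // lee_fin lern0 -leqn0 leqNgt n0.
  rewrite adde0 [X in (_ <= X)%E]E tau_proj_split leeD2lE //; case: attu => _ _ <- _.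
  apply: esum_ge; exists [set p]%classic; last by rewrite fsbig_set1.
  by split; [exact: finite_set1 | move=> _ ->; split=> //; rewrite /= p0 eqxx].
rewrite tau_proj_split esum1 ?adde0 // => p [sp /= /negP]; rewrite negbK => /eqP p0.
by case: (sm p p0).
Qed.

Lemma tau_aff_ge M (pt : 'I_M -> 'rV[C]_2) (n : 'I_M -> nat)
    (u : forall x, 'I_(n x) -> @series R) : injective pt ->
  (forall x, sing_aff (dehom f) (pt x)) -> (forall x, attained f (embed (pt x)) (u x)) ->
  (((\sum_x n x)%N%:R : R)%:E <= tau_aff (dehom f))%E.
Proof.
move=> inj_pt sp attu; apply: esum_ge; exists [set` codom pt]%classic.
  split; first exact: finite_seq.
  by move=> _ /codomP[x ->].
rewrite -fsbig_seq; last by rewrite /codom /image_mem map_inj_uniq // enum_uniq.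
rewrite big_map big_enum /= natr_sum -sumEFin.
by apply: lee_sum => x _; rewrite -local_eq_embed; case: (attu x) => _ _ ->.
Qed.

End TotalTjurina.

(** * Freeness and equality when 2 r < d *)

Section FreeCase.
Variable R : realType.
Local Notation C := R[i].
Variables (d : nat) (g : {mpoly C[2]}).
Hypotheses (d_gt0 : (0 < d)%N) (deg_g : deg g = d) (red_g : reduced g).
Local Notation f := (homogenize g).
Local Notation r := (mdr_proj f).
Local Notation w := (partials f).

Lemma tau_max_free s t : (r.*2 < d)%N -> (r <= s)%N -> (s + r = t + d.-1)%N ->
  ('C(s + d.-1 + 2, 2))%:Z - (\dim (limg (syz_map d.-1 w s)))%:Z =
  tau_max d r + (\dim (syz_space d.-1 w s))%:Z - ('C(s - r + 2, 2))%:Z - ('C(t + 2, 2))%:Z.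
Proof.
move=> rd rs st; rewrite /tau_max rd -(first_formula d_gt0 rs st).
have := dim_syz_map d.-1 w s; lia.
Qed.

(** If the curve were not free, dim AR(f)_s would stay below its bound in all large degrees, so that
    dim (S/J)_k <= tau_max - 1 there; the upper bound for tau(C) with this constant contradicts its
    value. *)
Lemma free_of_tau_max : (r.*2 < d)%N -> tau_proj f = ((tau_max d r)%:~R)%:E -> free_curve f.
Proof.
move=> rd tauE; have hf := homogenize_homog deg_g red_g.
have satw := saturated_partials d_gt0 deg_g red_g.
have [a [ha sa a0 re _]] := mdr_projP d_gt0 deg_g red_g.
have sata := saturated_mdr d_gt0 deg_g red_g ha sa a0.
apply: contrapT => nfree; have := @tau_proj_le R d f (tau_max d r - 1) hf.
rewrite tauE lee_fin ler_int => le; suff : tau_max d r <= tau_max d r - 1 by lia.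
apply: le; exists (r + d)%N => s sge.
have [t st] : exists t, (s + r = t + d.-1)%N by exists (s + r - d.-1)%N; lia.
have rs : (r <= s)%N by lia.
rewrite (tau_max_free rd rs st).
suff : (\dim (syz_space d.-1 w s) < 'C(s - r + 2, 2) + 'C(t + 2, 2))%N by lia.
rewrite ltnNge; apply/negP => /(dim_syz_space_eq_exists satw sata sa rs st re)[b [_ sb ab]].
apply: nfree; apply: (free_curve_of_basis satw sata sa sb (oner_neq0 C)) => i.
by rewrite ab mul1r.
Qed.

(** A homogeneous complement of the minimal syzygy makes dim AR(f)_s reach its bound; then dim
    (S/J)_k equals tau_max, and the affine germs bound this dimension from above. *)
Lemma tau_max_le_aff : (r.*2 < d)%N -> smooth_at_infinity f -> free_curve f ->
  (((tau_max d r)%:~R)%:E <= tau_aff g)%E.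
Proof.
move=> rd sm free; have hf := homogenize_homog deg_g red_g.
have satw := saturated_partials d_gt0 deg_g red_g.
have [a [ha sa a0 re minr]] := mdr_projP d_gt0 deg_g red_g.
have sata := saturated_mdr d_gt0 deg_g red_g ha sa a0.
have [u [v [c [su sv c0 uv]]]] := basis_of_free_curve satw free.
have [b [c' [_ hb sb c'0 ab]]] := homogeneous_complement satw sata sa minr su sv c0 uv.
have tg : thin (gradient (dehom f)) by rewrite dehom_homogenize; apply: thin_reduced deg_g red_g.
have [M [pt [inj_pt sp ptP]]] := sing_aff_finite tg.
have codim := dim_jacobian_le d_gt0 deg_g red_g.
have [n [U attU]] := attained_family hf codim (fun x => embed (pt x)).
have := tau_aff_ge inj_pt sp attU; rewrite dehom_homogenize.
apply: le_trans; rewrite lee_fin -[X in _ <= X]/((Posz (\sum_x n x)%N)%:~R) ler_int.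
have [s [t [rs st]]] : exists s t, (r <= s)%N /\ (s + r = t + d.-1)%N.
  by exists (r + d)%N, (r + d + r - d.-1)%N; lia.
have := codim_le_total hf d_gt0 tg sm ha hb (subnKC re) sa sb c'0 ab s ptP attU.
have := tau_max_free rd rs st.
rewrite (dim_syz_space_eq satw sata sa rs st re hb sb c'0 ab); lia.
Qed.

End FreeCase.

Theorem corollary4p2 (R : realType) (d : nat) (g : {mpoly R[i][2]})
    (d_gt0 : (0 < d)%N) (deg_g : deg g = d) (red_g : reduced g) :
  let f := homogenize g in
  let r := mdr_aff g in
  [/\ (tau_aff g <= tau_proj f)%E
        /\ (tau_aff g = tau_proj f <-> smooth_at_infinity f),
      r = mdr_proj f,
      (tau_aff g <= ((tau_max d r)%:~R)%:E)%E
    & tau_aff g = ((tau_max d r)%:~R)%:E <->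
        smooth_at_infinity f /\
        (((r.*2 < d)%N /\ free_curve f) \/
         ((d <= r.*2)%N /\ maximal_tjurina f))].
Proof.
move=> f r; have hf : f \is d.-homog := homogenize_homog deg_g red_g.
have codim := dim_jacobian_le d_gt0 deg_g red_g.
have gE : dehom f = g := dehom_homogenize g.
have rE : r = mdr_proj f := mdr_affE d_gt0 deg_g red_g.
have aff_le : (tau_aff g <= tau_proj f)%E by rewrite -gE; apply: tau_aff_le_proj hf d_gt0.
have aff_eq : tau_aff g = tau_proj f <-> smooth_at_infinity f.
  by rewrite -{1}gE; apply: tau_aff_eq_proj hf d_gt0 codim.
have proj_le : (tau_proj f <= ((tau_max d r)%:~R)%:E)%E by rewrite rE; apply: tau_proj_le hf codim.
have df : deg f = d := deg_homogenize deg_g red_g.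
split=> //; first exact: le_trans aff_le proj_le.
split=> [affE|[sm [[rd free]|[_ [_ tauE]]]]].
(* Squeezed between tau(X) and the bound, tau(C) equals both. The first equality excludes
   singularities at infinity; the second gives freeness or, when 2 r >= d, is the definition of a
   maximal Tjurina curve. *)
- have projE : tau_proj f = ((tau_max d r)%:~R)%:E by apply/le_anti; rewrite proj_le -affE.
  split; first by apply/aff_eq; rewrite affE.
  rewrite rE in projE *; have [rd|rd] := ltnP (mdr_proj f).*2 d; [left|right]; split=> //.
    exact: free_of_tau_max projE.
  by split; rewrite df.
- apply/le_anti; rewrite (le_trans aff_le proj_le) /= rE.
  by apply: tau_max_le_aff => //; rewrite -rE.
by rewrite (aff_eq.2 sm) tauE df rE.
Qed.
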